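(* Let $\mathcal M$ be an o-minimal structure whose underlying ordered set is the real numbers, and let $G$ be a group definable in $\mathcal M$. Let $E:\ 1\rightarrow A\xrightarrow{i}\tilde G\xrightarrow{\pi} G\rightarrow 1$ be a topological central extension of $G$ (so $A$, $\tilde G$, $i$, $\pi$ are not assumed definable), and let $\mathbf G$ be an arbitrary expansion of $\langle G,\cdot\rangle$ such that: (1) $\mathbf G$ has property $\rho$; (2) for every $n$, the set $i(A)\cap[\tilde G,\tilde G]_n$ is finite; (3) there exists $r\in\mathbb N$ with $G=[G,G]_r$. Then there is an exact sequence $E':1\rightarrow A\rightarrow\tilde G'\rightarrow G\rightarrow 1$, definable (over parameters) in the two-sorted structure $\langle\mathbf G,A\rangle$, which is isomorphic in the group language to $E$, with the isomorphisms on $A$ and $G$ being the identity maps. If moreover $A$ is definable in $\mathcal M$ (so that $\tilde G'$ is endowed with the o-minimal topology), then the isomorphism between $\tilde G$ and $\tilde G'$ is also a homeomorphism.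
   Context: Standing assumption: groups definable in $\mathcal M$ are (up to definable isomorphism) subsets of some $M^n$ and carry their canonical o-minimal group topology. A topological central extension of $G$ is an exact sequence of topological groups $1\to A\xrightarrow{i}\tilde G\xrightarrow{\pi}G\to 1$ with $i,\pi$ continuous homomorphisms and $i(A)$ central in $\tilde G$; here $G$ carries its o-minimal topology. For a group $H$, $[H,H]_n$ is the set of products of $n$ commutators in $H$. An expansion $\mathbf G$ of $G$ has property $\rho$ if for every $\langle G,\cdot\rangle$-definable $X\subseteq G^n$, every definably connected component of $X$ (with respect to the group topology) is definable in $\mathbf G$, possibly with parameters. $\langle\mathbf G,A\rangle$ is the two-sorted structure of $G$ with its $\mathbf G$-structure and $A$ with its group structure.
   Formalization: Extension taken as strict: i an embedding, π open, G̃ Hausdorff; in the last claim A carries its o-minimal topology (else false, e.g. G̃=SO(3) discrete, A trivial). Definable in ⟨G,A⟩ allows a quotient by a definable equivalence relation; X in ρ may use parameters. *)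

(* Defs.v *)
From HB Require Import structures.
From mathcomp Require Import all_boot all_order all_algebra.
From mathcomp Require Import boolp classical_sets functions cardinality reals.
From mathcomp Require Import topology num_topology.

Set Implicit Arguments.
Unset Strict Implicit.
Unset Printing Implicit Defensive.

Import Order.TTheory GRing.Theory Num.Theory.
Import numFieldTopology.Exports.

Local Open Scope classical_set_scope.

Section FirstOrder.
Variables (S : Type) (U : S -> Type).

(* A first-order signature over the sorts S, together with its interpretation
   in the carriers U. *)
Record structure := Structure {
  fun_symbol : Type;
  farity : fun_symbol -> nat;
  fdom : forall f, 'I_(farity f) -> S;
  fcod : fun_symbol -> S;
  fint : forall f, (forall i, U (@fdom f i)) -> U (fcod f);
  rel_symbol : Type;
  rarity : rel_symbol -> nat;
  rdom : forall r, 'I_(rarity r) -> S;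
  rint : forall r, (forall i, U (@rdom r i)) -> Prop }.

Section Formulas.
Variables (N : structure) (V : S -> Type).

Inductive term : S -> Type :=
| Tvar s of V s : term s
| Tapp (f : fun_symbol N) of (forall i, term (@fdom N f i)) : term (fcod f).

Inductive formula : Type :=
| Feq s of term s & term s
| Frel (r : rel_symbol N) of (forall i, term (@rdom N r i))
| Fbot
| Fimp of formula & formula
| Fall s of V s & formula.

Fixpoint teval (v : forall s, V s -> U s) s (t : term s) : U s :=
  match t with
  | Tvar _ x => v _ x
  | Tapp f ts => @fint N f (fun i => teval v (ts i))
  end.

(* The quantifier ranges over the assignments w that agree with v except
   possibly at the quantified variable. *)
Fixpoint sat (v : forall s, V s -> U s) (phi : formula) : Prop :=
  match phi with
  | Feq _ t u => teval v t = teval v u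
  | Frel r ts => @rint N r (fun i => teval v (ts i))
  | Fbot => False
  | Fimp phi1 phi2 => sat v phi1 -> sat v phi2
  | Fall s x phi1 =>
      forall w : forall s, V s -> U s,
        (forall s' (y : V s'), existT V s' y <> existT V s x -> w s' y = v s' y) ->
        sat w phi1
  end.

End Formulas.

(* Definability with parameters of a subset of the product of the U s ^ (I s).
   The variables inl i stand for the coordinates; the variables inr n are used
   for the bound variables and for the parameters, whose values are given by b
   (a formula mentions only finitely many of them). *)
Definition definable (N : structure) (I : S -> finType)
    (X : set (forall s, I s -> U s)) : Prop :=
  exists (phi : formula N (fun s => (I s + nat)%type)) (b : forall s, nat -> U s),
    forall x, X x <->
      sat (fun s z => match z with inl i => x s i | inr n => b s n end) phi.

Definition join_structure (N1 N2 : structure) : structure := {|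
  fun_symbol := fun_symbol N1 + fun_symbol N2;
  farity := fun f => match f with inl f => farity f | inr f => farity f end;
  fdom := fun f => match f with inl f => @fdom N1 f | inr f => @fdom N2 f end;
  fcod := fun f => match f with inl f => fcod f | inr f => fcod f end;
  fint := fun f => match f with inl f => @fint N1 f | inr f => @fint N2 f end;
  rel_symbol := rel_symbol N1 + rel_symbol N2;
  rarity := fun r => match r with inl r => rarity r | inr r => rarity r end;
  rdom := fun r => match r with inl r => @rdom N1 r | inr r => @rdom N2 r end;
  rint := fun r => match r with inl r => @rint N1 r | inr r => @rint N2 r end
|}.

(* Up to renaming of symbols, an expansion of N0 adds new symbols to it. *)
Definition expansion (N0 N : structure) : Prop :=
  exists N1, N = join_structure N0 N1.

(* A coding presents H as a quotient of a set cdom of tuples from U: the tuple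
   x in cdom represents the element cval x of H (cval is irrelevant outside
   cdom). *)
Record coding (H : Type) := Coding {
  cidx : S -> finType;
  cdom : set (forall s, cidx s -> U s);
  cval : (forall s, cidx s -> U s) -> H }.
Arguments cidx {H} c s.
Arguments cdom {H} c x.
Arguments cval {H} c x.

Definition coding_pair (H1 H2 : Type) (c1 : coding H1) (c2 : coding H2) :
    coding (H1 * H2) := {|
  cidx := fun s => (cidx c1 s + cidx c2 s)%type : finType;
  cdom := [set x | cdom c1 (fun s i => x s (inl i)) /\
                   cdom c2 (fun s i => x s (inr i))];
  cval := fun x => (cval c1 (fun s i => x s (inl i)),
                    cval c2 (fun s i => x s (inr i)))
|}.

Definition coding_pow (J : finType) (H : Type) (c : coding H) :
    coding (J -> H) := {|
  cidx := fun s => (J * cidx c s)%type : finType;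
  cdom := [set x | forall j, cdom c (fun s i => x s (j, i))];
  cval := fun x j => cval c (fun s i => x s (j, i))
|}.

(* X is definable when the set of all representatives of its elements is. *)
Definition definable_in (N : structure) (H : Type) (c : coding H)
    (X : set H) : Prop :=
  definable N [set x | cdom c x /\ X (cval c x)].

Definition interpretable_group (N : structure) (H : groupType)
    (c : coding H) : Prop :=
  [/\ definable N (cdom c),
      forall h : H, exists2 x, cdom c x & cval c x = h,
      definable_in N (coding_pair c c) [set t | t.1 = t.2] &
      definable_in N (coding_pair (coding_pair c c) c)
        [set t | (t.1.1 * t.1.2)%g = t.2]].

(* A definable group: the carrier is a definable set of tuples, not a proper
   quotient of one. *)
Definition definable_group (N : structure) (H : groupType)
    (c : coding H) : Prop :=
  interpretable_group N c /\ set_inj (cdom c) (cval c).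

End FirstOrder.

Arguments cidx {S U H} c s.
Arguments cdom {S U H} c x.
Arguments cval {S U H} c x.
Arguments definable_in {S U} N {H} c X.
Arguments interpretable_group {S U} N {H} c.
Arguments definable_group {S U} N {H} c.

Notation structure1 T := (structure (fun _ : unit => T)).
Notation coding1 T H := (coding (fun _ : unit => T) H).

Definition self (T : Type) : coding1 T T := {|
  cidx := fun=> unit : finType;
  cdom := setT;
  cval := fun x => x tt tt
|}.

(* A group as a structure in the language with one binary function symbol. *)
Definition group_structure (H : groupType) : structure1 H := {|
  fun_symbol := unit;
  farity := fun=> 2;
  fdom := fun _ _ => tt;
  fcod := fun=> tt;
  fint := fun _ (x : 'I_2 -> H) => (x ord0 * x ord_max)%g;
  rel_symbol := void;
  rarity := fun=> 0;
  rdom := fun _ _ => tt;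
  rint := fun _ _ => False
|}.

Definition order_structure (R : realType) : structure1 R := {|
  fun_symbol := void;
  farity := fun=> 0;
  fdom := fun _ _ => tt;
  fcod := fun=> tt;
  fint := fun f _ => match f : void with end;
  rel_symbol := unit;
  rarity := fun=> 2;
  rdom := fun _ _ => tt;
  rint := fun _ (x : 'I_2 -> R) => (x ord0 < x ord_max)%R
|}.

(* Points are the degenerate intervals `[a, a]. *)
Definition ominimal (R : realType) (M : structure1 R) : Prop :=
  forall X : set R, definable_in M (self R) X ->
    exists s : seq (interval R), X = [set x | exists2 I, I \in s & x \in I].

Inductive sort2 := sG | sA.

Definition carrier2 (G A : Type) (s : sort2) : Type :=
  match s with sG => G | sA => A end.

Definition two_sorted (G A : Type) (N : structure1 G) (P : structure1 A) :
    structure (carrier2 G A) := {|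
  fun_symbol := fun_symbol N + fun_symbol P;
  farity := fun f => match f with inl f => farity f | inr f => farity f end;
  fdom := fun f _ => match f with inl _ => sG | inr _ => sA end;
  fcod := fun f => match f with inl _ => sG | inr _ => sA end;
  fint := fun f =>
    match f with inl f => @fint _ _ N f | inr f => @fint _ _ P f end;
  rel_symbol := rel_symbol N + rel_symbol P;
  rarity := fun r => match r with inl r => rarity r | inr r => rarity r end;
  rdom := fun r _ => match r with inl _ => sG | inr _ => sA end;
  rint := fun r =>
    match r with inl r => @rint _ _ N r | inr r => @rint _ _ P r end
|}.

Definition self_G (G A : Type) : coding (carrier2 G A) G := {|
  cidx := fun s => match s with sG => unit : finType | sA => void end;
  cdom := setT;
  cval := fun x => x sG tt
|}.

Definition self_A (G A : Type) : coding (carrier2 G A) A := {|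
  cidx := fun s => match s with sG => void : finType | sA => unit end;
  cdom := setT;
  cval := fun x => x sA tt
|}.

Definition point2 (G A : Type) (I : sort2 -> finType)
    (x : I sG -> G) (a : I sA -> A) (s : sort2) : I s -> carrier2 G A s :=
  match s return I s -> carrier2 G A s with sG => x | sA => a end.

HB.mixin Record isTopologicalGroup G of Group G & Topological G := {
  mulg_continuous : continuous (fun xy : G * G => (xy.1 * xy.2)%g);
  invg_continuous : continuous (fun x : G => (x^-1)%g)
}.

#[short(type="topologicalGroupType")]
HB.structure Definition TopologicalGroup :=
  {G of Group G & Topological G & isTopologicalGroup G}.

(* op is the family of open sets of a topology making H a topological group. *)
Definition group_topology (H : groupType) (op : set_system H) : Prop :=
  [/\ [/\ op setT,
          forall V W, op V -> op W -> op (V `&` W) &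
          forall (I : Type) (F : I -> set H),
            (forall i, op (F i)) -> op (\bigcup_i F i)],
      forall (x y : H) W, op W -> W (x * y)%g ->
        exists V1 V2, [/\ op V1, op V2, V1 x, V2 y &
          forall u v, V1 u -> V2 v -> W (u * v)%g] &
      forall W, op W -> op [set x : H | W (x^-1)%g]].

(* The canonical topology of a group H definable in M: by Pillay's theorem
   there is exactly one group topology on H that is given by a definable
   manifold structure, i.e. by a finite atlas whose charts phi j are
   M-definable homeomorphisms from an open set D j onto an open subset of
   R^k. *)
Definition ominimal_topology (R : realType) (M : structure1 R) (H : groupType)
    (c : coding1 R H) (op : set_system H) : Prop :=
  group_topology op /\
  exists (k m : nat) (D : 'I_m -> set H) (phi : 'I_m -> H -> ('I_k -> R)),
    (forall h, exists j, D j h) /\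
    forall j,
      [/\ op (D j),
          set_inj (D j) (phi j),
          definable_in M (coding_pair c (coding_pow 'I_k (self R)))
            [set t | D j t.1 /\ phi j t.1 = t.2] &
          forall V, V `<=` D j ->
            (op V <-> open (phi j @` V : set {ptws 'I_k -> R}))].

Section Components.
Variables (R : realType) (M : structure1 R).
Variables (G : topologicalGroupType) (c : coding1 R G) (n : nat).

Definition definably_connected (X : set ('I_n -> G)) : Prop :=
  definable_in M (coding_pow 'I_n c) X /\
  forall P Q : set ('I_n -> G),
    definable_in M (coding_pow 'I_n c) P ->
    definable_in M (coding_pow 'I_n c) Q ->
    (exists2 W : set {ptws 'I_n -> G}, open W & P = X `&` W) ->
    (exists2 W : set {ptws 'I_n -> G}, open W & Q = X `&` W) ->
    P `|` Q = X -> P `&` Q = set0 -> P = set0 \/ Q = set0.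

Definition definably_connected_component (X C : set ('I_n -> G)) : Prop :=
  [/\ C `<=` X, definably_connected C &
      forall C', definably_connected C' -> C `<=` C' -> C' `<=` X -> C' = C].

End Components.

Definition property_rho (R : realType) (M : structure1 R)
    (G : topologicalGroupType) (c : coding1 R G) (N : structure1 G) : Prop :=
  forall (n : nat) (X : set ('I_n -> G)),
    definable_in (group_structure G) (coding_pow 'I_n (self G)) X ->
    forall C, definably_connected_component M c X C ->
      definable_in N (coding_pow 'I_n (self G)) C.

(* [H, H]_n *)
Definition commutator_products (H : groupType) (n : nat) : set H :=
  [set h | exists x y : 'I_n -> H, h = (\prod_(j < n) [~ x j, y j])%g].
Arguments commutator_products H n : clear implicits.

(* 1 -> A -> B -> C -> 1 *)
Definition exact_sequence (A B C : groupType) (i : A -> B) (p : B -> C) : Prop :=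
  [/\ {morph i : x y / (x * y)%g}, {morph p : x y / (x * y)%g},
      injective i, (forall z, exists y, p y = z) &
      forall y, (exists x, i x = y) <-> p y = 1%g].

(* Exactness is understood in the category of Hausdorff topological groups:
   the continuous maps i and p are strict, i.e. i is an embedding and p is open
   (so that B / i(A) is C as a topological group). *)
Definition topological_central_extension (A B C : topologicalGroupType)
    (i : A -> B) (p : B -> C) : Prop :=
  [/\ exact_sequence i p,
      forall x y, (i x * y = y * i x)%g,
      hausdorff_space B,
      continuous i /\
        (forall V, open V -> exists2 W, open W & V = i @^-1` W) &
      continuous p /\ (forall W, open W -> open (p @` W))].

(* The group B with the maps i and p is interpretable in N, where A and C are
   coded in N by cA and cC. *)
Definition interpretable_extension (S : Type) (U : S -> Type) (N : structure U)
    (A B C : groupType) (cA : coding U A) (cB : coding U B) (cC : coding U C)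
    (i : A -> B) (p : B -> C) : Prop :=
  [/\ exact_sequence i p,
      interpretable_group N cB,
      definable_in N (coding_pair cA cB) [set t | i t.1 = t.2] &
      definable_in N (coding_pair cB cC) [set t | p t.1 = t.2]].

(* Given codings of G and A in M, a coding c of B over the sorts G and A
   presents B as a quotient of a set of tuples of elements of M; this says that
   the identification of that quotient with B as coded in M by cB is
   M-definable. *)
Definition compatible_coding (R : realType) (M : structure1 R) (G A B : Type)
    (cG : coding1 R G) (cA : coding1 R A) (cB : coding1 R B)
    (c : coding (carrier2 G A) B) : Prop :=
  definable_in M
    (coding_pair (coding_pair (coding_pow (cidx c sG) cG)
                              (coding_pow (cidx c sA) cA)) cB)
    [set t | cdom c (point2 t.1.1 t.1.2) /\
             cval c (point2 t.1.1 t.1.2) = t.2].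

(* Main.v *)
From Stdlib Require List.
From HB Require Import structures.
Require Import Defs.
From mathcomp Require Import all_boot all_order all_algebra.
From mathcomp Require Import boolp classical_sets functions cardinality reals.
From mathcomp Require Import topology num_topology.

Set Implicit Arguments.
Unset Strict Implicit.
Unset Printing Implicit Defensive.

Import Order.TTheory GRing.Theory Num.Theory.
Import numFieldTopology.Exports.
Local Open Scope classical_set_scope.

(* A commutator of Gt depends only on the images of its entries in G. A product of
   n commutators is therefore a function F of 2n elements of G; it is continuous
   because p is open. Let G = [G,G]_n. Every element of Gt is i(a) F(z) for some a
   and z, which presents Gt as a quotient of G^2n x A; equality and multiplication
   reduce to the relations F(z1) F(z2) = i(v) F(z3). Only finitely many v occur,
   and on the set where F(z1) F(z2) F(z3)^-1 lies in i(A), which is definable in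
   the pure group G, this continuous function takes finitely many values, hence is
   locally constant. Its level sets are thus unions of definably connected
   components, finitely many by o-minimality, and property rho applies.

   If A is definable in M, one of the finitely many values of F over each g in G
   is selected definably, which gives a definable section s of p and identifies Gt
   with A x G. To recover the topology, composing F with a continuous definable
   choice of words over some open set and translating gives a continuous section
   germ at 1. Along a definable cell of G, s differs from a translate of this germ
   by one of finitely many elements of A, so it agrees with it up to a constant
   outside a set of smaller dimension. By induction on dimension, finitely many
   continuous definable sections defined on open sets cover G, and together with
   charts of G and A they provide an atlas of Gt. *)

(** * Formulas and definable relations *)

(** Only the order of the reals is guaranteed in [M]: there need be no definable choice, no field
    structure and no definable distance. Separability and completeness of the real line take their
    place. A condition with real endpoints can be tested at rational ones, so its exceptional set is
    covered by countably many thin definable sets, and such a union has empty interior. Completeness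
    makes definable components honest connected components, so no uniform bound on the size of
    finite fibres has to be known in advance: the number of points spreads from one fibre along a
    connected base. Condition (2) is invoked at two lengths. The relation F(z1) F(z2) = i(v) F(z3)
    involves 3n commutators. Comparing s with a translate of the section germ involves 4n, because
    the germ is normalized to be a quotient of two values of F. The group Gt' is Gt itself and the
    isomorphism is the identity: all the content lies in the codings. *)

Lemma existT_inj (I : Type) (T : I -> Type) i (x y : T i) :
  existT T i x = existT T i y -> x = y.
Proof.
move=> e; have h : forall z : {j & T j}, z = existT T i y ->
    forall e0 : projT1 z = i, eq_rect _ T (projT2 z) i e0 = y.
  by move=> z -> /= e0; rewrite (Prop_irrelevance e0 erefl).
exact: (h _ e erefl).
Qed.

Section Substitution.
Variables (S : Type) (U : S -> Type) (N : structure U).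
Variables (V W : S -> Type).
Notation V' := (fun s => (W s + nat)%type).

Fixpoint ren_term (rho : forall s, V s -> V' s) s (t : term N V s) : term N V' s :=
  match t with
  | Tvar _ x => Tvar N (rho _ x)
  | Tapp f ts => Tapp (fun i => ren_term rho (ts i))
  end.

(* The variable bound at depth k is renamed to the number 2k+1; free variables
   are therefore never sent to odd numbers. *)
Fixpoint ren_formula (k : nat) (rho : forall s, V s -> V' s)
    (phi : formula N V) : formula N V' :=
  match phi with
  | Feq _ t u => Feq (ren_term rho t) (ren_term rho u)
  | Frel r ts => Frel (fun i => ren_term rho (ts i))
  | Fbot => Fbot N V'
  | Fimp a b => Fimp (ren_formula k rho a) (ren_formula k rho b)
  | Fall s x a =>
      @Fall _ _ N V' s (inr k.*2.+1) (ren_formula k.+1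
        (fun s' y => if `[< existT V s' y = existT V s x >] then inr k.*2.+1
                     else rho s' y) a)
  end.

Lemma teval_ren rho s (t : term N V s) (v : forall s, V' s -> U s) :
  teval v (ren_term rho t) = teval (fun s y => v s (rho s y)) t.
Proof. by elim: t => //= f ts IH; congr fint; apply: functional_extensionality_dep => i; apply: IH. Qed.

Lemma sat_ren (phi : formula N V) k rho (v : forall s, V' s -> U s) :
  (forall s y j, rho s y = inr j.*2.+1 -> j < k) ->
  sat v (ren_formula k rho phi) <-> sat (fun s y => v s (rho s y)) phi.
Proof.
elim: phi k rho v => [s t u|r ts||a IHa b IHb|s x a IHa] k rho v hk /=.
- by rewrite !teval_ren.
- by rewrite (_ : (fun i => teval v _) =
    fun i => teval (fun s y => v s (rho s y)) (ts i)) //;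
    apply: functional_extensionality_dep => i; rewrite teval_ren.
- by [].
- by rewrite IHa // IHb.
set rho' := (fun s' y => if `[< existT V s' y = existT V s x >] then inr k.*2.+1
                     else rho s' y).
have hk' s' y j : rho' s' y = inr j.*2.+1 -> (j < k.+1)%N.
  rewrite /rho'; case: ifP => _.
    by case=> /double_inj ->.
  by move=> /hk/ltnW.
split=> h w hw.
(* [rho] may identify variables, so [w] cannot be pushed forward along it. Instead [w'] puts the one
   new value into the fresh slot and keeps [v] elsewhere. *)
- pose w' s' (z : V' s') : U s' :=
    match pselect (exists y : V s', existT V s' y = existT V s x /\ z = inr k.*2.+1) with
    | left e => w s' (projT1 (cid e)) | right _ => v s' z end.
  have ww : (fun s y => w' s (rho' s y)) = w.
    apply: functional_extensionality_dep => s'; apply: functional_extensionality_dep => y.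
    rewrite /w' /rho'; case: asboolP => [e|ne].
      case: pselect => [e'|]; last by case; exists y.
      have [e0 _] := projT2 (cid e').
      by congr w; apply: existT_inj; rewrite e0 -e.
    case: pselect => [e'|_].
      by exfalso; case: e' => y0 [_ /hk]; rewrite ltnn.
    by rewrite hw.
  rewrite -ww; apply/(IHa k.+1 rho') => //; apply: h => s' z nz.
  rewrite /w'; case: pselect => // e'; exfalso; case: e' => y [e ez]; case: nz; rewrite ez.
  by move: e => /(congr1 (@projT1 _ _)) /= ->.
- apply/(IHa k.+1 rho') => //; apply: h => s' y ny.
  rewrite /rho'; case: asboolP => // _; apply: hw => e.
  have /= es := congr1 (@projT1 _ _) e; subst s'.
  by have /hk := existT_inj e; rewrite ltnn.
Qed.

Fixpoint alls (l : seq {s & V' s}) (phi : formula N V') :=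
  if l is z :: l' then Fall (projT2 z) (alls l' phi) else phi.

Lemma sat_alls l phi (v : forall s, V' s -> U s) : sat v (alls l phi) <->
  forall w, (forall s y, ~ List.In (existT V' s y) l -> w s y = v s y) -> sat w phi.
Proof.
elim: l v => [|z l IH] v /=.
  split=> [h w hw|]; last by apply.
  suff -> : w = v by [].
  by do 2 apply: functional_extensionality_dep => ?; apply: hw.
split=> h w hw.
- pose w1 s y := if `[< existT V' s y = z >] then w s y else v s y.
  have /IH : sat w1 (alls l phi).
    apply: h => s y ne; rewrite /w1; case: asboolP => // e.
    by case: ne; rewrite e; case: (z).
  apply=> s y ny; rewrite /w1; case: asboolP => // ne.
  by apply: hw => -[e|//]; apply: ne.
- apply/IH => w2 hw2; apply: h => s y ny; rewrite hw2; last by move=> ?; apply: ny; right.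
  by apply: hw => e; apply: ny; left; rewrite e; case: (z).
Qed.

End Substitution.

Lemma sat_ext (S : Type) (U : S -> Type) (N : structure U) (V : S -> Type)
    (v w : forall s, V s -> U s) (phi : formula N V) :
  (forall s y, v s y = w s y) -> sat v phi <-> sat w phi.
Proof.
move=> e; suff -> : v = w by [].
by do 2 apply: functional_extensionality_dep => ?; apply: e.
Qed.

Lemma even_odd_neq n m : n.*2 = m.*2.+1 -> False.
Proof. by move/(congr1 odd); rewrite /= !odd_double. Qed.

Lemma inr_even_odd T n m : inr n.*2 = inr m.*2.+1 :> T + nat -> False.
Proof. by move=> e; apply: (@even_odd_neq n m); case: e. Qed.

(* The odd halves n./2 of even numbers n are reserved for distinguished
   finite families of variables, the even ones for parameters. *)
Section Definability.
Variables (S : Type) (U : S -> Type) (N : structure U).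

Definition env (V : S -> Type) (x : forall s, V s -> U s)
    (b : forall s, nat -> U s) s (z : V s + nat) : U s :=
  match z with inl i => x s i | inr n => b s n end.

Definition defv (V : S -> Type) (P : (forall s, V s -> U s) -> Prop) :=
  exists (phi : formula N (fun s => (V s + nat)%type)) b,
    forall x, P x <-> sat (env x b) phi.

Lemma defv_iff V (P Q : (forall s, V s -> U s) -> Prop) :
  (forall x, P x <-> Q x) -> defv P -> defv Q.
Proof.
move=> h [phi [b hb]]; exists phi, b => x; split; first by move/h/hb.
by move/hb/h.
Qed.

Lemma defv_ren V W (rho : forall s, V s -> W s) (P : (forall s, V s -> U s) -> Prop) :
  defv P -> defv (fun x : forall s, W s -> U s => P (fun s i => x s (rho s i))).
Proof.
move=> [phi [b hb]].
pose r s (z : V s + nat) : W s + nat :=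
  match z with inl i => inl (rho s i) | inr n => inr n.*2 end.
exists (ren_formula 0 r phi), (fun s n => b s n./2) => x.
rewrite sat_ren; last by move=> s [y|n] j //= [] /even_odd_neq.
rewrite hb; apply: sat_ext => s [y|n] //=; by rewrite doubleK.
Qed.

Lemma defv_imp V (P Q : (forall s, V s -> U s) -> Prop) :
  defv P -> defv Q -> defv (fun x => P x -> Q x).
Proof.
move=> [phi [b hb]] [psi [c hc]].
pose r1 s (z : V s + nat) : V s + nat :=
  match z with inl i => inl i | inr n => inr n.*2.*2 end.
pose r2 s (z : V s + nat) : V s + nat :=
  match z with inl i => inl i | inr n => inr n.*2.+1.*2 end.
(* The two parameter assignments are interleaved inside the even numbers: 4k carries [b] and 4k+2
   carries [c]. *)
pose bc s n := if odd n./2 then c s n./2./2 else b s n./2./2.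
exists (Fimp (ren_formula 0 r1 phi) (ren_formula 0 r2 psi)), bc => x /=.
have e1 : sat (env x bc) (ren_formula 0 r1 phi) <-> sat (env x b) phi.
  rewrite sat_ren; last by move=> s [y|n] j //= [] /even_odd_neq.
  by apply: sat_ext => s [y|n] //=; rewrite /bc !doubleK odd_double.
have e2 : sat (env x bc) (ren_formula 0 r2 psi) <-> sat (env x c) psi.
  rewrite sat_ren; last by move=> s [y|n] j // [/esym/even_odd_neq].
  by apply: sat_ext => s [y|n] //=; rewrite /bc !doubleK /= odd_double /= uphalf_double.
by rewrite hb hc; split=> h H; apply/e2/h/e1.
Qed.

(** The definable [P] supplies a parameter assignment [b]; none exists when some carrier is
    empty. *)
Lemma defv_True V W (P : (forall s, V s -> U s) -> Prop) :
  defv P -> defv (fun x : forall s, W s -> U s => True).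
Proof.
case=> phi [b _].
by exists (Fimp (Fbot N _) (Fbot N _)), b => x; split=> // _.
Qed.

Lemma defv_not V (P : (forall s, V s -> U s) -> Prop) :
  defv P -> defv (fun x => ~ P x).
Proof.
move=> d; apply: defv_imp (d) _; case: d => phi [b _].
by exists (Fbot N _), b.
Qed.

Lemma defv_and V (P Q : (forall s, V s -> U s) -> Prop) :
  defv P -> defv Q -> defv (fun x => P x /\ Q x).
Proof.
move=> dP dQ; apply: defv_iff (defv_not (defv_imp dP (defv_not dQ))) => x.
split; last by move=> [p q]; apply.
by move=> h; split; apply: contrapT => n; apply: h => p.
Qed.

Definition join (V I : S -> Type) (x : forall s, V s -> U s)
    (y : forall s, I s -> U s) s (z : V s + I s) : U s :=
  match z with inl i => x s i | inr j => y s j end.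

(** The sorts form a bare type, so finiteness of the total family is witnessed by a list rather than
    by a [finType]. *)
Definition finite_family (I : S -> Type) :=
  exists l : seq {s & I s}, forall z, List.In z l.

Lemma finite_family_index I : finite_family I ->
  exists f : {s & I s} -> nat, injective f.
Proof.
move=> [l hl]; have /choice [f hf] : forall z, exists n, List.nth_error l n = Some z.
  by move=> z; exact: List.In_nth_error.
by exists f => x y e; move: (hf x) (hf y); rewrite e => -> [].
Qed.

Section Family.
Variables (V I : S -> Type) (f : {s & I s} -> nat) (f_inj : injective f).
Variables (P : (forall s, (V s + I s)%type -> U s) -> Prop).

Definition code s (i : I s) := (f (existT I s i)).*2.+1.*2.

Definition mix (y : forall s, I s -> U s) (b : forall s, nat -> U s) s m : U s :=
  match pselect (exists i : I s, m = code i) with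
  | left e => y s (projT1 (cid e)) | right _ => b s m./2./2 end.

Lemma mix_code y b s (i : I s) : mix y b s (code i) = y s i.
Proof.
rewrite /mix; case: pselect => [e|[]]; last by exists i.
have e' := projT2 (cid e); congr y; symmetry; apply: existT_inj; apply: f_inj.
by apply: double_inj; apply: succn_inj; apply: double_inj.
Qed.

Lemma mix_even y b s n : mix y b s n.*2.*2 = b s n.
Proof.
rewrite /mix; case: pselect => [e|_]; last by rewrite !doubleK.
by exfalso; case: e => i /double_inj /even_odd_neq.
Qed.

Definition family_ren s (z : V s + I s + nat) : V s + nat :=
  match z with
  | inl (inl i) => inl i | inl (inr j) => inr (code j) | inr n => inr n.*2.*2
  end.

Lemma sat_family (phi : formula N (fun s => (V s + I s + nat)%type)) b (x : forall s, V s -> U s) (y : forall s, I s -> U s) :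
  (forall x, P x <-> sat (env x b) phi) ->
  P (join x y) <-> sat (env x (mix y b)) (ren_formula 0 family_ren phi).
Proof.
move=> ->; rewrite sat_ren; last by move=> s [[i|i]|n] j // /inr_even_odd.
by apply: sat_ext => s [[i|i]|n] //=; rewrite ?mix_code ?mix_even.
Qed.

End Family.

(** The fixed coordinates become parameters: a numbering of the finite family gives each of them its
    own slot in the parameter assignment. *)
Lemma defv_inst V I (P : (forall s, (V s + I s)%type -> U s) -> Prop) y :
  finite_family I -> defv P -> defv (fun x : forall s, V s -> U s => P (join x y)).
Proof.
move=> /finite_family_index [f f_inj] [phi [b hb]].
exists (ren_formula 0 (@family_ren V I f) phi), (mix f y b) => x.
exact: sat_family hb.
Qed.

Lemma defv_all V I (P : (forall s, (V s + I s)%type -> U s) -> Prop) :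
  finite_family I -> defv P ->
  defv (fun x : forall s, V s -> U s => forall y, P (join x y)).
Proof.
move=> If [phi [b hb]]; have [f f_inj] := finite_family_index If.
have [l hl] := If.
pose l' := List.map (fun z : {s & I s} => existT (fun s => (V s + nat)%type)
  (projT1 z) (inr (code f (projT2 z)))) l.
have inl' s n : List.In (existT (fun s => (V s + nat)%type) s (inr n)) l' <->
    exists i : I s, n = code f i.
  rewrite /l' List.in_map_iff; split.
    move=> [[s' i] [/= e _]]; have /= es := congr1 (@projT1 _ _) e; subst s'.
    by exists i; case: (existT_inj e).
  by move=> [i ->]; exists (existT _ s i).
have ninl' s i : ~ List.In (existT (fun s => (V s + nat)%type) s (inl i)) l'.
  rewrite /l' List.in_map_iff => -[[s' j] [/= e _]].
  by have /= es := congr1 (@projT1 _ _) e; subst s'; move: (existT_inj e).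
exists (alls l' (ren_formula 0 (@family_ren V I f) phi)), (fun s n => b s n./2./2) => x.
rewrite sat_alls; split=> [h w hw|h y].
- have /(sat_family f_inj x _ hb) := h (fun s i => w s (inr (code f i))).
  apply: (iffLR (sat_ext _ _)) => s [v|n] /=.
    by rewrite hw //; apply: ninl'.
  rewrite /mix; case: pselect => [e|ne]; first by rewrite -(projT2 (cid e)).
  by rewrite hw // inl'.
- apply/(sat_family f_inj x y hb); apply: h => s [v|n] //= /inl' ne.
  by rewrite /mix; case: pselect.
Qed.

Lemma defv_ex V I (P : (forall s, (V s + I s)%type -> U s) -> Prop) :
  finite_family I -> defv P ->
  defv (fun x : forall s, V s -> U s => exists y, P (join x y)).
Proof.
move=> If /defv_not/(defv_all If)/defv_not; apply: defv_iff => x; split.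
  by move=> /existsNP [y /contrapT]; exists y.
by move=> [y hy] h; apply: (h y).
Qed.

End Definability.

Lemma finite_family_sum (S : Type) (I J : S -> Type) :
  finite_family I -> finite_family J -> finite_family (fun s => (I s + J s)%type).
Proof.
move=> [l hl] [m hm].
exists (List.app (List.map (fun z => existT (fun s => (I s + J s)%type) (projT1 z) (inl (projT2 z))) l)
  (List.map (fun z => existT (fun s => (I s + J s)%type) (projT1 z) (inr (projT2 z))) m)).
move=> [s [i|j]]; rewrite List.in_app_iff !List.in_map_iff.
  by left; exists (existT _ s i).
by right; exists (existT _ s j).
Qed.

Lemma finite_family_mul (S : Type) (J : finType) (I : S -> Type) :
  finite_family I -> finite_family (fun s => (J * I s)%type).
Proof.
move=> [l hl].
exists (List.flat_map (fun j => List.map (fun z =>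
  existT (fun s => (J * I s)%type) (projT1 z) (j, projT2 z)) l) (enum J)).
move=> [s [j i]]; apply/List.in_flat_map; exists j; split.
  have : j \in enum J by rewrite mem_enum.
  by elim: (enum J) => //= k e IH; rewrite inE => /orP[/eqP->|/IH]; [left|right].
by apply/List.in_map_iff; exists (existT _ s i).
Qed.

(** * Interpreted sets, quantification over them and definable maps between them *)

Section Coded.
Variables (S : Type) (U : S -> Type) (N : structure U).

(** Pullback along a map that acts on representatives by selecting coordinates. The projections and
    rearrangements of products and powers are all of this kind. *)
Lemma definable_in_ren (H K : Type) (c : coding U H) (d : coding U K)
    (rho : forall s, cidx d s -> cidx c s) (g : H -> K) (P : K -> Prop) :
  definable N (cdom c) ->
  (forall x, cdom c x -> cdom d (fun s i => x s (rho s i)) /\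
    g (cval c x) = cval d (fun s i => x s (rho s i))) ->
  definable_in N d P -> definable_in N c (fun h => P (g h)).
Proof.
move=> dc h dP; apply: defv_iff (defv_and dc (defv_ren rho dP)) => x.
by split=> -[cx]; have [dx e] := h _ cx; rewrite /= e => // -[].
Qed.

Lemma definable_in_iff (H : Type) (c : coding U H) (P Q : H -> Prop) :
  (forall x, P x <-> Q x) -> definable_in N c P -> definable_in N c Q.
Proof. by move=> h; apply: defv_iff => x /=; rewrite h. Qed.

Lemma definable_in_and (H : Type) (c : coding U H) (P Q : H -> Prop) :
  definable_in N c P -> definable_in N c Q -> definable_in N c (fun x => P x /\ Q x).
Proof. by move=> dP dQ; apply: defv_iff (defv_and dP dQ) => x /=; tauto. Qed.

Lemma definable_in_not (H : Type) (c : coding U H) (P : H -> Prop) :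
  definable N (cdom c) ->
  definable_in N c P -> definable_in N c (fun x => ~ P x).
Proof. by move=> dc dP; apply: defv_iff (defv_and dc (defv_not dP)) => x /=; tauto. Qed.

Lemma definable_in_True (H : Type) (c : coding U H) :
  definable N (cdom c) -> definable_in N c (fun x => True).
Proof. by apply: defv_iff => x /=; tauto. Qed.

Lemma definable_in_forall_fin (J : finType) (H : Type) (c : coding U H)
    (P : J -> H -> Prop) : definable N (cdom c) ->
  (forall j, definable_in N c (P j)) -> definable_in N c (fun x => forall j, P j x).
Proof.
move=> dc dP.
suff h (l : seq J) : definable_in N c (fun x => forall j, j \in l -> P j x).
  by apply: definable_in_iff (h (enum J)) => x; split=> hx j; [apply: hx; rewrite mem_enum|move=> _; apply: hx].
elim: l => [|j l IH]; first by apply: definable_in_iff (definable_in_True dc).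
apply: definable_in_iff (definable_in_and (dP j) IH) => x; split.
  by move=> [h1 h2] k; rewrite inE => /orP[/eqP->//|/h2].
by move=> h; split=> [|k kl]; apply: h; rewrite inE ?eqxx ?kl ?orbT.
Qed.

(** A set interpreted in [N]: an element has a code only up to a definable equivalence, as it must
    be for a group presented as a quotient. *)
Class coded (T : Type) := Coded {
  cod : coding U T;
  cod_fin : finite_family (cidx cod);
  cod_dom : definable N (cdom cod);
  cod_surj : forall t : T, exists2 x, cdom cod x & cval cod x = t;
  cod_eq : definable_in N (coding_pair cod cod) [set t | t.1 = t.2] }.

Definition def (T : Type) (cT : coded T) (P : T -> Prop) : Prop :=
  definable_in N cod P.

Lemma coding_pair_dom (H K : Type) (c : coding U H) (d : coding U K) :
  definable N (cdom c) -> definable N (cdom d) -> definable N (cdom (coding_pair c d)).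
Proof.
by move=> dc dd; apply: (defv_and (defv_ren (fun s => inl) dc) (defv_ren (fun s => inr) dd)).
Qed.

Lemma coding_pow_dom (J : finType) (H : Type) (c : coding U H) :
  definable N (cdom c) -> definable N (cdom (coding_pow J c)).
Proof.
move=> dc.
suff h (l : seq J) : defv N (fun x => forall j, j \in l -> cdom c (fun s i => x s (j, i))).
  by apply: defv_iff (h (enum J)) => x; split=> hx j; [apply: (hx j); rewrite mem_enum|move=> _; exact: (hx j)].
have d j := defv_ren (fun s i => (j, i) : J * cidx c s) dc.
elim: l => [|j l IH]; first exact: defv_iff (defv_True _ dc).
apply: defv_iff (defv_and (d j) IH) => x; split.
  by move=> [h1 h2] k; rewrite inE => /orP[/eqP->//|/h2].
by move=> h; split=> [|k kl]; apply: h; rewrite inE ?eqxx ?kl ?orbT.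
Qed.

Program Definition coded_prod (T T' : Type) (cT : coded T) (cT' : coded T') :
  coded (T * T') := @Coded _ (coding_pair (@cod _ cT) (@cod _ cT')) _ _ _ _.
Next Obligation. by move=> *; apply: finite_family_sum; apply: cod_fin. Qed.
Next Obligation. by move=> *; apply: coding_pair_dom; apply: cod_dom. Qed.
Next Obligation.
move=> T T' cT cT' [t t'].
have [x cx ex] := cod_surj t; have [y cy ey] := cod_surj t'.
by exists (join x y) => //=; rewrite -[in RHS]ex -[in RHS]ey.
Qed.
Next Obligation.
move=> T T' cT cT'.
pose c := coding_pair (coding_pair (@cod _ cT) (@cod _ cT')) (coding_pair (@cod _ cT) (@cod _ cT')).
have dc : definable N (cdom c) by do 2 apply: coding_pair_dom; apply: cod_dom.
have d1 : definable_in N c (fun t => t.1.1 = t.2.1).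
  apply: (definable_in_ren (c := c) (d := coding_pair cod cod) (g := fun t => (t.1.1, t.2.1))
     (rho := fun s z => match z with inl i => inl (inl i) | inr i => inr (inl i) end)
     dc _ (cod_eq (coded := cT))).
  by move=> x [[? ?] [? ?]].
have d2 : definable_in N c (fun t => t.1.2 = t.2.2).
  apply: (definable_in_ren (c := c) (d := coding_pair cod cod) (g := fun t => (t.1.2, t.2.2))
     (rho := fun s z => match z with inl i => inl (inr i) | inr i => inr (inr i) end)
     dc _ (cod_eq (coded := cT'))).
  by move=> x [[? ?] [? ?]].
apply: definable_in_iff (definable_in_and d1 d2).
by move=> [[a b] [a' b']] /=; split=> [[-> ->]|[-> ->]].
Qed.

Program Definition coded_pow (J : finType) (T : Type) (cT : coded T) :
  coded (J -> T) := @Coded _ (coding_pow J (@cod _ cT)) _ _ _ _.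
Next Obligation. by move=> *; apply: finite_family_mul; apply: cod_fin. Qed.
Next Obligation. by move=> *; apply: coding_pow_dom; apply: cod_dom. Qed.
Next Obligation.
move=> J T cT t.
have /choice [x hx] : forall j, exists x, cdom (@cod _ cT) x /\ cval (@cod _ cT) x = t j.
  by move=> j; have [x] := cod_surj (t j); exists x.
exists (fun s z => x z.1 s z.2) => [j /=|]; first by case: (hx j).
by apply/funext => j; case: (hx j).
Qed.
Next Obligation.
move=> J T cT.
pose c := coding_pair (coding_pow J (@cod _ cT)) (coding_pow J (@cod _ cT)).
have dc : definable N (cdom c) by apply: coding_pair_dom; apply: coding_pow_dom; apply: cod_dom.
have d j : definable_in N c (fun t => t.1 j = t.2 j).
  apply: (definable_in_ren (c := c) (d := coding_pair cod cod) (g := fun t => (t.1 j, t.2 j))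
     (rho := fun s z => match z with inl i => inl (j, i) | inr i => inr (j, i) end)
     dc _ (cod_eq (coded := cT))).
  by move=> x [? ?].
apply: definable_in_iff (definable_in_forall_fin dc d).
by move=> [a b] /=; split=> [h|-> //]; apply/funext.
Qed.

Definition coding_unit : coding U unit :=
  {| cidx := fun=> void; cdom := setT; cval := fun=> tt |}.

Lemma coded_unit (T : Type) (cT : coded T) : coded unit.
Proof.
apply: (@Coded _ coding_unit).
- by exists [::] => -[].
- exact: (defv_True _ cod_dom).
- by case; exists (fun s (i : void) => match i with end).
- apply: defv_iff (defv_True _ cod_dom) => x; split=> // _.
Defined.


Section Def.
Context {T : Type} {cT : coded T}.
Implicit Types P Q : T -> Prop.

Lemma def_iff P Q : (forall x, P x <-> Q x) -> def cT P -> def cT Q.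
Proof. exact: definable_in_iff. Qed.

Lemma def_and P Q : def cT P -> def cT Q -> def cT (fun x => P x /\ Q x).
Proof. exact: definable_in_and. Qed.

Lemma def_not P : def cT P -> def cT (fun x => ~ P x).
Proof. exact: (definable_in_not cod_dom). Qed.

Lemma def_cst (Q : Prop) : def cT (fun=> Q).
Proof.
have dT : def cT (fun=> True) by exact: (definable_in_True cod_dom).
have [q|nq] := pselect Q; first by apply: def_iff dT.
by apply: def_iff (def_not dT) => x; split=> // [/(_ I)].
Qed.

Lemma def_imp P Q : def cT P -> def cT Q -> def cT (fun x => P x -> Q x).
Proof.
move=> dP dQ; apply: def_iff (def_not (def_and dP (def_not dQ))) => x; split.
  by move=> h p; apply: contrapT => q; apply: h.
by move=> h [p]; apply; apply: h.
Qed.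

Lemma def_or P Q : def cT P -> def cT Q -> def cT (fun x => P x \/ Q x).
Proof.
move=> dP dQ; apply: def_iff (def_imp (def_not dP) dQ) => x; split; last tauto.
by move=> h; have [p|/h q] := pselect (P x); [left|right].
Qed.

Lemma def_equiv P Q : def cT P -> def cT Q -> def cT (fun x => P x <-> Q x).
Proof. by move=> dP dQ; exact: (def_and (def_imp dP dQ) (def_imp dQ dP)). Qed.

Lemma def_forall_fin (J : finType) (P : J -> T -> Prop) :
  (forall j, def cT (P j)) -> def cT (fun x => forall j, P j x).
Proof. exact: (definable_in_forall_fin cod_dom). Qed.

Lemma def_exists_fin (J : finType) (P : J -> T -> Prop) :
  (forall j, def cT (P j)) -> def cT (fun x => exists j, P j x).
Proof.
move=> dP; have := def_not (def_forall_fin (fun j => def_not (dP j))).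
apply: def_iff => x; split; first by move=> /existsNP [j /contrapT]; exists j.
by move=> [j hj] h; apply: (h j).
Qed.

End Def.

Section Quantifiers.
Context {T T' : Type} {cT : coded T} {cT' : coded T'}.

Lemma def_ex (P : T -> T' -> Prop) :
  def (coded_prod cT cT') (fun t => P t.1 t.2) -> def cT (fun x => exists y, P x y).
Proof.
move=> /(defv_ex (@cod_fin _ cT'))/(defv_and (@cod_dom _ cT)).
apply: defv_iff => x; split.
  by move=> [cx [y [[_ cy] h]]]; split=> //; exists (cval cod y).
move=> [cx [y h]]; split=> //; have [z cz ez] := cod_surj y.
by exists z; split=> //=; rewrite ez.
Qed.

Lemma def_all (P : T -> T' -> Prop) :
  def (coded_prod cT cT') (fun t => P t.1 t.2) -> def cT (fun x => forall y, P x y).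
Proof.
move=> /def_not/(@def_ex (fun x y => ~ P x y))/def_not; apply: def_iff => x; split.
  by move=> h y; apply: contrapT => n; apply: h; exists y.
by move=> h [y]; apply.
Qed.

Definition dmap (f : T -> T') := def (coded_prod cT cT') (fun t => f t.1 = t.2).

End Quantifiers.
Arguments dmap {T T'} cT cT' f.

Local Notation "c ** d" := (coded_prod c d) (at level 40, left associativity).

Section Maps.
Context {A B C D : Type} {a : coded A} {b : coded B} {c : coded C} {d : coded D}.

Lemma dmap_id : dmap a a (fun x => x).
Proof. exact: cod_eq. Qed.

Lemma def_snd (P : B -> Prop) : def b P -> def (a ** b) (fun t => P t.2).
Proof. move=> dP; apply: (definable_in_ren (c := @cod _ (a ** b)) (d := @cod _ b) (g := snd)
  (rho := fun s => inr) cod_dom _ dP).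
by move=> x []. Qed.

Lemma def_comp (P : B -> Prop) f : dmap a b f -> def b P -> def a (fun x => P (f x)).
Proof.
move=> df dP; have h : def (a ** b) (fun t => f t.1 = t.2 /\ P t.2).
  by apply: def_and => //; apply: def_snd.
apply: def_iff (@def_ex _ _ _ _ (fun x y => f x = y /\ P y) h) => x.
by split=> [[y [<-]]|?] //; exists (f x).
Qed.

Lemma dmap_pair f g : dmap a b f -> dmap a c g -> dmap a (b ** c) (fun x => (f x, g x)).
Proof.
move=> df dg.
have d1 : def (a ** (b ** c)) (fun t => f t.1 = t.2.1).
  apply: (definable_in_ren (c := @cod _ (a ** (b ** c))) (d := coding_pair cod cod) (g := fun t => (t.1, t.2.1))
    (rho := fun s z => match z with inl i => inl i | inr i => inr (inl i) end) cod_dom _ df).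
  by move=> x [? []].
have d2 : def (a ** (b ** c)) (fun t => g t.1 = t.2.2).
  apply: (definable_in_ren (c := @cod _ (a ** (b ** c))) (d := coding_pair cod cod) (g := fun t => (t.1, t.2.2))
    (rho := fun s z => match z with inl i => inl i | inr i => inr (inr i) end) cod_dom _ dg).
  by move=> x [? []].
apply: def_iff (def_and d1 d2) => -[x [y z]] /=.
by split=> [[-> ->]|[-> ->]].
Qed.

Lemma dmap_fst0 : dmap (a ** b) a fst.
Proof.
apply: (definable_in_ren (c := @cod _ (a ** b ** a)) (d := coding_pair cod cod) (g := fun t => (t.1.1, t.2))
    (rho := fun s z => match z with inl i => inl (inl i) | inr i => inr i end) cod_dom _ cod_eq).
by move=> x [[? ?] ?].
Qed.

Lemma dmap_snd0 : dmap (a ** b) b snd.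
Proof.
apply: (definable_in_ren (c := @cod _ (a ** b ** b)) (d := coding_pair cod cod) (g := fun t => (t.1.2, t.2))
    (rho := fun s z => match z with inl i => inl (inr i) | inr i => inr i end) cod_dom _ cod_eq).
by move=> x [[? ?] ?].
Qed.

Lemma dmap_app0 (J : finType) (j : J) : dmap (coded_pow J a) a (fun x => x j).
Proof.
apply: (definable_in_ren (c := @cod _ (coded_pow J a ** a)) (d := coding_pair cod cod) (g := fun t => (t.1 j, t.2))
    (rho := fun s z => match z with inl i => inl (j, i) | inr i => inr i end) cod_dom _ cod_eq).
by move=> x [? ?].
Qed.

(** A constant is definable over parameters: one of its representatives is substituted for the
    second block of coordinates in the equality relation. *)
Lemma dmap_cst y0 : dmap a b (fun=> y0).
Proof.
have [x0 cx0 e0] := cod_surj y0.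
have h : def b (fun y => y = y0).
  have := defv_inst x0 cod_fin (cod_eq (coded := b)); apply: defv_iff => x /=.
  by rewrite -e0; tauto.
by apply: def_iff (def_snd h) => x.
Qed.

Lemma dmap_iff (f g : A -> B) : (forall x, f x = g x) -> dmap a b f -> dmap a b g.
Proof. by move=> h; apply: def_iff => x; rewrite h. Qed.

End Maps.

Lemma dmap_comp {A B C : Type} {a : coded A} {b : coded B} {c : coded C} f g :
  dmap a b f -> dmap b c g -> dmap a c (fun x => g (f x)).
Proof.
move=> df dg.
have d1 : dmap (a ** c) b (fun t => f t.1).
  apply: (definable_in_ren (c := @cod _ (a ** c ** b)) (d := coding_pair cod cod) (g := fun t => (t.1.1, t.2))
    (rho := fun s z => match z with inl i => inl (inl i) | inr i => inr i end) cod_dom _ df).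
  by move=> x [[? ?] ?].
exact: (def_comp (dmap_pair d1 dmap_snd0) dg).
Qed.

Lemma def_eq {A B : Type} {a : coded A} {b : coded B} (f g : A -> B) :
  dmap a b f -> dmap a b g -> def a (fun x => f x = g x).
Proof. by move=> df dg; exact: (def_comp (dmap_pair df dg) cod_eq). Qed.

Section Maps2.
Context {A B C D : Type} {a : coded A} {b : coded B} {c : coded C} {d : coded D}.

Lemma dmap_fst (f : A -> B * C) : dmap a (b ** c) f -> dmap a b (fun x => (f x).1).
Proof. by move=> df; exact: (dmap_comp df dmap_fst0). Qed.

Lemma dmap_snd (f : A -> B * C) : dmap a (b ** c) f -> dmap a c (fun x => (f x).2).
Proof. by move=> df; exact: (dmap_comp df dmap_snd0). Qed.

Lemma dmap_app (J : finType) (f : A -> J -> B) j :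
  dmap a (coded_pow J b) f -> dmap a b (fun x => f x j).
Proof. by move=> df; exact: (dmap_comp df (dmap_app0 j)). Qed.

End Maps2.

Section Maps3.
Context {A B C D : Type} {a : coded A} {b : coded B} {c : coded C} {d : coded D}.

Lemma dmap_fun (J : finType) (f : A -> J -> B) :
  (forall j, dmap a b (fun x => f x j)) -> dmap a (coded_pow J b) (fun x j => f x j).
Proof.
move=> df; have h j : def (a ** coded_pow J b) (fun t => f t.1 j = t.2 j).
  apply: (@def_eq _ _ _ b); last exact: (dmap_app j dmap_snd0).
  exact: (dmap_comp dmap_fst0 (df j)).
apply: def_iff (def_forall_fin h) => -[x y] /=; split=> [e|<- //].
exact/funext.
Qed.

Lemma def_comp2 (P : B -> C -> Prop) f g :
  def (b ** c) (fun t => P t.1 t.2) -> dmap a b f -> dmap a c g -> def a (fun x => P (f x) (g x)).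
Proof. by move=> dP df dg; exact: (def_comp (dmap_pair df dg) dP). Qed.

Lemma def_comp3 (P : B -> C -> D -> Prop) f g h :
  def (b ** c ** d) (fun t => P t.1.1 t.1.2 t.2) ->
  dmap a b f -> dmap a c g -> dmap a d h -> def a (fun x => P (f x) (g x) (h x)).
Proof. by move=> dP df dg dh; exact: (def_comp (dmap_pair (dmap_pair df dg) dh) dP). Qed.

Lemma dmap_comp2 (F : B -> C -> D) f g :
  dmap (b ** c) d (fun t => F t.1 t.2) -> dmap a b f -> dmap a c g -> dmap a d (fun x => F (f x) (g x)).
Proof. by move=> dF df dg; exact: (dmap_comp (dmap_pair df dg) dF). Qed.

(** Since [Q] is single-valued nothing is really chosen, and definable choice is not involved. The
    default [y0] only makes the map total. *)
Lemma dmap_choice (Q : A -> B -> Prop) (y0 : B) :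
  def (a ** b) (fun t => Q t.1 t.2) -> (forall x y y', Q x y -> Q x y' -> y = y') ->
  exists f, [/\ dmap a b f, (forall x y, Q x y -> f x = y) &
    (forall x, (forall y, ~ Q x y) -> f x = y0)].
Proof.
move=> dQ uQ.
pose Q' x y := Q x y \/ (~ (exists z, Q x z) /\ y = y0).
have /choice [f hf] : forall x, exists y, Q' x y.
  move=> x; have [[y hy]|n] := pselect (exists z, Q x z); first by exists y; left.
  by exists y0; right.
exists f; split.
- have h : def (a ** b) (fun t => Q' t.1 t.2).
    apply: def_or => //; apply: def_and; last by apply: def_eq; [exact: dmap_snd0|exact: dmap_cst].
    exact: (def_comp dmap_fst0 (def_not (def_ex dQ))).
  apply: def_iff h => -[x y] /=; split=> [|<- //].
  case: (hf x) => [h [h'|[n _]]|[n ->] [h'|[_ -> //]]].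
  + exact: uQ h h'.
  + by case: n; exists (f x).
  + by case: n; exists y.
- move=> x y h; case: (hf x) => [h'|[n _]]; first exact: uQ h' h.
  by case: n; exists y.
- by move=> x n; case: (hf x) => [/n|[_]].
Qed.

End Maps3.

End Coded.

Arguments def {S U} N {T cT} P.
Arguments dmap {S U} N {T T' cT cT'} f.
#[export] Existing Instance coded_prod.
#[export] Existing Instance coded_pow.

Lemma def_andb {S : Type} {U : S -> Type} {N : structure U} {T : Type} {cT : coded N T}
    (b c : T -> bool) : def N b -> def N c -> def N (fun x => b x && c x).
Proof. by move=> db dc; apply: def_iff (def_and db dc) => x; split=> /andP. Qed.

(** Follows the shape of the function. Definable maps among the hypotheses, of one or two arguments,
    are the base cases of compositions. *)
Ltac solve_dmap := cbv beta; lazymatch goal with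
  | |- forall j, _ => let j := fresh "j" in intro j; solve_dmap
  | |- dmap _ (fun x => x) => exact (@dmap_id _ _ _ _ _)
  | |- dmap _ (fun _ => ?c) => exact (@dmap_cst _ _ _ _ _ _ _ c)
  | |- dmap _ (fun x => (@?f x, @?g x)) =>
      refine (dmap_pair (f := f) (g := g) _ _); solve_dmap
  | |- dmap _ (fun x => fst (@?f x)) => refine (dmap_fst (f := f) _); solve_dmap
  | |- dmap _ (fun x => snd (@?f x)) => refine (dmap_snd (f := f) _); solve_dmap
  | _ => first
    [ eassumption
    | match goal with
      | H : dmap _ (fun t => ?h (fst t) (snd t)) |- dmap _ (fun x => ?h (@?f x) (@?g x)) =>
        refine (dmap_comp2 (F := h) (f := f) (g := g) H _ _); solve_dmap
      | H : dmap _ ?h |- dmap _ (fun x => ?h (@?f x)) =>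
        refine (dmap_comp (f := f) (g := h) _ H); solve_dmap
      end
    | lazymatch goal with
      | |- dmap _ (fun x => fun j => @?f x j) =>
        refine (dmap_fun (f := f) _); solve_dmap
      | |- dmap _ ?G =>
        let A := lazymatch type of G with ?A -> _ => A end in
        let f := constr:(fun x : A => ltac:(let t := eval cbv beta in (G x) in
          lazymatch t with ?u _ => exact u end)) in
        refine (dmap_app (f := f) _ _); solve_dmap
      end
    | idtac ]
  end.

(** A hook, extended later by the atoms of the order and then by neighbourhood conditions. *)
Ltac solve_def_atom := fail.

Ltac solve_def := cbv beta delta [mkset setI setU setC setD set0 setT set1 setX preimage]; cbv beta;
  lazymatch goal with
  | |- forall j, _ => let j := fresh "j" in intro j; solve_def
  | |- def _ (fun _ => ?Q) => exact (@def_cst _ _ _ _ _ Q)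
  | |- def _ (fun x => @?P x /\ @?Q x) => refine (def_and (P := P) (Q := Q) _ _); solve_def
  | |- def _ (fun x => @?P x \/ @?Q x) => refine (def_or (P := P) (Q := Q) _ _); solve_def
  | |- def _ (fun x => ~ @?P x) => refine (def_not (P := P) _); solve_def
  | |- def _ (fun x => @?P x <-> @?Q x) => refine (def_equiv (P := P) (Q := Q) _ _); solve_def
  | |- def _ (fun x => is_true (@?P x && @?Q x)) =>
      refine (def_andb (b := P) (c := Q) _ _); solve_def
  | |- def _ (fun x => exists2 y, @?P x y & @?Q x y) =>
      refine (def_iff (P := fun x => exists y, P x y /\ Q x y) _ _);
      [intro; split; [move=> [? []]; eexists; eassumption|move=> [? ? ?]; eexists; split; eassumption]
      | solve_def]
  | |- def _ (fun x => exists y, @?P x y) =>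
      first [refine (def_exists_fin (P := fun j x => P x j) _) | refine (def_ex (P := P) _)]; solve_def
  | |- def _ (fun x => forall y, @?P x y) =>
      first
        [ lazymatch goal with |- def _ (fun x => forall y : ?A, _) =>
            lazymatch type of A with Prop => fail | _ => idtac end end;
          first [refine (def_forall_fin (P := fun j x => P x j) _) | refine (def_all (P := P) _)]
        | lazymatch goal with |- def _ (fun x => @?P x -> @?Q x) =>
            refine (def_imp (P := P) (Q := Q) _ _) end]; solve_def
  | |- def _ (fun x => @?f x = @?g x) => refine (def_eq (f := f) (g := g) _ _); solve_dmap
  | _ => first
    [ eassumption
    | solve_def_atom
    | match goal with
      | H : def _ (fun t => ?h (fst (fst t)) (snd (fst t)) (snd t)) |- def _ (fun x => ?h (@?f x) (@?g x) (@?k x)) =>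
        refine (def_comp3 (P := h) (f := f) (g := g) (h := k) H _ _ _); solve_dmap
      | H : def _ (fun t => ?h (fst t) (snd t)) |- def _ (fun x => ?h (@?f x) (@?g x)) =>
        refine (def_comp2 (P := h) (f := f) (g := g) H _ _); solve_dmap
      | H : def _ ?h |- def _ (fun x => ?h (@?f x)) =>
        refine (def_comp (P := h) (f := f) _ H); solve_dmap
      end
    | idtac ]
  end.

Local Open Scope ring_scope.

(** * Definable subsets of R^n *)

Inductive finite_union (T : Type) (C : set T -> Prop) : set T -> Prop :=
| finite_union0 : finite_union C set0
| finite_union1 (X : set T) of C X : finite_union C X
| finite_unionU (X Y : set T) of finite_union C X & finite_union C Y :
    finite_union C (X `|` Y).

Section RealLine.
Variable R : realType.
Implicit Types (a b x y : R) (X Y T : set R).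

Definition convex_set X := forall x y z, X x -> X z -> x <= y <= z -> X y.

(** The germ of [T] at its left end decides [X]. A convex piece that leaves [T] somewhere below one
    of its points is never met again further down, and the smaller of two thresholds serves a
    union. *)
Lemma convex_eventually T X : finite_union convex_set X -> T !=set0 ->
  exists2 t, T t & (forall s, T s -> s <= t -> X s) \/ (forall s, T s -> s <= t -> ~ X s).
Proof.
move=> + [t0 Tt0]; elim=> [|C cC|A B _ [s Ts hs] _ [t Tt ht]].
- by exists t0 => //; right => s _ _ [].
- have [[t1 [Tt1 Ct1]]|nC] := pselect (exists t, T t /\ C t); last first.
    by exists t0 => //; right => s Ts _ Cs; apply: nC; exists s.
  have [h|] := pselect (forall s, T s -> s <= t1 -> C s); first by exists t1 => //; left.
  move=> /existsNP[t /not_implyP[Tt /not_implyP[tt1 nCt]]].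
  exists t => //; right => s Ts st Cs; apply: nCt; apply: (cC s t t1) => //.
  by rewrite st.
- exists (Num.min s t); first by case: (leP s t).
  case: hs => hs; first by left=> u Tu; rewrite le_min => /andP[us ut]; left; apply: hs.
  case: ht => ht; first by left=> u Tu; rewrite le_min => /andP[us ut]; right; apply: ht.
  by right=> u Tu; rewrite le_min => /andP[us ut] [/hs|/ht]; apply.
Qed.

Lemma thin_convex_finite X : finite_union convex_set X ->
  (forall a b, a < b -> exists2 y, a < y < b & ~ X y) -> finite_set X.
Proof.
elim=> [//|C cC|A B _ IHA _ IHB] h.
- have [[x Cx]|nC] := pselect (C !=set0); last first.
    by rewrite (_ : C = set0) //; apply/seteqP; split=> // y Cy; case: nC; exists y.
  apply: (@sub_finite_set _ _ [set x]) => // y Cy /=; apply: contrapT => nyx.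
  have aux u v : C u -> C v -> u < v -> False.
    move=> Cu Cv uv; have [w /andP[uw wv]] := h u v uv; apply.
    by apply: (cC u w v) => //; rewrite !ltW.
  have [xy|yx|xy] := ltgtP x y.
  - exact: aux Cx Cy xy.
  - exact: aux Cy Cx yx.
  - by move: nyx; rewrite xy.
- rewrite finite_setU; split.
    by apply: IHA => a b ab; have [y yab nAB] := h a b ab; exists y => // ?; apply: nAB; left.
  by apply: IHB => a b ab; have [y yab nAB] := h a b ab; exists y => // ?; apply: nAB; right.
Qed.

(** Cantor's nested intervals: stage n shrinks strictly inside the previous interval and avoids
    [u n]; the supremum of the left ends lies in all of them. *)
Lemma uncountable_itv (u : nat -> R) a b : a < b -> exists2 y, a < y < b & forall n, y <> u n.
Proof.
move=> ab.
pose P (p q : R * R) (n : nat) := p.1 < q.1 /\ q.1 < q.2 /\ q.2 < p.2 /\ (u n < q.1 \/ q.2 < u n).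
have step (p : R * R) n : exists q, p.1 < p.2 -> P p q n.
  have [pp|] := pselect (p.1 < p.2); last by exists p.
  have [c /andP[c1 c2]] : exists c, p.1 < c < p.2.
    by have [c] := rat_in_itvoo pp; rewrite in_itv /= => ?; exists (ratr c).
  have mid (x y : R) : x < y -> exists c, x < c < y.
    by move=> xy; have [d] := rat_in_itvoo xy; rewrite in_itv /= => ?; exists (ratr d).
  have [d /andP[d1 d2]] := mid _ _ c1; have [e /andP[e1 e2]] := mid _ _ d1.
  have [f /andP[f1 f2]] := mid _ _ c2.
  have [uc|uc] := ltP (u n) c; last by exists (e, d) => _; split=> //=; split=> //; split;
    [exact: lt_trans d2 c2|right; exact: lt_le_trans d2 uc].
  have [g /andP[g1 g2]] := mid _ _ f2.
  exists (f, g) => _; split=> /=; first exact: lt_trans c1 f1.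
  by split=> //; split=> //; left; exact: lt_trans uc f1.
have /choice [F hF] : forall pn : (R * R) * nat, exists q, pn.1.1 < pn.1.2 -> P pn.1 q pn.2.
  by move=> [p n]; exact: step.
pose s := fix s n : R * R := if n is n'.+1 then F (s n', n') else (a, b).
have s_lt n : (s n).1 < (s n).2.
  by elim: n => //= n IH; have [_ []] := hF (s n, n) IH.
have sP n : P (s n) (s n.+1) n by have := hF (s n, n) (s_lt n).
have s1 m n : (m <= n)%N -> (s m).1 <= (s n).1.
  elim: n => [|n IH]; first by rewrite leqn0 => /eqP->.
  rewrite leq_eqVlt => /predU1P[->//|/IH h]; apply: le_trans h _.
  by have [/ltW] := sP n.
have s2 m n : (m <= n)%N -> (s n).2 <= (s m).2.
  elim: n => [|n IH]; first by rewrite leqn0 => /eqP->.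
  rewrite leq_eqVlt => /predU1P[->//|/IH h]; apply: le_trans h.
  by have [_ [_ [/ltW]]] := sP n.
have s12 m n : (s m).1 <= (s n).2.
  have [mn|nm] := leqP m n.
    exact: le_trans (s1 _ _ mn) (ltW (s_lt n)).
  exact: le_trans (ltW (s_lt m)) (s2 _ _ (ltnW nm)).
pose E := range (fun n => (s n).1).
have supE : has_sup E.
  by split; [exists a, 0%N|exists b => _ [n _ <-]; exact: (s12 n 0%N)].
pose y := sup E.
have y1 n : (s n).1 <= y by apply: ub_le_sup; [exact: supE.2|exists n].
have y2 n : y <= (s n).2 by apply: ge_sup; [exact: supE.1|move=> _ [m _ <-]].
exists y => [|n yn].
  have [h1 [h2 [h3 _]]] := sP 0%N.
  by rewrite (lt_le_trans h1 (y1 1%N)) (le_lt_trans (y2 1%N) h3).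
have [_ [_ [_ [h|h]]]] := sP n.
  by have := lt_le_trans h (y1 n.+1); rewrite yn ltxx.
by have := le_lt_trans (y2 n.+1) h; rewrite yn ltxx.
Qed.

Lemma nbhs_itv x (P : set R) :
  nbhs x P <-> exists a b, a < x < b /\ forall y, a < y < b -> P y.
Proof.
rewrite nbhs_ballP; split.
  move=> [e /= e0 h]; exists (x - e), (x + e); split.
    by rewrite ltrBlDr ltrDl e0.
  move=> y /andP[h1 h2]; apply: h.
  by rewrite /ball /= ltr_distl ltrBlDr h2 -ltrBlDr h1.
move=> [a [b [/andP[ax xb] h]]]; exists (Num.min (x - a) (b - x)).
  by rewrite /= lt_min !subr_gt0 ax.
move=> y; rewrite /ball /= lt_min !ltr_norml => /andP[/andP[_ h1] /andP[h2 _]].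
apply: h; apply/andP; split.
  by move: h1; rewrite ltrD2l ltrN2.
by move: h2; rewrite opprB ltrD2l ltrN2.
Qed.

Lemma rat_between a b : a < b -> exists q : rat, a < ratr q < b.
Proof. by move=> /rat_in_itvoo[q]; rewrite in_itv /= => ?; exists q. Qed.

(** Choosing the gap rational keeps the conditions of the later arguments within a countable
    family. *)
Lemma finite_gap_left (F : set R) y : finite_set F ->
  exists2 q : rat, ratr q < y & forall z, F z -> ratr q <= z -> y <= z.
Proof.
move=> /finite_seqP [s ->]; elim: s => [|t s [q qy h]].
  have [|q /andP[_ qy]] := @rat_between (y - 1) y; first by rewrite ltrBlDr ltrDl.
  by exists q.
have [ty|yt] := ltP t y.
  have [|r /andP[]] := @rat_between (Num.max t (ratr q)) y; first by rewrite gt_max ty.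
  rewrite gt_max => /andP[tr qr] ry; exists r => // z; rewrite /= inE => /predU1P[->|zs] rz.
    by have := lt_le_trans tr rz; rewrite ltxx.
  by apply: h => //; apply: le_trans rz; apply: ltW.
by exists q => // z; rewrite /= inE => /predU1P[-> //|]; apply: h.
Qed.

Lemma finite_gap_right (F : set R) y : finite_set F ->
  exists2 q : rat, y < ratr q & forall z, F z -> z <= ratr q -> z <= y.
Proof.
move=> fF; have [|q qy h] := @finite_gap_left (-%R @` F) (- y); first exact: finite_image.
exists (- q); first by rewrite raddfN /= ltrNr.
move=> z Fz; rewrite raddfN /= => zq; rewrite -lerN2; apply: h; first by exists z.
by rewrite lerNr.
Qed.

Lemma finite_min (F : set R) : finite_set F -> F !=set0 ->
  exists2 m, F m & forall z, F z -> m <= z.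
Proof.
move=> /finite_seqP [s ->]; elim: s => [[x //]|t s IH _].
have [[x xs]|ns] := pselect ([set` s] !=set0); last first.
  exists t; first by rewrite /= inE eqxx.
  by move=> z /=; rewrite inE => /predU1P[-> //|zs]; case: ns; exists z.
have [|m ms mle] := IH; first by exists x.
exists (Num.min m t); first by rewrite /= inE; case: (leP m t); rewrite ?eqxx // (ms : m \in s) orbT.
move=> z /=; rewrite inE ge_min => /predU1P[->|/mle ->//]; by rewrite lexx orbT.
Qed.

End RealLine.

(* Connectedness of the subspace W: locally constant predicates spare the
   relatively open subsets. *)
Definition lconnected (T : topologicalType) (W : set T) :=
  forall P : T -> Prop,
  (forall x, W x -> nbhs x (fun x' => W x' -> (P x' <-> P x))) ->
  forall x y, W x -> W y -> P x -> P y.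

Definition cont_in (T T' : topologicalType) (W : set T) (f : T -> T') :=
  forall x, W x -> forall P, nbhs (f x) P -> nbhs x (fun x' => W x' -> P (f x')).

Lemma lconnected_image (T T' : topologicalType) (W : set T) (f : T -> T') :
  lconnected W -> cont_in W f -> lconnected (f @` W).
Proof.
move=> cW cf P hP _ _ [x Wx <-] [y Wy <-]; apply: (cW (P \o f)) => // z Wz.
have fWz : (f @` W) (f z) by exists z.
have := cf z Wz _ (hP _ fWz); apply: filterS => z' h Wz'; apply: h => //; by exists z'.
Qed.

(** Completeness of the reals enters here, and with it the passage from definable connectedness to
    connectedness. *)
Lemma lconnected_convex (R : realType) (I : set R) : convex_set I -> lconnected I.
Proof.
move=> cI P hP.
suff h x y : I x -> I y -> x < y -> P x <-> P y.
  move=> x y Ix Iy Px; have [xy|yx|<- //] := ltgtP x y; first exact/(h _ _ Ix Iy xy).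
  by apply/(h _ _ Iy Ix yx).
move=> Ix Iy xy.
(* [E] collects the points up to which [P] keeps its value at [x]. At its supremum local constancy
   reaches further to the right, which is absurd unless [y] has been reached. *)
pose E := [set t | x <= t <= y /\ forall z, x <= z <= t -> P z <-> P x].
have Ex : E x.
  by split; [rewrite lexx ltW|move=> z /le_anti ->].
have supE : has_sup E by split; [exists x|exists y => t [/andP[]]].
pose s := sup E.
have xs : x <= s by apply: ub_le_sup => //; exact: supE.2.
have sy : s <= y by apply: ge_sup; [exact: supE.1|move=> t [/andP[]]].
have Is : I s by apply: (cI x s y) => //; rewrite xs.
have /nbhs_itv [a [b [/andP[as_ sb] hab]]] := hP _ Is.
have Psame z : a < z < b -> x <= z <= y -> P z <-> P s.
  by move=> zab xzy; apply: hab => //; apply: (cI x z y).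
have [t [/andP[xt ty] Et] at_] : exists2 t, E t & a < t.
  apply: contrapT => h; have : s <= a; last by rewrite leNgt as_.
  apply: ge_sup; first exact: supE.1.
  by move=> t Et; rewrite leNgt; apply/negP => at_; apply: h; exists t.
have ts : t <= s by apply: ub_le_sup; [exact: supE.2|split; rewrite ?xt].
have Psx : P s <-> P x.
  rewrite -(Psame t) ?at_ ?(le_lt_trans ts sb) ?xt ?ty //.
  by apply: Et; rewrite xt lexx.
have Px_lt z : x <= z <= y -> z < b -> P z <-> P x.
  move=> /andP[xz zy] zb; have [zt|tz] := leP z t; first by apply: Et; rewrite xz.
  by rewrite -Psx; apply: Psame; rewrite ?zb ?xz ?zy // (lt_trans at_ tz).
have [bs|yb] := leP b y; last by symmetry; apply: Px_lt => //; rewrite lexx ltW.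
have [q /andP[sq qb]] := rat_between sb.
have : ratr q <= s.
  apply: ub_le_sup; first exact: supE.2.
  split; first by rewrite (ltW (le_lt_trans xs sq)) (ltW (lt_le_trans qb bs)).
  move=> z /andP[xz zq]; apply: Px_lt; last exact: le_lt_trans qb.
  by rewrite xz (le_trans zq) // (ltW (lt_le_trans qb bs)).
by rewrite leNgt sq.
Qed.

HB.instance Definition _ := hasNbhs.Build unit principal_filter.
HB.instance Definition _ := Discrete_ofNbhs.Build unit erefl.

Section Omin.
Variables (R : realType) (M : structure1 R).

Lemma coded_R : coded M R.
Proof.
apply: (@Coded _ _ _ _ (self R)).
- by exists [:: existT _ tt tt] => -[[] []]; left.
- by exists (Fimp (Fbot _ _) (Fbot _ _)), (fun _ _ => 0) => x; split=> // _ [].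
- by move=> t; exists (fun _ _ => t).
- exists (@Feq _ _ M (fun s => (unit + unit + nat)%type) tt
    (Tvar _ (inl (inl tt) : (unit + unit + nat)%type))
    (Tvar _ (inl (inr tt) : (unit + unit + nat)%type))), (fun _ _ => 0) => x /=.
  by split=> [[]|].
Defined.
#[local] Existing Instance coded_R.

Lemma coded_unitR : coded M unit.
Proof. exact: coded_unit coded_R. Defined.
#[local] Existing Instance coded_unitR.

(** Iterated pairs rather than functions on ['I_n]: every induction on dimension fibres R^(n+1) over
    its first n coordinates. *)
Fixpoint Rn (n : nat) : topologicalType :=
  if n is m.+1 then (Rn m * R)%type else unit.

Fixpoint coded_Rn n : coded M (Rn n) :=
  match n with 0 => coded_unitR | m.+1 => coded_prod (coded_Rn m) coded_R end.
#[local] Existing Instance coded_Rn.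

Hypothesis M_order : expansion (order_structure R) M.

Lemma def_lt0 : def M (fun t : R * R => t.1 < t.2).
Proof.
case: M_order => N1 e.
change (@definable unit (fun=> R : Type) M (fun=> (unit + unit)%type : finType)
  (fun x => (True /\ True) /\ x tt (inl tt) < x tt (inr tt))); rewrite e.
exists (@Frel _ _ (join_structure (order_structure R) N1) (fun s => (unit + unit + nat)%type) (inl tt)
  (fun i : 'I_2 => if i == ord0 then Tvar _ (inl (inl tt) : (unit + unit + nat)%type)
    else Tvar _ (inl (inr tt) : (unit + unit + nat)%type))), (fun _ _ => 0) => x /=.
by split=> [[]|].
Qed.

Section T.
Context {T : Type} {cT : coded M T}.
Implicit Types f g : T -> R.

Lemma def_lt f g : dmap M f -> dmap M g -> def M (fun x => f x < g x).
Proof. by move=> df dg; exact: (def_comp (dmap_pair df dg) def_lt0). Qed.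

Lemma def_le f g : dmap M f -> dmap M g -> def M (fun x => f x <= g x).
Proof.
move=> df dg; apply: def_iff (def_not (def_lt dg df)) => x.
by rewrite leNgt; split=> /negP.
Qed.

(** Handles endpoints of intervals that may be infinite, [None] standing for the missing
    endpoint. *)
Lemma def_option (P : option R -> T -> Prop) :
  def M (P None) -> def M (fun t : R * T => P (Some t.1) t.2) -> def M (fun x => forall p, P p x).
Proof.
move=> d1 d2; have d2' : def M (fun x => forall p : R, P (Some p) x).
  apply: (@def_all _ _ _ _ _ _ _ (fun x p => P (Some p) x)).
  refine (def_comp (P := fun t : R * T => P (Some t.1) t.2) (f := fun t : T * R => (t.2, t.1)) _ d2).
  by solve_dmap.
by apply: def_iff (def_and d1 d2') => x; split=> [[h1 h2] [p|]|h]; [exact: h2|exact: h1|split].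
Qed.

End T.

End Omin.

Ltac solve_def_atom ::= lazymatch goal with
  | |- def _ (fun x => is_true (@Order.lt _ _ (@?f x) (@?g x))) =>
      refine (def_lt (f := f) (g := g) _ _ _); [eassumption|solve_dmap|solve_dmap]
  | |- def _ (fun x => is_true (@Order.le _ _ (@?f x) (@?g x))) =>
      refine (def_le (f := f) (g := g) _ _ _); [eassumption|solve_dmap|solve_dmap]
  end.

(** * Boxes as a base of neighbourhoods *)

Fixpoint bx (R : realType) n : Rn R n -> Rn R n -> Rn R n -> Prop :=
  if n is m.+1 then fun l u x => bx l.1 u.1 x.1 /\ l.2 < x.2 < u.2 else fun _ _ _ => True.

Fixpoint Qn n : countType := if n is m.+1 then (Qn m * rat)%type else unit.

Fixpoint qr (R : realType) n : Qn n -> Rn R n :=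
  if n is m.+1 then fun q => (qr R q.1, ratr q.2) else fun q => q.

Section Boxes.
Variable R : realType.

(** Rational boxes form a countable base, which lets interior conditions be expressed as countable
    unions. *)
Lemma nbhs_qbx n (x : Rn R n) P : nbhs x P <->
  exists q r : Qn n, bx (qr R q) (qr R r) x /\ forall y, bx (qr R q) (qr R r) y -> P y.
Proof.
elim: n x P => [[] P|n IH [x t] P].
  split; first by move=> /nbhs_singleton h; exists tt, tt; split=> // -[].
  by move=> [q [r [_ h]]]; rewrite nbhs_principalE => _ ->; apply: h.
split.
  move=> [[/= A B] [/IH [q [r [h1 h2]]] /nbhs_itv [a [b [/andP[at_ tb] hab]]]] h].
  have [q' /andP[aq qt]] := rat_between at_; have [r' /andP[tr rb]] := rat_between tb.
  exists (q, q'), (r, r'); split; first by split=> //=; rewrite qt.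
  move=> [y s] [/= y1 /andP[s1 s2]]; apply: h; split=> /=; first exact: h2.
  by apply: hab; rewrite (lt_trans aq s1) (lt_trans s2 rb).
move=> [[q q'] [[r r'] [[/= h1 h2] h]]].
exists (bx (qr R q) (qr R r), [set s | ratr q' < s < ratr r']).
  split=> /=; first by apply/IH; exists q, r.
  by apply/nbhs_itv; exists (ratr q'), (ratr r').
by move=> [y s] /= [y1 s1]; apply: h.
Qed.

Lemma nbhs_bx n (x : Rn R n) P : nbhs x P <->
  exists l u, bx l u x /\ forall y, bx l u y -> P y.
Proof.
split=> [/nbhs_qbx [q [r h]]|]; first by exists (qr R q), (qr R r).
elim: n x P => [[] P|n IH [x t] P].
  by move=> [q [r [_ h]]]; rewrite nbhs_principalE => _ ->; apply: h.
move=> [[q q'] [[r r'] [[/= h1 h2] h]]].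
exists (bx q r, [set s | q' < s < r']).
  split=> /=; first by apply: IH; exists q, r.
  by apply/nbhs_itv; exists q', r'.
by move=> [y s] /= [y1 s1]; apply: h.
Qed.

End Boxes.

#[export] Existing Instance coded_R.
#[export] Existing Instance coded_unitR.
#[export] Existing Instance coded_Rn.

(** * Thin sets *)

Section Thin.
Variables (R : realType) (M : structure1 R).
Hypothesis M_order : expansion (order_structure R) M.
Hypothesis M_ominimal : ominimal M.
Local Notation Rn := (Rn R).

Lemma def_bx n : def M (fun t : Rn n * Rn n * Rn n => bx t.1.1 t.1.2 t.2).
Proof.
elim: n => [|n IH] /=; first exact: def_cst.
by solve_def.
Qed.

Lemma def_nbhs (T : Type) (cT : coded M T) n (f : T -> Rn n) (P : T -> Rn n -> Prop) :
  dmap M f -> def M (fun t => P t.1 t.2) -> def M (fun t => nbhs (f t) (P t)).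
Proof.
move=> df dP; have db := def_bx n.
apply: (def_iff (P := fun t => exists l u, bx l u (f t) /\ forall y, bx l u y -> P t y)).
  by move=> t; rewrite nbhs_bx.
by solve_def.
Qed.

Lemma def_convex (X : set R) : def M X -> finite_union (@convex_set R) X.
Proof.
move=> /M_ominimal [s ->]; elim: s => [|I s IH].
  rewrite (_ : [set x | _] = set0); first exact: finite_union0.
  by apply/seteqP; split=> // x [].
rewrite (_ : [set x | _] = [set` I] `|` [set x | exists2 J, J \in s & x \in J]).
  apply: finite_unionU => //; apply: finite_union1.
  move=> x y z /=; case: I => [b1 b2]; rewrite !itv_boundlr => /andP[b1x _] /andP[_ zb2] /andP[xy yz].
  by rewrite (le_trans b1x) ?bnd_simp // (le_trans _ zb2) ?bnd_simp.
apply/seteqP; split=> x.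
  by move=> [J]; rewrite inE => /predU1P[->|Js] xJ; [left|right; exists J].
by move=> [xI|[J Js xJ]]; [exists I|exists J] => //; rewrite inE ?eqxx ?Js ?orbT.
Qed.

(** Empty interior. For definable sets this plays the role of having dimension less than n, and no
    dimension function is introduced. *)
Definition thin n (X : set (Rn n)) :=
  forall l u, (exists x, bx l u x) -> exists2 x, bx l u x & ~ X x.

(* The fibrewise countable sets form a sigma-ideal containing no nonempty box:
   this is how a nonempty open set is shown not to be a countable union of thin
   definable sets. *)
Fixpoint small n : set (Rn n) -> Prop :=
  if n is m.+1 then fun X => countable [set t : R | ~ small (fun x : Rn m => X (x, t))]
  else fun X => forall x, ~ X x.

Lemma small_sub n (X Y : set (Rn n)) : X `<=` Y -> small Y -> small X.
Proof.
elim: n X Y => [|n IH] X Y XY; first by move=> h x /XY; apply: h.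
apply: sub_countable; apply: subset_card_le => t; apply: contra_not.
by apply: IH => x; apply: XY.
Qed.

Lemma small_bigcup n (I : countType) (F : I -> set (Rn n)) :
  (forall i, small (F i)) -> small (\bigcup_i F i).
Proof.
elim: n F => [|n IH] F hF; first by move=> x [i _ /hF].
apply: (@sub_countable _ _ _ (\bigcup_i [set t : R | ~ small (fun x : Rn n => F i (x, t))])).
  apply: subset_card_le => t /= nt; apply: contrapT => h; apply: nt.
  apply: small_sub (IH (fun i x => F i (x, t)) _); first by move=> x [i _ ?]; exists i.
  by move=> i; apply: contrapT => hi; apply: h; exists i.
by apply: bigcup_countable => // i _; exact: hF.
Qed.

Lemma small_bx n (l u x : Rn n) : bx l u x -> ~ small (bx l u).
Proof.
elim: n l u x => [|n IH] l u x; first by move=> _ /(_ tt); apply.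
move=> [/= bx1 /andP[h1 h2]] /countable_injP [f finj].
have lu : l.2 < u.2 := lt_trans h1 h2.
have nsm t : l.2 < t < u.2 -> ~ small (fun y : Rn n => bx l.1 u.1 y /\ l.2 < t < u.2).
  by move=> tlu /small_sub h; apply: (IH _ _ _ bx1); apply: h => y.
(* [g] is a partial inverse of the injection [f] of the exceptional set into the integers, hence an
   enumeration of the interval; the point [y] that it misses contradicts injectivity. *)
pose g k := xget 0 [set t | l.2 < t < u.2 /\ f t = k].
have [y yab /(_ (f y))] := uncountable_itv g lu; apply.
have : [set t | l.2 < t < u.2 /\ f t = f y] (g (f y)).
  by apply: (@xgetPex _ _ _ _); exists y.
move=> [gy fgy]; apply: finj => //; rewrite inE /=; exact: nsm.
Qed.

(** A fibre that is not small has interior, by induction, hence contains a rational box. For a given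
    rational box the set of [t] whose fibre contains it is definable and contains no interval, as
    [X] is thin; by o-minimality it is finite. There are countably many boxes, so countably many
    exceptional fibres. *)
Lemma thin_small n (X : set (Rn n)) : def M X -> thin X -> small X.
Proof.
elim: n X => [|n IH] X dX tX.
  by move=> x Xx; have [|[] _] := tX tt tt; [exists tt|case: x Xx].
have db := def_bx n.
pose F (qr_ : Qn n * Qn n) := [set t : R | (exists x, bx (qr R qr_.1) (qr R qr_.2) x) /\
   forall x, bx (qr R qr_.1) (qr R qr_.2) x -> X (x, t)].
have dF i : def M (F i) by rewrite /F; solve_def.
apply: (@sub_countable _ _ _ (\bigcup_i F i)); last first.
  apply: bigcup_countable => // i _; apply: finite_set_countable.
  apply: thin_convex_finite; first exact: def_convex.
  move=> a b ab; apply: contrapT => h.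
  have {}h t : a < t < b -> F i t by move=> tab; apply: contrapT => nF; apply: h; exists t.
  have [c cab] := rat_between ab; have [[x xb] _] := h _ cab.
  have [|[y t] [/= yb tb]] := tX (qr R i.1, a) (qr R i.2, b); first by exists (x, ratr c).
  by apply; have [_] := h _ tb; apply.
apply: subset_card_le => t /= nsm.
have dXt : def M (fun x => X (x, t)) by solve_def.
have : ~ thin (fun x => X (x, t)) by move=> /(IH _ dXt).
move=> /existsNP [l /existsNP [u /not_implyP [[x lux] nX]]].
have : nbhs x (fun x => X (x, t)).
  by apply/nbhs_bx; exists l, u; split=> // y hy; apply: contrapT => nXy; apply: nX; exists y.
by move=> /nbhs_qbx [q [r [h1 h2]]]; exists (q, r) => //; split=> //; exists x.
Qed.

(** The substitute for dimension theory: the exceptional set of a condition is covered by one thin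
    definable set for each choice of rational data. *)
Lemma thin_cover n (I : countType) (X : set (Rn n)) (F : I -> set (Rn n)) :
  (forall i, def M (F i)) -> (forall i, thin (F i)) -> X `<=` \bigcup_i F i -> thin X.
Proof.
move=> dF tF XF l u [x lux]; apply: contrapT => h.
apply: (small_bx lux); apply: small_sub (small_bigcup (fun i => thin_small (dF i) (tF i))).
by move=> y ly; apply: XF; apply: contrapT => nX; apply: h; exists y.
Qed.

Lemma thin_sub n (X Y : set (Rn n)) : X `<=` Y -> thin Y -> thin X.
Proof. by move=> XY tY l u /tY [x lux nY]; exists x => // /XY. Qed.

Lemma thinU n (X Y : set (Rn n)) : def M X -> def M Y -> thin X -> thin Y -> thin (X `|` Y).
Proof.
move=> dX dY tX tY; apply: (@thin_cover _ bool _ (fun b => if b then X else Y)).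
- by case.
- by case.
- by move=> x [h|h]; [exists true|exists false].
Qed.

Lemma thinN n (X : set (Rn n)) : ~ thin X <->
  exists x : Rn n, nbhs x X.
Proof.
split.
  move=> /existsNP [l /existsNP [u /not_implyP [[x lux] nX]]]; exists x; apply/nbhs_bx.
  by exists l, u; split=> // y hy; apply: contrapT => nXy; apply: nX; exists y.
move=> [x /nbhs_bx [l [u [lux h]]]] /(_ l u) [|y /h //]; by exists x.
Qed.

Definition stable n (X : set (Rn n)) (x : Rn n) := nbhs x X \/ nbhs x (~` X).

Lemma def_stable n (X : set (Rn n)) : def M X -> def M (stable X).
Proof.
by move=> dX; apply: def_or; apply: (@def_nbhs _ _ _ id); rewrite ?/setC; solve_def; exact: dmap_id.
Qed.

(** An unstable point lies in [X] or in its complement without being interior to it, and a set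
    deprived of its interior has empty interior. *)
Lemma thin_unstable n (X : set (Rn n)) : def M X -> thin (~` stable X).
Proof.
move=> dX.
have dX' : def M (~` X) by solve_def.
have d1 Y : def M Y -> def M (Y `\` [set x : Rn n | nbhs x Y]).
  move=> dY; have dYn : def M (fun x => nbhs x Y) by apply: (@def_nbhs _ _ _ id); solve_def; exact: dmap_id.
  by solve_def.
have t1 Y : thin (Y `\` [set x : Rn n | nbhs x Y]).
  apply: contrapT => /thinN [x h]; have [_] := nbhs_singleton h; apply.
  by apply: filterS h => y [].
apply: thin_sub (thinU (d1 _ dX) (d1 _ dX') (t1 X) (t1 (~` X))).
move=> x /not_orP [h1 h2]; have [Xx|nXx] := pselect (X x); first by left.
by right.
Qed.

End Thin.

(** * Decomposition of definable sets *)

Section FiniteUnion.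
Context {T : Type}.
Implicit Types (C D : set T -> Prop) (X Y : set T).

Lemma finite_union_subset C X :
  finite_union C X -> finite_union (fun P => C P /\ P `<=` X) X.
Proof.
move=> h; suff {h} H Y : finite_union C Y -> Y `<=` X -> finite_union (fun P => C P /\ P `<=` X) Y.
  exact: H.
elim=> [_|P CP PX|P Q _ IHP _ IHQ PQX]; first exact: finite_union0.
  exact: finite_union1.
by apply: finite_unionU; [apply: IHP|apply: IHQ] => x h; apply: PQX; [left|right].
Qed.

Lemma finite_union_bind (T' : Type) (D : set T' -> Prop) C X (F : set T -> set T') :
  F set0 = set0 -> (forall P Q, F (P `|` Q) = F P `|` F Q) ->
  finite_union C X -> (forall P, C P -> P `<=` X -> finite_union D (F P)) ->
  finite_union D (F X).
Proof.
move=> F0 FU /finite_union_subset h H.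
elim: h => [|P [CP PX]|P Q _ IHP _ IHQ]; first by rewrite F0; exact: finite_union0.
  exact: H.
by rewrite FU; apply: finite_unionU.
Qed.

Lemma finite_union_image (T' : Type) (D : set T' -> Prop) C X (f : T -> T') :
  finite_union C X -> (forall P, C P -> P `<=` X -> finite_union D (f @` P)) ->
  finite_union D (f @` X).
Proof.
by apply: finite_union_bind => [|P Q]; [exact: image_set0|exact: image_setU].
Qed.

Lemma finite_union_lt C (m : nat) (F : nat -> set T) :
  (forall j, (j < m)%N -> finite_union C (F j)) ->
  finite_union C [set t | exists2 j, (j < m)%N & F j t].
Proof.
elim: m => [|m IH] h.
  rewrite (_ : [set _ | _] = set0); first exact: finite_union0.
  by apply/seteqP; split=> // t [].
rewrite (_ : [set _ | _] = [set t | exists2 j, (j < m)%N & F j t] `|` F m).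
  by apply: finite_unionU; [apply: IH => j jm; apply: h; exact: ltnW|exact: h].
apply/seteqP; split=> t.
  by move=> [j]; rewrite ltnS leq_eqVlt => /predU1P[->|jm] Fj; [right|left; exists j].
by move=> [[j jm Fj]|Fm]; [exists j => //; exact: ltnW|exists m].
Qed.

Definition over (T' : Type) (X : set (T * T')) (W : set T) : set (T * T') :=
  [set t | X t /\ W t.1].

Lemma finite_union_over (T' : Type) (D : set (T * T') -> Prop) C W (X : set (T * T')) :
  finite_union C W -> (forall P, C P -> P `<=` W -> finite_union D (over X P)) ->
  finite_union D (over X W).
Proof.
apply: finite_union_bind => [|P Q]; first by apply/seteqP; split=> t // [].
by apply/seteqP; split=> t [] => [Xt [|]|[]|[]] *; [left|right|split=> //; left|split=> //; right].
Qed.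

End FiniteUnion.

(** By convexity a locally constant [P] is constant on each fibre. Since a height present over [x]
    persists over nearby points of [W], the resulting predicate [Q] on the base is locally constant
    too. *)
Lemma lconnected_band (T : topologicalType) (R : realType) (W : set T) (B : set (T * R)) :
  lconnected W -> (forall t, B t -> W t.1) ->
  (forall x, W x -> convex_set [set y | B (x, y)]) ->
  (forall x, W x -> exists y, B (x, y)) ->
  (forall x y, B (x, y) -> nbhs x (fun x' => W x' -> B (x', y))) ->
  lconnected B.
Proof.
move=> cW BW cB B0 Bo P hP.
have fib x y y' : B (x, y) -> B (x, y') -> P (x, y) -> P (x, y').
  move=> Bxy Bxy'; have Wx := BW _ Bxy.
  apply: (lconnected_convex (cB x Wx) (P := fun y => P (x, y))) => // z Bz.
  have [[/= N1 N2] [/= N1x N2z] h] := hP _ Bz.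
  by apply: filterS N2z => w N2w; apply: (h (x, w)); split=> //=; exact: nbhs_singleton.
pose Q x := exists2 y, B (x, y) & P (x, y).
have hQ x : W x -> nbhs x (fun x' => W x' -> (Q x' <-> Q x)).
  move=> Wx; have [y Bxy] := B0 x Wx.
  have [[/= N1 N2] [/= N1x N2y] h] := hP _ Bxy.
  apply: filterS (filterI N1x (Bo _ _ Bxy)) => x' [N1x' hB] Wx'.
  have [h1 h2] := h (x', y) (conj N1x' (nbhs_singleton N2y)) (hB Wx').
  split=> -[z Bz Pz]; exists y => //; try exact: hB.
    exact: h1 (fib _ _ _ Bz (hB Wx') Pz).
  exact: h2 (fib _ _ _ Bz Bxy Pz).
move=> [x y] [x' y'] Bxy Bxy' Pxy.
have [|z Bz Pz] := cW Q hQ _ _ (BW _ Bxy) (BW _ Bxy'); first by exists y.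
exact: fib Bz Bxy' Pz.
Qed.

(** The closed interval from [p] to [q], unbounded on the side of a [None]. Unbounded intervals let
    [usc] forbid points that come in from infinity. *)
Definition inI (R : realType) (p q : option R) (y : R) :=
  (if p is Some a then a <= y else true) && (if q is Some b then y <= b else true).

Ltac solve_def_atom ::= lazymatch goal with
  | |- def _ (fun x => is_true (@Order.lt _ _ (@?f x) (@?g x))) =>
      refine (def_lt (f := f) (g := g) _ _ _); [eassumption|solve_dmap|solve_dmap]
  | |- def _ (fun x => is_true (@Order.le _ _ (@?f x) (@?g x))) =>
      refine (def_le (f := f) (g := g) _ _ _); [eassumption|solve_dmap|solve_dmap]
  | |- def _ (fun x => @nbhs _ _ (@?f x) (@?P x)) =>
      refine (def_nbhs _ (f := f) (P := P) _ _); [eassumption|solve_dmap|solve_def]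
  end.

(** * Definable sets with finite fibres *)

Section Sheets.
Variables (R : realType) (M : structure1 R).
Hypothesis M_order : expansion (order_structure R) M.
Hypothesis M_ominimal : ominimal M.
Variable n : nat.
Local Notation T := (Rn R n).
Implicit Types (A : set (T * R)) (W : set T).

(* Together these say that, near x, the fibres of A are the values of finitely
   many continuous functions. *)
Definition lsc A (x : T) := forall y a b, A (x, y) -> a < y < b ->
  nbhs x (fun x' => exists y', a < y' < b /\ A (x', y')).

Definition single_sheet A (x : T) := forall y, A (x, y) -> exists a b, a < y < b /\
  nbhs x (fun x' => forall y' y'', a < y' < b -> a < y'' < b ->
    A (x', y') -> A (x', y'') -> y' = y'').

Definition usc A (x : T) := forall p q : option R, (forall y, inI p q y -> ~ A (x, y)) ->
  nbhs x (fun x' => forall y, inI p q y -> ~ A (x', y)).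

Definition good A x := [/\ lsc A x, single_sheet A x & usc A x].

Lemma def_good A : def M A -> def M (good A).
Proof.
move=> dA.
have d1 : def M (lsc A) by rewrite /lsc; solve_def.
have d2 : def M (single_sheet A) by rewrite /single_sheet; solve_def.
have d3 : def M (usc A).
  by rewrite /usc; do 2 (apply: def_option); rewrite /inI /=; solve_def.
apply: (def_iff (P := fun x => lsc A x /\ single_sheet A x /\ usc A x)).
  by move=> x; split=> [[? []]|[]].
by solve_def.
Qed.

(** For rational endpoints each of the three conditions describes a definable set [E i] of base
    points. A base point stable for every [E i] is good, because finiteness of the fibre allows real
    endpoints to be replaced by rational ones; the bad points are thus covered by countably many
    thin boundaries. *)
Lemma thin_bad A : def M A -> (forall x, finite_set [set y | A (x, y)]) -> thin (~` good A).
Proof.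
move=> dA fA.
pose qo (p : option rat) : option R := omap ratr p.
pose E (i : (rat * rat) + (rat * rat) + (option rat * option rat)) : set T := match i with
  | inl (inl q) => [set x | exists y', ratr q.1 < y' < ratr q.2 /\ A (x, y')]
  | inl (inr q) => [set x | forall y' y'', ratr q.1 < y' < ratr q.2 ->
      ratr q.1 < y'' < ratr q.2 -> A (x, y') -> A (x, y'') -> y' = y'']
  | inr q => [set x | forall y, inI (qo q.1) (qo q.2) y -> ~ A (x, y)]
  end.
have dE i : def M (E i).
  case: i => [[q|q]|[[p|] [q|]]]; rewrite /E /inI /=; solve_def.
apply: (@thin_cover _ _ M_order M_ominimal _ _ _ (fun i => ~` stable (E i))).
- by move=> i; have := def_stable M_order (dE i) => ?; solve_def.
- by move=> i; apply: (thin_unstable M_order M_ominimal (dE i)).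
move=> x; apply: contra_notP => h.
have {}h i : E i x -> nbhs x (E i).
  move=> Ex; apply: contrapT => nE; apply: h; exists i => //= -[//|/nbhs_singleton]; exact.
split.
- move=> y a b Axy /andP[ay yb].
  have [q /andP[aq qy]] := rat_between ay; have [r /andP[yr rb]] := rat_between yb.
  have /h : E (inl (inl (q, r))) x by exists y; rewrite /= qy yr.
  apply: filterS => x' [y' [/= /andP[qy' y'r] Ay']]; exists y'; split=> //.
  by rewrite (lt_trans aq qy') (lt_trans y'r rb).
- move=> y Axy; have [q qy hq] := finite_gap_left y (fA x).
  have [r yr hr] := finite_gap_right y (fA x).
  exists (ratr q), (ratr r); split; first by rewrite qy yr.
  apply: (h (inl (inr (q, r)))) => y' y'' /= /andP[h1 h2] /andP[h3 h4] Ay' Ay''.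
  have e z : ratr q < z -> z < ratr r -> A (x, z) -> z = y.
    by move=> qz zr Az; apply: le_anti; rewrite hr ?hq // ltW.
  by rewrite (e y') // (e y'').
- move=> p q hpq.
  (* The interval is enlarged to rational endpoints without catching any new point of the finite
     fibre over [x]. *)
  have [p' [pp' hp]] : exists p' : option rat, (forall y, inI p None y -> inI (qo p') None y) /\
      forall z, A (x, z) -> inI (qo p') None z -> inI p None z.
    case: p {hpq} => [a|]; last by exists None.
    have [c ca hc] := finite_gap_left a (fA x); exists (Some c); split=> y; rewrite /inI /= ?andbT.
      by apply: le_trans; exact: ltW.
    exact: hc.
  have [q' [qq' hq]] : exists q' : option rat, (forall y, inI None q y -> inI None (qo q') y) /\
      forall z, A (x, z) -> inI None (qo q') z -> inI None q z.
    case: q {hpq} => [a|]; last by exists None.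
    have [c ca hc] := finite_gap_right a (fA x); exists (Some c); split=> y; rewrite /inI /=.
      by move=> ya; apply: le_trans ya _; exact: ltW.
    exact: hc.
  have inIE u v (y : R) : inI u v y = inI u None y && inI None v y by rewrite /inI andbT.
  have /h : E (inr (p', q')) x.
    move=> y /=; rewrite inIE => /andP[h1 h2] Axy; apply: (hpq y) => //.
    by rewrite inIE hp ?hq.
  apply: filterS => x' /= h' y; rewrite inIE => /andP[/pp' h1 /qq' h2].
  by apply: h'; rewrite inIE h1.
Qed.

(** Induction on the size of a single fibre, the one over [x0]. Connectedness of [W] makes all
    fibres empty or all nonempty; in the second case the lowest points form a continuous sheet, and
    removing it leaves a set that is still good and has one point less over [x0]. *)
Lemma sheets A W : def M A -> (forall x, finite_set [set y | A (x, y)]) ->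
  lconnected W -> (forall x, W x -> good A x) ->
  exists (m : nat) (f : nat -> T -> R), [/\ forall j, dmap M (f j),
    forall j, (j < m)%N -> cont_in W (f j),
    forall x, W x -> forall y, A (x, y) <-> exists2 j, (j < m)%N & y = f j x &
    forall x j, W x -> (j.+1 < m)%N -> f j x < f j.+1 x].
Proof.
move=> dA fA cW.
have [[x0 Wx0]|W0] := pselect (W !=set0); last first.
  by move=> _; exists 0%N, (fun _ _ => 0); split=> [j|j|x Wx|x j Wx] //; [exact: dmap_cst|case: W0; exists x].
have [s sA] : exists s : seq R, forall y, A (x0, y) -> y \in s.
  by have /finite_seqP [s e] := fA x0; exists s => y Ay; have : [set y | A (x0, y)] y by []; rewrite e.
have [k] := ubnP (size s); elim: k A dA fA s sA => // k IH A dA fA s sA sk gA.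
pose P x := forall y, ~ A (x, y).
have hP x : W x -> nbhs x (fun x' => W x' -> (P x' <-> P x)).
  move=> Wx; have [lA _ uA] := gA x Wx.
  have [Px|] := pselect (P x).
    have /uA : forall y : R, inI None None y -> ~ A (x, y) by move=> y _; exact: Px.
    by apply: filterS => x' hx' _; split=> // _ y; exact: hx'.
  move=> nPx; move: (nPx) => /existsNP [y /contrapT Axy].
  have := lA y (y - 1) (y + 1) Axy; rewrite ltrBlDr ltrDl ltr01 => /(_ isT).
  by apply: filterS => x' [y' [_ Ay']] _; split=> // /(_ _ Ay').
have [P0|nP0] := pselect (P x0).
  have allP x : W x -> P x by move=> Wx; exact: (cW P hP x0).
  exists 0%N, (fun _ _ => 0); split=> // [j|x Wx y]; first exact: dmap_cst.
  by split=> [/allP|[]] //; apply.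
have A0 x : W x -> [set y | A (x, y)] !=set0.
  move=> Wx; apply: contrapT => h; apply: nP0; apply: (cW P hP x) => // y Axy.
  by apply: h; exists y.
pose Q x y := A (x, y) /\ forall z, A (x, z) -> y <= z.
have [f0 [df0 Qf0 _]] : exists f, [/\ dmap M f, (forall x y, Q x y -> f x = y) &
    (forall x, (forall y, ~ Q x y) -> f x = 0)].
  apply: dmap_choice; first by rewrite /Q; solve_def.
  by move=> x y y' [h1 h2] [h3 h4]; apply: le_anti; rewrite h2 // h4.
have f0P x : [set y | A (x, y)] !=set0 -> Q x (f0 x).
  move=> h; have [y Ay hy] := finite_min (fA x) h.
  by have Qxy : Q x y by []; rewrite (Qf0 _ _ Qxy).
(* [usc] keeps the nearby fibres above [a], and [lsc] puts a point of them below [b]; the lowest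
   point is then caught in between. *)
have f0c x a b : W x -> a < f0 x < b -> nbhs x (fun x' => a < f0 x' < b /\ A (x', f0 x')).
  move=> Wx /andP[af fb]; have [lA _ uA] := gA x Wx; have [Af hf] := f0P x (A0 x Wx).
  have /uA h1 : forall y, inI None (Some a) y -> ~ A (x, y).
    by rewrite /inI /= => y ya /hf fy; have := le_lt_trans (le_trans fy ya) af; rewrite ltxx.
  have h2 := lA (f0 x) a b Af; rewrite af fb in h2.
  apply: filterS (filterI h1 (h2 isT)) => x' [u1 [y' [/andP[_ y'b] Ay']]].
  have [Af' hf'] : Q x' (f0 x') by apply: f0P; exists y'.
  split=> //; rewrite (le_lt_trans (hf' _ Ay') y'b) andbT ltNge; apply/negP => fa.
  by apply: (u1 (f0 x')) => //; rewrite /inI.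
pose A1 := [set t : T * R | A t /\ f0 t.1 < t.2].
have dA1 : def M A1 by rewrite /A1; solve_def.
have fA1 x : finite_set [set y | A1 (x, y)].
  by apply: sub_finite_set (fA x) => y [].
have gA1 x : W x -> good A1 x.
  move=> Wx; have [lA sA0 uA] := gA x Wx; have [Af hf] := f0P x (A0 x Wx).
  have f1 : f0 x - 1 < f0 x by rewrite ltrBlDr ltrDl.
  split.
  - move=> y a b [Axy /= fy] /andP[ay yb].
    have [c /andP[]] : exists c : rat, Num.max a (f0 x) < ratr c < y by apply: rat_between; rewrite gt_max ay.
    rewrite gt_max => /andP[ac fc] cy.
    have h1 := f0c x _ (ratr c) Wx; have {}h1 := h1 (f0 x - 1); rewrite f1 fc in h1.
    have h2 := lA y (ratr c) b Axy; rewrite cy yb in h2.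
    apply: filterS (filterI (h1 isT) (h2 isT)) => x' [[/andP[_ fc'] _] [y' [/andP[cy' y'b] Ay']]].
    exists y'; split; first by rewrite (lt_trans ac cy').
    by split=> //=; exact: lt_trans fc' cy'.
  - move=> y [Axy _]; have [a [b [yab h]]] := sA0 y Axy; exists a, b; split=> //.
    by apply: filterS h => x' h y' y'' h1 h2 [h3 _] [h4 _]; exact: h.
  - move=> p q hpq; have [fI|nfI] := boolP (inI p q (f0 x)); last first.
      have /uA : forall y, inI p q y -> ~ A (x, y).
        move=> y yI Axy; apply: (hpq y) => //; split=> //=; rewrite lt_neqAle hf // andbT.
        by apply: contraNneq nfI => ->.
      by apply: filterS => x' h y yI [Ay _]; exact: h yI Ay.
    (* The interval contains [f0 x], so it may meet [A] there. Near [x] the fibres of [A] avoid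
       everything up to [c] and the part of the interval from [d] on; between [c] and [d] the single
       sheet is [f0] itself, which [A1] excludes. *)
    have [a [b [/andP[af fb] h]]] := sA0 _ Af.
    have [c /andP[ac cf]] := rat_between af; have [d /andP[fd db]] := rat_between fb.
    have /uA h1 : forall y, inI None (Some (ratr c)) y -> ~ A (x, y).
      by rewrite /inI /= => y yc /hf fy; have := le_lt_trans (le_trans fy yc) cf; rewrite ltxx.
    have /uA h2 : forall y, inI (Some (ratr d)) q y -> ~ A (x, y).
      move=> y /andP[dy yq] Axy; have fy := lt_le_trans fd dy.
      apply: (hpq y) => //; move: fI; rewrite /inI yq andbT => /andP[pf _].
      by case: (p) pf => // u uf; rewrite (le_trans uf) // ltW.
    have h3 := f0c x (ratr c) (ratr d) Wx; rewrite cf fd in h3.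
    apply: filterS (filterI (filterI h h1) (filterI h2 (h3 isT))).
    move=> x' [[{}h {}h1] [{}h2 [/andP[cf' fd'] Af']]] y yI [Ay /= fy].
    have yd : y < ratr d.
      rewrite ltNge; apply/negP => dy; apply: (h2 y) => //; rewrite /inI dy /=.
      by move: yI => /andP[].
    have e : f0 x' = y.
      apply: h => //; first by rewrite (lt_trans ac cf') (lt_trans fd' db).
      by rewrite (lt_trans _ fy) ?(lt_trans yd db) // (lt_trans ac cf').
    by move: fy; rewrite e ltxx.
have sA1 y : A1 (x0, y) -> y \in [seq z <- s | predC1 (f0 x0) z].
  move=> [Ay /= fy]; rewrite mem_filter /= sA // andbT.
  by apply: contraTneq fy => ->; rewrite ltxx.
have ss : (size [seq z <- s | predC1 (f0 x0) z] < k)%N.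
  rewrite ltnS in sk; apply: leq_trans sk; rewrite size_filter -(count_predC (pred1 (f0 x0)) s).
  rewrite -[X in (X < _)%N]add0n ltn_add2r -has_count has_pred1; apply: sA.
  by case: (f0P x0 (A0 x0 Wx0)).
have [m [f [df cf fE fmono]]] := IH A1 dA1 fA1 _ sA1 ss gA1.
exists m.+1, (fun j => if j is i.+1 then f i else f0); split.
- by case.
- case=> [_|j]; last exact: cf.
  move=> x Wx S /nbhs_itv [a [b [fab h]]].
  by apply: filterS (f0c x a b Wx fab) => x' [h' _] _; exact: h.
- move=> x Wx y; have [Af hf] := f0P x (A0 x Wx); split.
    move=> Axy; have [e|ne] := eqVneq y (f0 x); first by exists 0%N.
    have /(fE x Wx) [j jm e] : A1 (x, y) by split=> //=; rewrite lt_neqAle eq_sym ne hf.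
    by exists j.+1.
  move=> [[|j] jm ->] //; have : A1 (x, f j x) by apply/(fE x Wx); exists j.
  by case.
- move=> x [|j] Wx jm; last exact: fmono.
  have : A1 (x, f 0%N x) by apply/(fE x Wx); exists 0%N.
  by case.
Qed.

End Sheets.

Section Decomposition.
Variables (R : realType) (M : structure1 R).
Hypothesis M_order : expansion (order_structure R) M.
Hypothesis M_ominimal : ominimal M.
Local Notation Rn := (Rn R).

Definition frontier (Y : set R) : set R := [set y | ~ exists a b, a < y < b /\
  ((forall z, a < z < b -> Y z) \/ (forall z, a < z < b -> ~ Y z))].

Lemma finite_frontier (Y : set R) : def M Y -> finite_set (frontier Y).
Proof.
move=> dY; apply: thin_convex_finite.
  by apply: (def_convex M_ominimal); rewrite /frontier; solve_def.
move=> a b ab; have [c /andP[ac cb]] := rat_between ab.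
have [||t /andP[ct tb] ht] := @convex_eventually _ [set t | ratr c < t < b] Y.
- exact: (def_convex M_ominimal).
- by have [d /andP[cd db]] := rat_between cb; exists (ratr d); rewrite /= cd.
have [d /andP[cd dt]] := rat_between ct.
exists (ratr d); first by rewrite (lt_trans ac cd) (lt_trans dt tb).
apply; exists (ratr c), t; split; first by rewrite cd.
by case: ht => ht; [left|right] => z /andP[cz zt]; (apply: ht; [rewrite /= cz (lt_trans zt)|exact: ltW]).
Qed.

(** Off the fibrewise frontier one interval around [y] serves all fibres near [x], so that [X] is
    locally constant near (x, y). *)
Definition locally_product n (X : set (Rn n * R)) (x : Rn n) :=
  forall y, ~ frontier [set y | X (x, y)] y -> exists a b, a < y < b /\
    (nbhs x (fun x' => forall z, a < z < b -> X (x', z)) \/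
     nbhs x (fun x' => forall z, a < z < b -> ~ X (x', z))).

Lemma def_frontier n (X : set (Rn n * R)) : def M X ->
  def M (fun t : Rn n * R => frontier [set y | X (t.1, y)] t.2).
Proof. by move=> dX; rewrite /frontier; solve_def. Qed.

Lemma def_locally_product n (X : set (Rn n * R)) : def M X -> def M (locally_product X).
Proof.
move=> dX; have dF := def_frontier dX.
have dF' : def M (fun t : Rn n * R => (fun x => frontier [set y | X (x, y)]) t.1 t.2) by [].
rewrite /locally_product.
apply: (def_iff (P := fun x => forall y, ~ (fun x => frontier [set y | X (x, y)]) x y -> exists a b, a < y < b /\
    (nbhs x (fun x' => forall z, a < z < b -> X (x', z)) \/
     nbhs x (fun x' => forall z, a < z < b -> ~ X (x', z))))) => //.
refine (def_all _); refine (def_imp (def_not dF) _).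
by solve_def.
Qed.

Lemma thin_locally_product n (X : set (Rn n * R)) : def M X -> thin (~` locally_product X).
Proof.
move=> dX.
pose E (i : (rat * rat) * bool) : set (Rn n) := if i.2
  then [set x | forall z, ratr i.1.1 < z < ratr i.1.2 -> X (x, z)]
  else [set x | forall z, ratr i.1.1 < z < ratr i.1.2 -> ~ X (x, z)].
have dE i : def M (E i) by case: i => [q []]; rewrite /E /=; solve_def.
apply: (thin_cover M_order M_ominimal (F := fun i => ~` stable (E i))).
- by move=> i; have := def_stable M_order (dE i) => ?; solve_def.
- by move=> i; apply: (thin_unstable M_order M_ominimal (dE i)).
move=> x; apply: contra_notP => h.
have {}h i : E i x -> nbhs x (E i).
  move=> Ex; apply: contrapT => nE; apply: h; exists i => //= -[//|/nbhs_singleton]; exact.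
move=> y /contrapT [a [b [/andP[ay yb] hX]]].
have [q /andP[aq qy]] := rat_between ay; have [r /andP[yr rb]] := rat_between yb.
exists (ratr q), (ratr r); split; first by rewrite qy yr.
have sub z : ratr q < z < ratr r -> a < z < b.
  by move=> /andP[qz zr]; rewrite (lt_trans aq qz) (lt_trans zr rb).
case: hX => hX; [left; apply: (h (q, r, true))|right; apply: (h (q, r, false))];
by move=> z /sub; apply: hX.
Qed.

(* Z is a homeomorphic copy of Y; the retraction rho is defined and continuous
   everywhere, so that parametrizations compose. *)
Definition retract_image d n (Z : set (Rn n)) := exists (Y : set (Rn d)) theta rho,
  [/\ def M Y, dmap M theta /\ cont_in Y theta, dmap M rho /\ continuous rho,
      (forall y, Y y -> rho (theta y) = y) & Z = theta @` Y].

Definition has_conn_decomposition n := forall X : set (Rn n), def M X ->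
  finite_union (fun P => def M P /\ lconnected P) X.

(** In dimension 0 the empty set is the only thin set, and there the inductions on dimension
    stop. *)
Definition thin_shape n (Z : set (Rn n)) :=
  if n is m.+1 then finite_union (@retract_image m n) Z else Z = set0.

Definition has_thin_decomposition n := forall Z : set (Rn n), def M Z -> thin Z -> thin_shape Z.

Lemma cont_in_pair (S T T' : topologicalType) (W : set S) (f : S -> T) (g : S -> T') :
  cont_in W f -> cont_in W g -> cont_in W (fun x => (f x, g x)).
Proof.
move=> cf cg x Wx P [[/= A B] [/= hA hB] h].
apply: filterS (filterI (cf x Wx _ hA) (cg x Wx _ hB)) => x' [h1 h2] Wx'.
by apply: h; split=> /=; [apply: h1|apply: h2].
Qed.

Lemma cont_in_comp (S T T' : topologicalType) (W : set S) (V : set T) (f : S -> T) (g : T -> T') :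
  cont_in W f -> cont_in V g -> (forall x, W x -> V (f x)) -> cont_in W (fun x => g (f x)).
Proof.
move=> cf cg fWV x Wx P hP.
apply: filterS (cf x Wx _ (cg _ (fWV x Wx) _ hP)) => x' h Wx'.
by apply: h => //; exact: fWV.
Qed.

Lemma continuous_cont_in (S T : topologicalType) (W : set S) (f : S -> T) :
  continuous f -> cont_in W f.
Proof.
move=> cf x Wx P hP; have : nbhs x (f @^-1` P) by exact: cf.
by apply: filterS => x' h _.
Qed.

Lemma cont_in_cst (S T : topologicalType) (W : set S) (y : T) : cont_in W (fun=> y).
Proof. by move=> x _ P /nbhs_singleton hP; apply: filterE. Qed.

Lemma cont_in_id (S : topologicalType) (W : set S) : cont_in W id.
Proof. by move=> x _ P; apply: filterS. Qed.

Lemma continuous_fst (S T : topologicalType) : continuous (@fst S T).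
Proof. by move=> [x y] P hP; exists (P, setT); [split=> //=; exact: filter_nbhsT|case=> a b []]. Qed.

Lemma continuous_snd (S T : topologicalType) : continuous (@snd S T).
Proof. by move=> [x y] P hP; exists (setT, P); [split=> //=; exact: filter_nbhsT|case=> a b []]. Qed.

Lemma over_image n d (X : set (Rn n * R)) (Y : set (Rn d)) (theta : Rn d -> Rn n) :
  over X (theta @` Y) = (fun t : Rn d * R => (theta t.1, t.2)) @` [set t | Y t.1 /\ X (theta t.1, t.2)].
Proof.
apply/seteqP; split=> [[x y] /= [Xt [z Yz /= e]]|_ [[z y] /= [Yz Xz] <-]].
  by exists (z, y) => /=; rewrite e.
by split=> //=; exists z.
Qed.

Lemma finite_union_over_full n (C : set (Rn n * R) -> Prop) (B : set (Rn n)) X :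
  finite_union C (over X B) -> finite_union C (over X (~` B)) -> finite_union C X.
Proof.
move=> h1 h2; rewrite (_ : X = over X B `|` over X (~` B)); first exact: finite_unionU.
by apply/seteqP; split=> [t Xt|t [] []//]; have [Bt|nBt] := pselect (B t.1); [left|right].
Qed.

Lemma over_thin_retract n (Z : set (Rn n * R)) (B : set (Rn n)) :
  def M Z -> thin_shape B -> finite_union (@retract_image n n.+1) (over Z B).
Proof.
move=> dZ; case: n Z B dZ => [|m] Z B dZ.
  by move=> ->; rewrite (_ : over Z _ = set0); [exact: finite_union0|apply/seteqP; split=> t // []].
move=> hB; apply: (finite_union_over hB) => _ [Y [theta [rho [dY [dth cth] [drh crh] rt ->]]]] _.
rewrite over_image; apply: finite_union1.
exists [set t : Rn m * R | Y t.1 /\ Z (theta t.1, t.2)],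
  (fun t : Rn m * R => (theta t.1, t.2)), (fun t : Rn m.+1 * R => (rho t.1, t.2)).
split=> //.
- by rewrite /=; solve_def.
- split; first by rewrite /=; solve_dmap.
  apply: cont_in_pair; last exact: continuous_cont_in (@continuous_snd _ _).
  by apply: cont_in_comp (continuous_cont_in (@continuous_fst _ _)) cth _ => t [].
- split; first by rewrite /=; solve_dmap.
  move=> [x y] P [[/= U V] [/= hU hV] h].
  exists (rho @^-1` U, V) => /=; first by split=> //; exact: crh.
  by move=> [x' y'] [/= h1 h2]; apply: h.
- by move=> [x y] [/= /rt ->].
Qed.

(** A piece of the thin base is the image of a subset of a space one dimension lower than the base.
    The part of [X] over it therefore pulls back to R^n, where the decomposition is known. *)
Lemma over_thin_conn n (X : set (Rn n * R)) (B : set (Rn n)) : has_conn_decomposition n ->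
  def M X -> thin_shape B -> finite_union (fun P => def M P /\ lconnected P) (over X B).
Proof.
move=> cn dX; case: n cn X B dX => [|m] cn X B dX.
  by move=> ->; rewrite (_ : over X _ = set0); [exact: finite_union0|apply/seteqP; split=> t // []].
move=> hB; apply: (finite_union_over hB) => _ [Y [theta [rho [dY [dth cth] _ _ ->]]]] _.
rewrite over_image.
pose Y' : set (Rn m * R) := [set t | Y t.1 /\ X (theta t.1, t.2)].
have dY' : def M Y' by rewrite /Y'; solve_def.
have := cn (Y' : set (Rn m.+1)) dY'; move/finite_union_image; apply.
move=> P [dP cP] PY; apply: finite_union1; split.
  have dP' : def M (P : set (Rn m * R)) by exact: dP.
  rewrite /image; change (def M (fun u : Rn m.+1 * R => exists2 t : Rn m * R, P t & (theta t.1, t.2) = u)).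
  by solve_def.
apply: lconnected_image cP _.
apply: (cont_in_pair (S := Rn m.+1)); last exact: continuous_cont_in (@continuous_snd _ _).
by apply: (cont_in_comp (S := Rn m.+1)) (continuous_cont_in (@continuous_fst _ _)) cth _ => t /PY [].
Qed.

Section Step.
Variable n : nat.
Hypothesis conn_n : has_conn_decomposition n.
Hypothesis thin_n : has_thin_decomposition n.

(** The base points [T1] whose fibre contains an interval form a thin set, since an open set of them
    would carry a box inside [Z] for some rational interval. Elsewhere the fibres are finite. Over
    connected pieces of good points [Z] is then a union of graphs, for which the projection to the
    base is the retraction; what lies over the thin rest is handled by induction. *)
Lemma thin_decomposition_step : has_thin_decomposition n.+1.
Proof.
move=> Z dZ tZ; change (set (Rn n * R)) in Z.
have dZ' : def M (Z : set (Rn n * R)) by exact: dZ.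
pose T1 : set (Rn n) := [set x | exists a b, a < b /\ forall y, a < y < b -> Z (x, y)].
have dT1 : def M T1 by rewrite /T1; solve_def.
have tT1 : thin T1.
  pose E (q : rat * rat) : set (Rn n) := [set x | ratr q.1 < ratr q.2 :> R /\
    forall y, ratr q.1 < y < ratr q.2 -> Z (x, y)].
  apply: (thin_cover M_order M_ominimal (F := E)).
  - by move=> i; rewrite /E; solve_def.
  - move=> [q r]; apply: contrapT => /thinN [x /nbhs_bx [l [u [lux h]]]].
    have [qr_ _] := h _ lux; have [c qcr] := rat_between qr_.
    have [|[x' y'] [/= lux' y'q]] := tZ (l, ratr q) (u, ratr r); first by exists (x, ratr c).
    by apply; have [_] := h _ lux'; apply.
  - move=> x [a [b [ab h]]]; have [c /andP[ac cb]] := rat_between ab.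
    have [d /andP[cd db]] := rat_between cb; exists (c, d) => //; split=> //= y /andP[cy yd].
    by apply: h; rewrite (lt_trans ac cy) (lt_trans yd db).
pose A : set (Rn n * R) := [set t | Z t /\ ~ T1 t.1].
have dA : def M A by rewrite /A; solve_def.
have fA x : finite_set [set y | A (x, y)].
  have [T1x|nT1] := pselect (T1 x).
    by rewrite (_ : [set y | _] = set0) //; apply/seteqP; split=> // y [_].
  apply: thin_convex_finite.
    by apply: (def_convex M_ominimal); solve_def.
  move=> a b ab; apply: contrapT => h; apply: nT1; exists a, b; split=> // y yab.
  by apply: contrapT => nZ; apply: h; exists y => // -[].
have dg := def_good M_order dA.
pose B : set (Rn n) := T1 `|` ~` good A.
have dB : def M B by rewrite /B; solve_def.
have tB : thin B.
  apply: (thinU M_order M_ominimal) => //; first by solve_def.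
  exact: (thin_bad M_order M_ominimal).
apply: (finite_union_over_full (B := B)).
  exact: over_thin_retract (thin_n dB tB).
apply: (finite_union_over (conn_n (X := ~` B) _)); first by solve_def.
move=> W [dW cW] WB.
have [m [f [df cf fE fmono]]] := sheets M_order dA fA cW (fun x Wx => contrapT (fun h => WB x Wx (or_intror h))).
rewrite (_ : over Z W = [set t | exists2 j, (j < m)%N & ((fun x => (x, f j x)) @` W) t]).
  apply: finite_union_lt => j jm; apply: finite_union1.
  exists W, (fun x => (x, f j x)), fst; split=> //.
  - by split; [have := df j => ?; solve_dmap|apply: cont_in_pair; [move=> x _ P; apply: filterS|exact: cf]].
  - by split; [exact: dmap_fst0|exact: continuous_fst].
apply/seteqP; split=> [[x y] [Zxy /= Wx]|_ [j jm [x Wx <-]]].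
  have nT1 : ~ T1 x by move=> h; apply: (WB x Wx); left.
  have /(fE x Wx) [j jm ->] : A (x, y) by [].
  by exists j => //; exists x.
by split=> //=; have /(fE x Wx) [] : exists2 i, (i < m)%N & f j x = f i x by exists j.
Qed.

(** Over a connected piece of the good points, the sheets of the fibrewise frontier [A] cut the
    cylinder into bands, each of which [X] contains or misses. No uniform finiteness is presupposed:
    it comes out of [sheets]. *)
Lemma conn_decomposition_step : has_conn_decomposition n.+1.
Proof.
move=> X0 dX0; pose X : set (Rn n * R) := X0.
have dX : def M X by exact: dX0.
change (finite_union (fun P : set (Rn n * R) => def M P /\ lconnected P) X).
pose A : set (Rn n * R) := [set t | frontier [set y | X (t.1, y)] t.2].
have dA : def M A by exact: def_frontier.
have fA x : finite_set [set y | A (x, y)].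
  by apply: (@finite_frontier [set y | X (x, y)]); solve_def.
(* The frontier points belonging to [X] get sheets of their own, so it is never asked which sheets
   of [A] lie in [X]. *)
pose A' := A `&` X.
have dA' : def M A' by rewrite /A'; solve_def.
have fA' x : finite_set [set y | A' (x, y)] by apply: sub_finite_set (fA x) => y [].
pose G := [set x | good A x /\ good A' x /\ locally_product X x].
have dg := def_good M_order dA; have dg' := def_good M_order dA'.
have dlp := def_locally_product dX.
have dG : def M G by rewrite /G; solve_def.
have tG : thin (~` G).
  have t1 := thin_bad M_order M_ominimal dA fA; have t2 := thin_bad M_order M_ominimal dA' fA'.
  have t3 := thin_locally_product dX.
  have d1 : def M (~` good A) by solve_def.
  have d2 : def M (~` good A') by solve_def.
  have d3 : def M (~` locally_product X) by solve_def.
  have d12 : def M (~` good A `|` ~` good A') by solve_def.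
  apply: thin_sub (thinU M_order M_ominimal d12 d3 (thinU M_order M_ominimal d1 d2 t1 t2) t3).
  move=> x nG; apply: contrapT => h; apply: nG.
  by split; [|split]; apply: contrapT => nh; apply: h; [left; left|left; right|right].
have dG' : def M (~` G) by solve_def.
apply: (finite_union_over_full (B := ~` G)).
  exact: over_thin_conn (thin_n dG' tG).
rewrite setCK; apply: (finite_union_over (conn_n dG)) => W [dW cW] WG.
have [m [f [df cf fE fmono]]] := sheets M_order dA fA cW (fun x Wx => (WG x Wx).1).
have [m' [f' [df' cf' fE' _]]] := sheets M_order dA' fA' cW (fun x Wx => (WG x Wx).2.1).
(* Band [j] lies between the sheets [j - 1] and [j]; band 0 is unbounded below and band [m]
   unbounded above. *)
pose band j : set (Rn n * R) := [set t | [/\ W t.1, forall i, i.+1 = j -> f i t.1 < t.2 &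
   (j < m)%N -> t.2 < f j t.1]].
have fle x i j : W x -> (i <= j)%N -> (j < m)%N -> f i x <= f j x.
  move=> Wx; elim: j => [|j IH]; first by rewrite leqn0 => /eqP ->.
  rewrite leq_eqVlt => /predU1P[-> //|ij jm]; apply: le_trans (IH ij (ltnW jm)) _.
  exact/ltW/fmono.
have bandA j x y : (j <= m)%N -> band j (x, y) -> ~ A (x, y).
  move=> jm [/= Wx h1 h2] /(fE x Wx) [i im e]; have [ji|ij] := leqP j i.
    have := lt_le_trans (h2 (leq_ltn_trans ji im)) (fle _ _ _ Wx ji im).
    by rewrite e ltxx.
  case: j => // j in jm h1 h2 ij.
  by have := le_lt_trans (fle x i j Wx ij jm) (h1 j erefl); rewrite e ltxx.
rewrite (_ : over X W = [set t | exists2 j, (j < m')%N & ((fun x => (x, f' j x)) @` W) t] `|`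
                        [set t | exists2 j, (j < m.+1)%N & (X `&` band j) t]); last first.
  apply/seteqP; split=> [[x y] [Xxy /= Wx]|u [[j jm [x Wx <-]]|[j jm [Xu [Wu _ _]]]]]; last 2 first.
  - by split=> //=; have /(fE' x Wx) [] : exists2 i, (i < m')%N & f' j x = f' i x by exists j.
  - by split.
  have [Axy|nA] := pselect (A (x, y)).
    have /(fE' x Wx) [j jm ->] : A' (x, y) by [].
    by left; exists j => //; exists x.
  (* A point off the sheets is in the band under the first sheet above it, or in band [m] if there
     is none. *)
  right; have ex : exists j, (j == m) || (y < f j x) by exists m; rewrite eqxx.
  have [j hj jmin] := ex_minnP ex.
  have jm : (j <= m)%N by apply: jmin; rewrite eqxx.
  exists j => //; split=> //; split=> //= [i ij|jm'].
    rewrite lt_neqAle; apply/andP; split.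
      apply/eqP => e; apply: nA; apply/(fE x Wx); exists i => //.
      by rewrite -ij in jm.
    rewrite leNgt; apply/negP => yf; have := jmin i; rewrite yf orbT -ij ltnn => /(_ isT) //.
  by case/orP: hj => // /eqP e; rewrite e ltnn in jm'.
apply: finite_unionU; apply: finite_union_lt => j jm.
  apply: finite_union1; split.
    by have := df' j => ?; rewrite /image; solve_def.
  by apply: lconnected_image cW _; apply: cont_in_pair; [move=> x _ P; apply: filterS|exact: cf'].
have dband : def M (band j).
  apply: (def_iff (P := fun t : Rn n * R => W t.1 /\ (if j is i.+1 then f i t.1 < t.2 : Prop else True) /\
      (if (j < m)%N then t.2 < f j t.1 : Prop else True))).
    move=> t; split=> [[Wt [h1 h2]]|[Wt h1 h2]].
      by split=> // [i e|jm']; [rewrite -e in h1|rewrite jm' in h2].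
    by split=> //; split; [case: (j) h1 => // i; apply|case: ifP].
  case: (j) => [|i] /=.
    by have := df 0%N => ?; case: (0 < m)%N; solve_def.
  by have := df i => ?; have := df i.+1 => ?; case: (i.+1 < m)%N; solve_def.
have cband : lconnected (band j).
  apply: lconnected_band cW _ _ _ _.
  - by move=> t [].
  - move=> x Wx y1 y2 y3 [/= _ h1 h2] [/= _ h3 h4] /andP[y12 y23]; split=> //= [i e|jm'].
      exact: lt_le_trans (h1 i e) y12.
    exact: le_lt_trans y23 (h4 jm').
  - move=> x Wx; case: j jm {dband} => [|j] jm.
      by exists (f 0%N x - 1); split=> //= _; rewrite ltrBlDr ltrDl.
    have [jm'|mj] := ltnP j.+1 m.
      have [c /andP[h1 h2]] := rat_between (fmono x j Wx jm').
      by exists (ratr c); split=> //= i [->].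
    exists (f j x + 1); split=> //= [i [->]|jm']; first by rewrite ltrDl.
    by rewrite ltnNge mj in jm'.
  - move=> x y [/= Wx h1 h2].
    have n1 : nbhs x (fun x' => W x' -> forall i, i.+1 = j -> f i x' < y).
      case: j jm h1 {h2 dband} => [|j] jm h1; first by apply: filterE.
      have /(cf j jm x Wx) : nbhs (f j x) [set z | z < y].
        apply/nbhs_itv; exists (f j x - 1), y; split; first by rewrite ltrBlDr ltrDl ltr01 (h1 j).
        by move=> z /andP[].
      by apply: filterS => x' h Wx' i [->]; apply: h.
    have n2 : nbhs x (fun x' => W x' -> (j < m)%N -> y < f j x').
      have [jm'|_] := ltnP j m; last by apply: filterE.
      have /(cf j jm' x Wx) : nbhs (f j x) [set z | y < z].
        apply/nbhs_itv; exists y, (f j x + 1); split; first by rewrite h2 //= ltrDl.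
        by move=> z /andP[].
      by apply: filterS => x' h Wx' _; apply: h.
    by apply: filterS (filterI n1 n2) => x' [{}h1 {}h2] Wx'; split=> //; [exact: h1|exact: h2].
have [[t0 [Xt0 Bt0]]|n0] := pselect (X `&` band j !=set0); last first.
  rewrite (_ : X `&` band j = set0); first exact: finite_union0.
  by apply/seteqP; split=> // t ht; case: n0; exists t.
rewrite (_ : X `&` band j = band j); first exact: finite_union1.
apply/seteqP; split=> [t []//|t Bt]; split=> //.
apply: (cband X _ t0) => // -[x y] Bxy.
(* The band misses the frontier, so by local product structure membership in [X] is locally constant
   on it; connectedness gives all or nothing. *)
have [_ [_ lpx]] := WG x (let: And3 h _ _ := Bxy in h).
have [a [b [yab h]]] := lpx y (bandA j x y jm Bxy).
have nby : nbhs y [set z | a < z < b] by apply/nbhs_itv; exists a, b.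
case: h => h.
  exists ([set x' | forall z, a < z < b -> X (x', z)], [set z | a < z < b]); first by split.
  move=> [x' y'] [/= h1 h2] _; split=> _; last exact: h1.
  exact: (nbhs_singleton h).
exists ([set x' | forall z, a < z < b -> ~ X (x', z)], [set z | a < z < b]); first by split.
move=> [x' y'] [/= h1 h2] _; split=> [/(h1 _ h2)//|].
by move/(nbhs_singleton h _ yab).
Qed.

End Step.

Theorem conn_thin_decomposition n : has_conn_decomposition n /\ has_thin_decomposition n.
Proof.
elim: n => [|n [cn tn]]; last by split; [exact: conn_decomposition_step|exact: thin_decomposition_step].
split=> [X dX|Z dZ tZ].
  by apply: finite_union1; split=> // P hP [] [].
apply/seteqP; split=> // x Zx.
by have [|[] _] := tZ tt tt; [exists tt|case: x Zx].
Qed.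

End Decomposition.

Lemma finite_union_mono (T : Type) (C D : set T -> Prop) (X : set T) :
  (forall P, C P -> D P) -> finite_union C X -> finite_union D X.
Proof.
move=> h; elim=> [|P /h|P Q _ ? _ ?]; [exact: finite_union0|exact: finite_union1|exact: finite_unionU].
Qed.

Lemma cont_in_setT (S T : topologicalType) (f : S -> T) : cont_in setT f -> continuous f.
Proof.
move=> cf x P hP; change (nbhs x (fun x' => P (f x'))).
by apply: filterS (cf x I P hP) => x'; apply.
Qed.

Lemma cont_in_ptws (S V : topologicalType) (I : eqType) (W : set S) (f : S -> {ptws I -> V}) :
  (forall i, cont_in W (fun x => f x i)) -> cont_in W f.
Proof.
move=> cf x Wx P hP; have : within W (nbhs x) (f @^-1` P); last by [].
suff : f @ within W (nbhs x) --> (f x : {ptws I -> V}) by move=> /(_ P hP).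
apply/cvg_sup => i A hA; rewrite /nbhs /= in hA; case: hA => B [[O' oO <-] Ofx BA].
have : nbhs x (fun x' => W x' -> O' (f x' i)) by apply: cf => //; exact: open_nbhs_nbhs.
move=> h; change (nbhs x (fun x' => W x' -> A (f x'))).
by apply: filterS h => x' h Wx'; apply: BA; apply: h.
Qed.

Lemma continuous_ptws_app (V : topologicalType) (I : eqType) (i : I) :
  continuous (fun f : {ptws I -> V} => f i).
Proof. exact: (@proj_continuous I (fun=> V)). Qed.

Definition coded_ptws (S : Type) (U : S -> Type) (N : structure U) (I : finType)
    (V : topologicalType) (cV : coded N V) : coded N {ptws I -> V} := coded_pow I cV.
#[export] Existing Instance coded_ptws.

(** * Spaces covered by continuous definable images of subsets of R^n *)

Section Parametrized.
Variables (R : realType) (M : structure1 R).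
Hypothesis M_order : expansion (order_structure R) M.
Hypothesis M_ominimal : ominimal M.
Local Notation Rn := (Rn R).

Definition parameter_image (H : topologicalType) {cH : coded M H} (Z : set H) :=
  exists m (Y : set (Rn m)) e, [/\ def M Y, dmap M e, cont_in Y e & Z = e @` Y].

Definition parametrized (H : topologicalType) {cH : coded M H} :=
  finite_union (parameter_image (H := H)) [set: H].
Arguments parametrized H {cH}.

Lemma parametrized_image (H H' : topologicalType) (cH : coded M H) (cH' : coded M H')
    (g : H -> H') : dmap M g -> continuous g -> (forall y, exists x, g x = y) ->
  parametrized H -> parametrized H'.
Proof.
move=> dg cg sg pH; rewrite /parametrized (_ : setT = g @` setT); last first.
  by apply/seteqP; split=> // y _; have [x <-] := sg y; exists x.
apply: finite_union_image pH _ => _ [m [Y [e [dY de ce ->]]]] _.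
apply: finite_union1; exists m, Y, (g \o e); split=> //.
- by rewrite /comp; solve_dmap.
- exact: (cont_in_comp ce (continuous_cont_in (W := setT) cg)).
- by rewrite image_comp.
Qed.

Fixpoint rsplit m n : Rn (n + m) -> Rn m * Rn n :=
  if n is n'.+1 return Rn (n + m) -> Rn m * Rn n
  then fun x => ((@rsplit m n' x.1).1, ((@rsplit m n' x.1).2, x.2)) else fun x => (x, tt).

Lemma rsplit_surj m n (y : Rn m * Rn n) : exists x, @rsplit m n x = y.
Proof.
elim: n y => [|n IH] [a b]; first by exists a; case: b.
by case: b => b t; have [x hx] := IH (a, b); exists (x, t); rewrite /= hx.
Qed.

Lemma dmap_rsplit m n : dmap M (@rsplit m n).
Proof. by elim: n => [|n IH] /=; solve_dmap. Qed.

Lemma continuous_rsplit m n : continuous (@rsplit m n).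
Proof.
apply: cont_in_setT.
elim: n => [|n IH] /=.
  apply: cont_in_pair; first by move=> x _ P; apply: filterS.
  by move=> x _ P /nbhs_singleton hP; apply: filterE.
have c1 : cont_in setT (fun x : Rn (n + m) * R => @rsplit m n x.1).
  by apply: cont_in_comp (continuous_cont_in (@continuous_fst _ _)) IH _.
apply: cont_in_pair; last apply: cont_in_pair.
- by apply: cont_in_comp c1 (continuous_cont_in (W := setT) (@continuous_fst _ _)) _.
- by apply: cont_in_comp c1 (continuous_cont_in (W := setT) (@continuous_snd _ _)) _.
- exact: continuous_cont_in (@continuous_snd _ _).
Qed.

Lemma parametrized_prod (H H' : topologicalType) (cH : coded M H) (cH' : coded M H') :
  parametrized H -> parametrized H' -> parametrized (H * H')%type.
Proof.
move=> pH pH'.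
have word_lift1 : finite_union (parameter_image (H := (H * H')%type)) (setT `*` setT).
  have {}pH := finite_union_subset pH; elim: pH => [|Z [[m [Y [e [dY de ce ->]]]] _]|P Q _ h1 _ h2].
  - by rewrite (_ : _ `*` _ = set0); [exact: finite_union0|apply/seteqP; split=> // t []].
  - have {}pH' := finite_union_subset pH'.
    elim: pH' => [|Z' [[m' [Y' [e' [dY' de' ce' ->]]]] _]|P Q _ h1 _ h2].
    + by rewrite (_ : _ `*` _ = set0); [exact: finite_union0|apply/seteqP; split=> // t []].
    + apply: finite_union1; have ds := @dmap_rsplit m m'.
      exists (m' + m)%N, [set x | Y (rsplit x).1 /\ Y' (rsplit x).2],
        (fun x => (e (@rsplit m m' x).1, e' (rsplit x).2)); split.
      * by solve_def.
      * by solve_dmap.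
      * have cs := continuous_cont_in (W := setT) (@continuous_rsplit m m').
        apply: cont_in_pair.
          apply: (cont_in_comp (f := fun x => (rsplit x).1) (V := Y)) ce _ => [|x [] //].
          by move=> x [Yx _] P hP; apply: filterS (cs x I (fun z => P z.1) (continuous_fst hP)) => x' + _; apply.
        apply: (cont_in_comp (f := fun x => (rsplit x).2) (V := Y')) ce' _ => [|x [] //].
        by move=> x [Yx _] P hP; apply: filterS (cs x I (fun z => P z.2) (continuous_snd hP)) => x' + _; apply.
      * apply/seteqP; split=> [[_ _] [/= [y Yy <-] [y' Yy' <-]]|_ [x [Yx Yx'] <-]].
          by have [x ex] := rsplit_surj (y, y'); exists x; rewrite ex.
        by split=> /=; [exists (rsplit x).1|exists (rsplit x).2].
    + rewrite (_ : _ `*` (P `|` Q) = (e @` Y) `*` P `|` (e @` Y) `*` Q); first exact: finite_unionU.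
      by apply/seteqP; split=> t; rewrite /setX /setU /=; tauto.
  - rewrite (_ : (P `|` Q) `*` setT = P `*` setT `|` Q `*` setT); first exact: finite_unionU.
    by apply/seteqP; split=> t; rewrite /setX /setU /=; tauto.
by rewrite /parametrized -setXTT.
Qed.

Definition snoc_ptws (H : Type) n (t : ('I_n -> H) * H) : 'I_n.+1 -> H :=
  fun i => if unlift ord_max i is Some j then t.1 j else t.2.

Lemma parametrized_ptws n (H : topologicalType) (cH : coded M H) (h0 : H) :
  parametrized H -> parametrized {ptws 'I_n -> H}.
Proof.
move=> pH; elim: n => [|n IH].
  apply: finite_union1; exists 0%N, setT, (fun=> fun=> h0); split.
  - by solve_def.
  - exact: dmap_cst.
  - by move=> x _ P /nbhs_singleton hP; apply: filterE.
  - by apply/seteqP; split=> // x _; exists tt => //; apply/funext => -[].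
apply: (@parametrized_image ({ptws 'I_n -> H} * H)%type {ptws 'I_n.+1 -> H} _ _
  (@snoc_ptws H n) _ _ _ (parametrized_prod IH pH)).
- rewrite /snoc_ptws; apply: (dmap_fun (f := fun t i => _)) => i.
  by case: (unlift ord_max i) => [j|]; solve_dmap.
- apply: cont_in_setT; apply: cont_in_ptws => i; rewrite /snoc_ptws; case: (unlift ord_max i) => [j|].
    exact: (cont_in_comp (V := setT) (f := fst) (g := fun h : {ptws 'I_n -> H} => h j)
      (continuous_cont_in (@continuous_fst _ _)) (continuous_cont_in (@continuous_ptws_app _ _ j))).
  exact: continuous_cont_in (@continuous_snd _ _).
- move=> y; exists (fun j => y (lift ord_max j), y ord_max).
  by apply/funext => i; rewrite /snoc_ptws; case: unliftP => [j ->|->].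
Qed.

Lemma parametrized_conn (H : topologicalType) (cH : coded M H) (X : set H) :
  parametrized H -> def M X -> finite_union (fun P => def M P /\ lconnected P) X.
Proof.
move=> pH dX; rewrite -(setTI X).
elim: pH => [|_ [m [Y [e [dY de ce ->]]]]|P Q _ h1 _ h2]; last 2 first.
- have -> : e @` Y `&` X = e @` [set y | Y y /\ X (e y)].
    apply/seteqP; split=> [_ [[y Yy <-] Xy]|_ [y [Yy Xy] <-]]; last by split=> //; exists y.
    by exists y.
  have d : def M [set y | Y y /\ X (e y)] by solve_def.
  apply: finite_union_image ((conn_thin_decomposition M_order M_ominimal m).1 _ d) _.
  move=> P [dP cP] PY; apply: finite_union1; split.
    by rewrite /image; solve_def.
  apply: lconnected_image cP _ => x Px O hO.
  apply: filterS (ce x (PY x Px).1 O hO) => x' h Px'.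
  by apply: h; case: (PY x' Px').
- by rewrite setIUl; exact: finite_unionU.
- by rewrite set0I; exact: finite_union0.
Qed.

Lemma finite_union_thin n (C : set (Rn n) -> Prop) X :
  finite_union C X -> (forall P, C P -> def M P) -> ~ thin X -> exists2 P, C P & ~ thin P /\ P `<=` X.
Proof.
move=> /finite_union_subset + dC nX.
suff h (Y : set (Rn n)) : finite_union (fun P => C P /\ P `<=` X) Y -> def M (cT := coded_Rn M n) Y /\ (~ thin Y -> exists2 P, C P & ~ thin P /\ P `<=` X).
  by move=> /h [_]; apply.
elim=> [|P [CP PX]|P Q _ [dP hP] _ [dQ hQ]].
- by split; [solve_def|case; move=> l u [x lux]; exists x].
- by split; [exact: dC|exists P].
- split; first by solve_def.
  move=> nPQ; have [tP|/hP//] := pselect (thin P); have [tQ|/hQ//] := pselect (thin Q).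
  by case: nPQ; exact: (thinU M_order M_ominimal).
Qed.

(** A weak form of definable choice that survives in every o-minimal expansion of the order: a
    selection over some nonempty open set, continuous there, rather than over the whole base. *)
Definition selectable (H : topologicalType) {cH : coded M H} :=
  forall k (X : set (Rn k * H)), def M X -> ~ thin [set x | exists h, X (x, h)] ->
  exists (U : set (Rn k)) (t : Rn k -> H), [/\ U !=set0, open U, def M U, dmap M t /\ cont_in U t &
    forall x, U x -> X (x, t x)].
Arguments selectable H {cH}.

Lemma open_box n (X : set (Rn n)) x : nbhs x X ->
  exists U : set (Rn n), [/\ open U, def M U, U x & U `<=` X].
Proof.
move=> /nbhs_bx [l [u [lux h]]]; exists (bx l u); split=> //.
  by rewrite openE => y hy; apply/nbhs_bx; exists l, u.
by have db := def_bx M_order n; change (def M (fun y => bx l u y)); solve_def.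
Qed.

(** Either a rational constant is a selection over some box, or the base points whose fibre contains
    an interval are covered by countably many thin sets. In the second case the fibres are finite
    outside a thin set, and the lowest sheet over a piece with interior is a selection. *)
Lemma selectable_R : selectable R.
Proof.
move=> k X dX nX.
have [[q nq]|hq] := pselect (exists q : rat, ~ thin [set x : Rn k | X (x, ratr q)]).
  have [x hx] := (thinN _).1 nq; have [U [oU dU Ux UX]] := open_box hx.
  exists U, (fun=> ratr q); split=> //; first by exists x.
  by split; [exact: dmap_cst|exact: cont_in_cst].
have tq (q : rat) : thin [set x : Rn k | X (x, ratr q)].
  by apply: contrapT => h; apply: hq; exists q.
pose E (q : rat) := [set x : Rn k | X (x, ratr q)].
pose T1 : set (Rn k) := [set x | exists a b, a < b /\ forall y, a < y < b -> X (x, y)].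
have dT1 : def M T1 by rewrite /T1; solve_def.
have tT1 : thin T1.
  apply: (thin_cover M_order M_ominimal (F := E)) => //.
    by move=> q; rewrite /E; solve_def.
  move=> x [a [b [ab h]]]; have [q qab] := rat_between ab.
  by exists q => //; exact: h.
pose A : set (Rn k * R) := [set t | X t /\ ~ T1 t.1].
have dA : def M A by rewrite /A; solve_def.
have fA x : finite_set [set y | A (x, y)].
  have [T1x|nT1] := pselect (T1 x).
    by rewrite (_ : [set y | _] = set0) //; apply/seteqP; split=> // y [_].
  apply: thin_convex_finite.
    by apply: (def_convex M_ominimal); solve_def.
  move=> a b ab; apply: contrapT => h; apply: nT1; exists a, b; split=> // y yab.
  by apply: contrapT => nZ; apply: h; exists y => // -[].
have dg := def_good M_order dA.
pose G := [set x : Rn k | good A x /\ exists y, A (x, y)].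
have dG : def M G by rewrite /G; solve_def.
have nG : ~ thin G.
  move=> tG; apply: nX.
  have dng : def M (~` good A) by solve_def.
  have dU : def M (T1 `|` ~` good A) by solve_def.
  apply: thin_sub (thinU M_order M_ominimal dU dG _ tG); last first.
    by apply: (thinU M_order M_ominimal) => //; exact: (thin_bad M_order M_ominimal).
  move=> x [y Xy]; have [T1x|nT1] := pselect (T1 x); first by left; left.
  have [gx|ng] := pselect (good A x); last by left; right.
  by right; split=> //; exists y.
have [W [dW cW] [nW WG]] := finite_union_thin
  ((conn_thin_decomposition M_order M_ominimal k).1 _ dG) (fun P h => h.1) nG.
have [m [f [df cf fE _]]] := sheets M_order dA fA cW (fun x Wx => (WG x Wx).1).
have [x hx] := (thinN _).1 nW; have [U [oU dU Ux UW]] := open_box hx.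
have m0 : (0 < m)%N.
  have Wx := UW x Ux; have [_ [y Axy]] := WG x Wx; have [j jm _] := (fE x Wx y).1 Axy.
  exact: leq_ltn_trans jm.
exists U, (f 0%N); split=> //; first by exists x.
  split=> // y Uy P hP; apply: filterS (cf _ m0 y (UW y Uy) P hP) => y' h Uy'.
  by apply: h; exact: UW.
move=> y Uy; have [] // : A (y, f 0%N y).
by apply/(fE y (UW y Uy)); exists 0%N.
Qed.

Lemma selectable_prod (H H' : topologicalType) (cH : coded M H) (cH' : coded M H') :
  selectable H -> selectable H' -> selectable (H * H')%type.
Proof.
move=> sH sH' k X dX nX.
have [||U [t [U0 oU dU [dt ct] tX]]] := sH k [set z | exists y, X (z.1, (z.2, y))].
- by solve_def.
- apply: contra_not nX; apply: thin_sub => x [[h h'] Xx].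
  by exists h; exists h'.
have [||U' [t' [U'0 oU' dU' [dt' ct'] tX']]] := sH' k [set z | U z.1 /\ X (z.1, (t z.1, z.2))].
- by solve_def.
- apply/thinN; have [x Ux] := U0; exists x; move: oU; rewrite openE => /(_ x Ux).
  by apply: filterS => y Uy; have /= [h' Xh'] := tX y Uy; exists h'.
exists U', (fun x => (t x, t' x)); split=> //.
- split; first by solve_dmap.
  apply: cont_in_pair => // x U'x P hP; have [Ux _] := tX' x U'x.
  by apply: filterS (ct x Ux P hP) => x' h U'x'; apply: h; case: (tX' x' U'x').
- by move=> x /tX' [].
Qed.

Lemma selectable_Rn n : selectable (Rn n).
Proof.
elim: n => [|n IH]; last by apply: (@selectable_prod (Rn n) R) => //; exact: selectable_R.
move=> k X dX nX; have [|x hx] := (thinN [set x : Rn k | X (x, tt)]).1.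
  by apply: contra_not nX; apply: thin_sub => x [[]].
have [U [oU dU Ux UX]] := open_box hx.
exists U, (fun=> tt); split=> //; first by exists x.
by split; [exact: dmap_cst|exact: cont_in_cst].
Qed.

(** One of the finitely many images covering [H] already meets the fibres over a set with interior;
    the selection is made among its parameters, in R^m, and composed with the parametrization. *)
Lemma parametrized_selectable (H : topologicalType) (cH : coded M H) :
  parametrized H -> selectable H.
Proof.
move=> pH k X dX nX.
pose F (Z : set H) := [set x : Rn k | exists2 h, Z h & X (x, h)].
pose C (E : set (Rn k)) := exists2 Z : set H, parameter_image (cH := cH) Z & E = F Z.
have hF : finite_union C (F setT).
  apply: (finite_union_bind (F := F)) pH _.
  - by apply/seteqP; split=> // x [].
  - move=> P Q; apply/seteqP; split=> [x [h [Ph|Qh] Xh]|x [[h Ph Xh]|[h Qh Xh]]].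
    + by left; exists h.
    + by right; exists h.
    + by exists h => //; left.
    + by exists h => //; right.
  - by move=> P iP _; apply: finite_union1; exists P.
have [||E [Z [m [Y [e [dY de ce ->]]]] ->] [nE _]] := finite_union_thin hF.
- by move=> _ [_ [m [Y [e [dY de ce ->]]]] ->]; rewrite /F /image; solve_def.
- by apply: contra_not nX; apply: thin_sub => x [h Xh]; exists h.
have [||U [t [U0 oU dU [dt ct] tX]]] := @selectable_Rn m k [set z | Y z.2 /\ X (z.1, e z.2)].
- by solve_def.
- apply: contra_not nE; apply: thin_sub => x [_ [y Yy <-] Xy]; exists y; by [].
exists U, (e \o t); split=> //.
- split; first by rewrite /comp; solve_dmap.
  by apply: cont_in_comp ct ce _ => x /tX [].
- by move=> x /tX [].
Qed.

End Parametrized.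

Arguments parametrized {R M} H {cH}.
Arguments selectable {R M} H {cH}.

(** * Charts and definable components *)

Section Coordinates.
Variables (R : realType) (M : structure1 R).
Local Notation Rn := (Rn R).

Fixpoint to_fun n : Rn n -> 'I_n -> R :=
  if n is m.+1 return Rn n -> 'I_n -> R then fun x => snoc_ptws (@to_fun m x.1, x.2) else fun _ _ => 0.

Fixpoint of_fun n : ('I_n -> R) -> Rn n :=
  if n is m.+1 return ('I_n -> R) -> Rn n
  then fun y => (@of_fun m (fun j => y (lift ord_max j)), y ord_max) else fun=> tt.

Lemma to_funK n : cancel (@to_fun n) (@of_fun n).
Proof.
elim: n => [[]//|n IH] [x t] /=; congr pair.
  rewrite -[RHS]IH; congr of_fun; apply/funext => j.
  by rewrite /snoc_ptws liftK.
by rewrite /snoc_ptws unlift_none.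
Qed.

Lemma of_funK n : cancel (@of_fun n) (@to_fun n).
Proof.
elim: n => [|n IH] y; first by apply/funext => -[].
apply/funext => i; rewrite /= /snoc_ptws /= IH.
by case: unliftP => [j ->|->].
Qed.

Lemma dmap_to_fun n : dmap M (@to_fun n).
Proof.
elim: n => [|n IH]; first exact: dmap_cst.
rewrite /= /snoc_ptws; apply: (dmap_fun (f := fun x i => _)) => i.
by case: (unlift ord_max i) => [j|] /=; solve_dmap.
Qed.

Lemma continuous_to_fun n : continuous (@to_fun n : Rn n -> {ptws 'I_n -> R}).
Proof.
apply: cont_in_setT; elim: n => [|n IH].
  by move=> x _ P /nbhs_singleton hP; apply: filterE => x' _; rewrite (_ : to_fun x' = to_fun x) //; apply/funext => -[].
apply: cont_in_ptws => i; rewrite /= /snoc_ptws /=; case: (unlift ord_max i) => [j|] /=; last first.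
  exact: continuous_cont_in (@continuous_snd _ _).
apply: (cont_in_comp (V := setT) (f := fun x : Rn n * R => x.1) (g := fun x => to_fun x j)) => //.
  exact: continuous_cont_in (@continuous_fst _ _).
exact: (cont_in_comp (V := setT) (g := fun h : {ptws 'I_n -> R} => h j) IH
  (continuous_cont_in (@continuous_ptws_app _ _ j))).
Qed.

Lemma continuous_of_fun n : continuous (@of_fun n : {ptws 'I_n -> R} -> Rn n).
Proof.
apply: cont_in_setT; elim: n => [|n IH] /=.
  by move=> x _ P /nbhs_singleton hP; apply: filterE.
apply: cont_in_pair; last exact: continuous_cont_in (@continuous_ptws_app _ _ ord_max).
apply: (cont_in_comp (V := setT) (f := fun (y : {ptws 'I_n.+1 -> R}) => (fun j => y (lift ord_max j)) : {ptws 'I_n -> R})) IH _ => //.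
by apply: cont_in_ptws => j; exact: continuous_cont_in (@continuous_ptws_app _ _ (lift ord_max j)).
Qed.

End Coordinates.

Section DefinableGroup.
Variables (R : realType) (M : structure1 R) (H : groupType) (c : coding1 R H).
Hypothesis H_interpretable : interpretable_group M c.

Lemma coded_group : coded M H.
Proof.
apply: (@Coded _ _ _ _ c).
- exists (List.map (fun i => existT _ tt i) (enum (cidx c tt))) => -[[] i].
  apply/List.in_map_iff; exists i; split=> //.
  have : i \in enum (cidx c tt) by rewrite mem_enum.
  by elim: (enum _) => //= j l IH; rewrite inE => /orP[/eqP->|/IH]; [left|right].
- by case: H_interpretable.
- by case: H_interpretable.
- by case: H_interpretable.
Defined.

Lemma dmap_mulg0 : dmap M (cT := coded_prod coded_group coded_group) (cT' := coded_group)
  (fun t : H * H => (t.1 * t.2)%g).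
Proof. by case: H_interpretable. Qed.

End DefinableGroup.

Section Charts.
Variables (R : realType) (M : structure1 R).
Variables (H : topologicalType) (cH : coded M H) (h0 : H).
Local Notation Rn := (Rn R).

Definition is_chart k (D : set H) (ch : H -> Rn k) (e : Rn k -> H) :=
  [/\ open D, [/\ def M D, dmap M ch & dmap M e], (forall g, D g -> e (ch g) = g),
      open (ch @` D) & cont_in D ch /\ cont_in (ch @` D) e].

(** [phi] is known to be definable only on [D]. The chart and its inverse are rebuilt from their
    graphs as total definable maps, with arbitrary values outside their domains. *)
Lemma chart_exists k (D : set H) (phi : H -> 'I_k -> R) : open D -> set_inj D phi ->
  def M [set t | D t.1 /\ phi t.1 = t.2] ->
  (forall V, V `<=` D -> (open V <-> open (phi @` V : set {ptws 'I_k -> R}))) ->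
  exists ch e, is_chart (k := k) D ch e /\ forall g, D g -> to_fun (ch g) = phi g.
Proof.
move=> oD inj dphi hV; have dt := @dmap_to_fun _ M k.
pose P : set (H * ('I_k -> R)) := fun t => D t.1 /\ phi t.1 = t.2.
have dP : def M P by exact: dphi.
have dD : def M D.
  apply: (def_iff (P := fun h => exists y, P (h, y))); last by solve_def.
  by move=> h /=; split=> [[y []]|] //; exists (phi h).
have dQ : def M (fun t : H * Rn k => D t.1 /\ phi t.1 = to_fun t.2).
  by change (def M (fun t : H * Rn k => P (t.1, to_fun t.2))); solve_def.
have [ch [dch chE _]] := @dmap_choice _ _ M H (Rn k) cH _
  (fun g x => D g /\ phi g = to_fun x) (of_fun (fun=> 0)) dQ
  (fun g x y h1 h2 => can_inj (@to_funK R k) (etrans (esym h1.2) h2.2)).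
have dQ' : def M (fun t : Rn k * H => D t.2 /\ phi t.2 = to_fun t.1).
  by change (def M (fun t : Rn k * H => P (t.2, to_fun t.1))); solve_def.
have uQ' (x : Rn k) g g' : D g /\ phi g = to_fun x -> D g' /\ phi g' = to_fun x -> g = g'.
  by move=> [Dg e1] [Dg' e2]; apply: inj; rewrite ?inE // e1.
have [e [de eE _]] := dmap_choice h0 dQ' uQ'.
have chP g : D g -> to_fun (ch g) = phi g.
  by move=> Dg; rewrite (chE g (of_fun (phi g))) of_funK.
have eK g : D g -> e (ch g) = g by move=> Dg; apply: eE; rewrite chP.
have imE V : V `<=` D -> ch @` V = (@to_fun R k) @^-1` (phi @` V).
  move=> VD; apply/seteqP; split=> [_ [g Vg <-]|x [g Vg ex]] /=.
    by exists g => //; rewrite chP //; exact: VD.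
  by exists g => //; apply: (can_inj (@to_funK R k)); rewrite chP //; exact: VD.
have opn V : V `<=` D -> open V -> open (ch @` V).
  move=> VD oV; rewrite imE //; apply: (@open_comp (Rn k) {ptws 'I_k -> R} (@to_fun R k)); last exact: (hV V VD).1 oV.
  by move=> x _; exact: continuous_to_fun.
exists ch, e; split=> //; split=> //; first exact: opn.
split.
  move=> g Dg Q; rewrite nbhsE => -[O [oO Og] OP].
  pose V := D `&` ch @^-1` O.
  have oV : open V.
    have VD : V `<=` D by move=> ? [].
    apply: (hV V VD).2.
    rewrite (_ : phi @` V = (phi @` D) `&` (@of_fun R k) @^-1` O); last first.
      apply/seteqP; split=> [_ [g' [Dg' Og'] <-]|_ [[g' Dg' <-]] /= Og'].
        by split; [exists g'|rewrite /= -chP // to_funK].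
      by exists g' => //; split=> //=; move: Og'; rewrite -chP // to_funK.
    apply: openI; first exact: (hV D (@subset_refl _ D)).1 oD.
    by apply: (@open_comp {ptws 'I_k -> R} (Rn k) (@of_fun R k)) => // x _; exact: continuous_of_fun.
  have : nbhs g V by apply: open_nbhs_nbhs.
  by apply: filterS => g' [_ Og'] _; exact: OP.
move=> _ [g Dg <-] Q; rewrite eK // nbhsE => -[O [oO Og] OP].
have oV : open (ch @` (D `&` O)) by apply: opn; [move=> ? []|exact: openI].
have : nbhs (ch g) (ch @` (D `&` O)) by apply: open_nbhs_nbhs; split=> //; exists g.
by apply: filterS => _ [g' [Dg' Og'] <-] _; apply: OP; rewrite eK.
Qed.

Lemma parametrized_charts k m (D : 'I_m -> set H) (ch : 'I_m -> H -> Rn k) e :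
  (forall h, exists j, D j h) -> (forall j, is_chart (D j) (ch j) (e j)) -> parametrized H.
Proof.
move=> cov hch; pose F n := if insub n is Some j then D j else set0.
rewrite /parametrized (_ : setT = [set h | exists2 n, (n < m)%N & F n h]); last first.
  apply/seteqP; split=> // h _; have [j Djh] := cov h.
  by exists (val j); [exact: ltn_ord|rewrite /F valK].
apply: finite_union_lt => n nm; rewrite /F insubT.
apply: finite_union1; have [_ [dD dch de] eK _ [_ ce]] := hch (Ordinal nm).
exists k, (ch (Ordinal nm) @` D (Ordinal nm)), (e (Ordinal nm)); split=> //.
  by rewrite /image; solve_def.
apply/seteqP; split=> [h Dh|_ [_ [h Dh <-] <-]]; last by rewrite eK.
by exists (ch (Ordinal nm) h); [exists h|exact: eK].
Qed.

End Charts.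

(** * Connected components *)

Section Components.
Variable T : topologicalType.
Implicit Types (X Y P : set T).

Definition component X x := [set y | exists B : set T, [/\ lconnected B, B `<=` X, B x & B y]].

Lemma lconnected_component X x : lconnected (component X x).
Proof.
move=> P hP.
suff h y : component X x y -> P x <-> P y by move=> y z /h h1 /h h2 /h1 /h2.
move=> [B [cB BX Bx By]].
have hPB z : B z -> nbhs z (fun z' => B z' -> (P z' <-> P z)).
  move=> Bz; have /hP : component X x z by exists B.
  by apply: filterS => z' h Bz'; apply: h; exists B.
by split=> h; [exact: (cB P hPB x)|exact: (cB P hPB y)].
Qed.

Lemma component_max X x P : lconnected P -> P `<=` X -> P x -> P `<=` component X x.
Proof. by move=> cP PX Px y Py; exists P. Qed.

Lemma lconnectedU X Y x : lconnected X -> lconnected Y -> X x -> Y x -> lconnected (X `|` Y).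
Proof.
move=> cX cY Xx Yx P hP.
have hX z : X z -> nbhs z (fun z' => X z' -> (P z' <-> P z)).
  by move=> Xz; apply: filterS (hP z (or_introl Xz)) => z' h Xz'; apply: h; left.
have hY z : Y z -> nbhs z (fun z' => Y z' -> (P z' <-> P z)).
  by move=> Yz; apply: filterS (hP z (or_intror Yz)) => z' h Yz'; apply: h; right.
suff h y : (X `|` Y) y -> P x <-> P y by move=> y z /h h1 /h h2 /h1 /h2.
by move=> [Xy|Yy]; split=> h; [exact: (cX P hX x)|exact: (cX P hX y)|exact: (cY P hY x)|exact: (cY P hY y)].
Qed.

Lemma component_sub X x : component X x `<=` X.
Proof. by move=> y [B [_ BX _ /BX]]. Qed.

Lemma lconnected1 (x : T) : lconnected [set x].
Proof. by move=> P _ y z -> ->. Qed.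

Lemma component_refl X x : X x -> component X x x.
Proof. by move=> Xx; exists [set x]; split=> //; [exact: lconnected1|move=> _ ->]. Qed.

Lemma component_trans X x y z : component X x y -> component X y z -> component X x z.
Proof.
move=> [B [cB BX Bx By]] [B' [cB' BX' By' Bz]]; exists (B `|` B'); split.
- exact: lconnectedU cB cB' By By'.
- by move=> t [/BX|/BX'].
- by left.
- by right.
Qed.

Lemma component_sym X x y : component X x y -> component X y x.
Proof. by move=> [B [? ? ? ?]]; exists B. Qed.

Lemma lconnected_adherent P y : lconnected P -> P !=set0 -> ~ nbhs y (~` P) ->
  lconnected (P `|` [set y]).
Proof.
move=> cP [x Px] ny Q hQ.
have hP z : P z -> nbhs z (fun z' => P z' -> (Q z' <-> Q z)).
  by move=> Pz; apply: filterS (hQ z (or_introl Pz)) => z' h Pz'; apply: h; left.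
have [z [Pz Qz]] : exists z, P z /\ (Q z <-> Q y).
  apply: contrapT => h; apply: ny.
  apply: filterS (hQ y (or_intror erefl)) => z' hz Pz'; apply: h; exists z'; split=> //.
  by apply: hz; left.
suff h t : (P `|` [set y]) t -> Q z <-> Q t by move=> t u /h h1 /h h2 /h1 /h2.
by move=> [Pt|->] //; split=> h; [exact: (cP Q hP z)|exact: (cP Q hP t)].
Qed.

(** A connected piece of [X] accumulating at [x] stays connected when [x] is added, so it lies in
    the component of [x]. Each other piece misses a neighbourhood of [x], and there are finitely
    many pieces. *)
Lemma component_open X x : finite_union (@lconnected T) X -> component X x x ->
  nbhs x (fun y => X y -> component X x y).
Proof.
move=> /finite_union_subset + cxx.
suff h Y : finite_union (fun P => lconnected P /\ P `<=` X) Y ->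
    nbhs x (fun y => Y y -> component X x y) by exact: h.
elim=> [|P [cP PX]|P Q _ hP _ hQ]; first by apply: filterE.
- have [[z [Pz cz]]|nz] := pselect (exists z, P z /\ component X x z).
    by apply: filterE => y Py; apply: component_trans cz _; exact: component_max Pz _ Py.
  have [[z Pz]|P0] := pselect (P !=set0); last first.
    by apply: filterE => y Py; case: P0; exists y.
  have [ny|ny] := pselect (nbhs x (~` P)); first by apply: filterS ny.
  exfalso; apply: nz; exists z; split=> //; exists (P `|` [set x]); split.
  + by apply: lconnected_adherent => //; exists z.
  + by move=> t [/PX//|->]; exact: component_sub cxx.
  + by right.
  + by left.
- by apply: filterS (filterI hP hQ) => y [h1 h2] [/h1|/h2].
Qed.

End Components.

(** * Level sets of locally constant functions *)

Section LevelSets.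
Variables (R : realType) (M : structure1 R).
Hypothesis M_order : expansion (order_structure R) M.
Hypothesis M_ominimal : ominimal M.
Variables (G : topologicalGroupType) (cG : coding1 R G).
Hypothesis G_interpretable : interpretable_group M cG.
Let coG : coded M G := coded_group G_interpretable.
#[local] Existing Instance coG.
Hypothesis G_parametrized : parametrized G.
Variable n : nat.
Local Notation T := {ptws 'I_n -> G}.
Implicit Types (X C : set T).

Lemma conn_pieces X : def M X -> finite_union (fun P => def M P /\ lconnected P) X.
Proof.
by apply: (parametrized_conn M_order M_ominimal); exact: parametrized_ptws 1%g G_parametrized.
Qed.

Lemma def_component X x : def M X -> def M (component X x).
Proof.
move=> dX; suff h (Y : set T) : finite_union (fun P => (def M (cT := coded_ptws _ coG) P /\ lconnected P) /\ P `<=` X) Y ->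
    def M (cT := coded_ptws _ coG) (Y `&` component X x).
  have := h X (finite_union_subset (conn_pieces dX)).
  have e : X `&` component X x = component X x by apply/setIidPr => y; exact: component_sub.
  by have := h X (finite_union_subset (conn_pieces dX)); rewrite e.
elim=> [|P [[dP cP] PX]|P Q _ hP _ hQ].
- by rewrite set0I; exact: def_cst.
- have [[z [Pz cz]]|nz] := pselect (exists z, P z /\ component X x z).
    rewrite (_ : P `&` _ = P) //; apply/setIidPl => y Py.
    by apply: component_trans cz _; exact: component_max Pz _ Py.
  rewrite (_ : P `&` _ = set0); first exact: def_cst.
  by apply/seteqP; split=> // y [Py cy]; case: nz; exists y.
- by rewrite setIUl; exact: def_or.
Qed.

(** Property rho speaks of definable components, while the analysis produces connected ones. They
    match because a definable set has finitely many connected pieces, all definable. *)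
Lemma definably_connected_component_component X x : def M X -> X x ->
  definably_connected_component M cG X (component X x).
Proof.
move=> dX Xx; split; first by move=> y; exact: component_sub.
  split; first exact: (@def_component X x dX).
  move=> P Q dP dQ [W oW PW] [V oV QV] PQ PQ0.
  have [[y Py]|P0] := pselect (P !=set0); last first.
    by left; apply/seteqP; split=> // y Py; case: P0; exists y.
  have [[z Qz]|Q0] := pselect (Q !=set0); last first.
    by right; apply/seteqP; split=> // z Qz; case: Q0; exists z.
  have cP : forall t, P t -> component X x t by move=> t Pt; rewrite -PQ; left.
  have cQ : forall t, Q t -> component X x t by move=> t Qt; rewrite -PQ; right.
  have nPQ t : P t -> Q t -> False by move=> Pt Qt; have : (P `&` Q) t by []; rewrite PQ0.
  exfalso; apply: (nPQ z) => //; apply: (lconnected_component (X := X) (x := x) (P := P) _ _ _ Py) => //; try exact: cP; try exact: cQ.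
  move=> t; rewrite -PQ => -[Pt|Qt].
    have : nbhs (t : T) W by apply: open_nbhs_nbhs; split=> //; move: Pt; rewrite PW => -[].
    by apply: filterS => t' Wt' ct'; split=> // _; rewrite PW; split=> //; rewrite -PQ.
  have : nbhs (t : T) V by apply: open_nbhs_nbhs; split=> //; move: Qt; rewrite QV => -[].
  apply: filterS => t' Vt' ct'; split=> [Pt'|Pt]; exfalso; last exact: nPQ Qt.
  by apply: (nPQ t') => //; rewrite QV; split=> //; rewrite -PQ.
move=> C [dC hC] XC CX; have Cx : C x by apply: XC; exact: component_refl.
apply/seteqP; split=> //.
have fC : finite_union (@lconnected T) C.
  by apply: finite_union_mono (conn_pieces dC) => P [].
(* For maximality, [K] and its complement in [C] are both definable and relatively open, so a
   definably connected [C] is all of [K] and hence connected. *)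
pose K : set T := component (T := T) C x.
have dK : def M K by exact: (@def_component C x dC).
have oK y : C y -> nbhs (y : T) (fun z => C z -> component (T := T) C y z).
  by move=> Cy; apply: (@component_open T) => //; exact: (@component_refl T).
have sepK : C `\` K = C `&` interior (fun z : T => C z -> (C `\` K) z).
  apply/seteqP; split=> y [Cy]; last by move=> /nbhs_singleton; apply.
  move=> nK; split=> //; apply: filterS (oK y Cy) => z h Cz; split=> // Kz; apply: nK.
  exact: component_trans Kz (component_sym (h Cz)).
have sepK' : K = C `&` interior (fun z : T => C z -> K z).
  apply/seteqP; split=> y; last by move=> [Cy /nbhs_singleton]; apply.
  move=> Ky; have Cy := component_sub Ky; split=> //.
  by apply: filterS (oK y Cy) => z h Cz; apply: component_trans Ky _; exact: h.
have dCK : def M (C `\` K).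
  by apply: def_and => //; exact: def_not.
have [||||K0|CK0] := hC K (C `\` K) dK dCK.
- by exists (interior (fun z : T => C z -> K z)) => //; exact: open_interior.
- by exists (interior (fun z : T => C z -> (C `\` K) z)) => //; exact: open_interior.
- apply/seteqP; split=> y; first by move=> [/component_sub//|[]].
  by move=> Cy; have [Ky|nK] := pselect (K y); [left|right].
- by apply/seteqP; split=> // y [Ky [_ nK]]; case: (nK Ky).
- have Kx : K x by exact: (@component_refl T).
  by rewrite K0 in Kx.
move=> y Cy; have [B [cB BC Bx By]] : K y.
  by apply: contrapT => nK; have : (C `\` K) y by []; rewrite CK0.
by exists B; split=> // z /BC/CX.
Qed.

Section Level.
Variables (V : Type) (F : T -> V) (X : set T).
Hypothesis dX : def M X.
Hypothesis F_const : forall z, X z -> nbhs z (fun z' => X z' -> F z' = F z).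
Variable v : V.
Local Notation L := [set z | X z /\ F z = v].

Lemma level_lconnected P x : lconnected P -> P `<=` X -> P x -> L x -> P `<=` L.
Proof.
move=> cP PX Px [_ Fx] y Py; split; first exact: PX.
apply: (cP (fun z => F z = v) _ x y) => // z Pz.
by apply: filterS (F_const (PX z Pz)) => z' h Pz'; rewrite h //; exact: PX.
Qed.

Lemma def_level : def M L.
Proof.
suff h (Y : set T) : finite_union (fun P => (def M (cT := coded_ptws _ coG) P /\ lconnected P) /\ P `<=` X) Y ->
    def M (cT := coded_ptws _ coG) (Y `&` L).
  have e : X `&` L = L by apply/setIidPr => z [].
  by have := h X (finite_union_subset (conn_pieces dX)); rewrite e.
elim=> [|P [[dP cP] PX]|P Q _ hP _ hQ].
- by rewrite set0I; exact: def_cst.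
- have [[z [Pz Lz]]|nz] := pselect (exists z, P z /\ L z).
    rewrite (_ : P `&` _ = P) //; apply/setIidPl; exact: level_lconnected Pz Lz.
  rewrite (_ : P `&` _ = set0); first exact: def_cst.
  by apply/seteqP; split=> // y [Py Ly]; case: nz; exists y.
- by rewrite setIUl; exact: def_or.
Qed.

(** A component of [X] that meets the level set lies inside it. Property rho makes each such
    component definable in [bG], and the finitely many connected pieces of [X] show that finitely
    many components suffice. *)
Lemma definable_in_level (bG : structure1 G) : property_rho M cG bG ->
  definable_in (group_structure G) (coding_pow 'I_n (self G)) X ->
  definable_in bG (coding_pow 'I_n (self G)) L.
Proof.
move=> rho gX.
have d0 : definable_in bG (coding_pow 'I_n (self G)) set0.
  exists (Fbot _ _), (fun _ _ => 1%g) => x; split=> //; by case.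
suff h (Y : set T) : finite_union (fun P => (def M (cT := coded_ptws _ coG) P /\ lconnected P) /\ P `<=` X) Y ->
    exists D, [/\ definable_in bG (coding_pow 'I_n (self G)) D, Y `&` L `<=` D & D `<=` L].
  have [D [dD h1 h2]] := h X (finite_union_subset (conn_pieces dX)).
  have -> : L = D by apply/seteqP; split=> // z Lz; apply: h1; split=> //; case: Lz.
  exact: dD.
elim=> [|P [[dP cP] PX]|P Q _ [D [dD h1 h2]] _ [E [dE h3 h4]]].
- by exists set0; split=> // z [].
- have [[z [Pz Lz]]|nz] := pselect (exists z, P z /\ L z); last first.
    by exists set0; split=> // z [Pz Lz]; case: nz; exists z.
  exists (component X z); split.
  + exact: rho gX _ (definably_connected_component_component dX Lz.1).
  + by move=> y [Py _]; exact: component_max Pz _ Py.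
  + have czz : component X z z by apply: component_refl; case: Lz.
    by apply: level_lconnected (lconnected_component (x := z)) _ czz Lz => y; exact: component_sub.
- exists (D `|` E); split.
  + have dT : definable bG (cdom (coding_pow 'I_n (self G))).
      by exists (Fimp (Fbot _ _) (Fbot _ _)), (fun _ _ => 1%g) => x; split=> // _ [].
    apply: definable_in_iff (definable_in_not dT (definable_in_and (definable_in_not dT dD) (definable_in_not dT dE))) => z.
    by rewrite /setU /=; have := pselect (D z); have := pselect (E z); tauto.
  + by move=> z [[Pz|Qz] Lz]; [left; apply: h1|right; apply: h3].
  + by move=> z [/h2|/h4].
Qed.

End Level.
End LevelSets.

(** * Lifting commutators to the extension *)

Section CommutatorProducts.
Variable H : groupType.
Local Notation cp := (commutator_products H).

Lemma commutator_products1 (x y : H) : cp 1 [~ x, y]%g.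
Proof. by exists (fun=> x), (fun=> y); rewrite big_ord1. Qed.

Lemma commutator_productsM n m (h k : H) : cp n h -> cp m k -> cp (n + m) (h * k)%g.
Proof.
move=> [x [y ->]] [x' [y' ->]].
exists (fun j : 'I_(n + m) => match fintype.split j with inl i => x i | inr i => x' i end),
  (fun j : 'I_(n + m) => match fintype.split j with inl i => y i | inr i => y' i end).
rewrite big_split_ord /=; congr (_ * _)%g; apply: eq_bigr => j _.
  by rewrite (unsplitK (inl _)).
by rewrite (unsplitK (inr _)).
Qed.

Lemma commutator_productsV n (h : H) : cp n h -> cp n (h^-1)%g.
Proof.
elim: n h => [|n IH] h [x [y ->]]; first by exists x, y; rewrite !big_ord0 invg1.
rewrite big_ord_recr /= invgM invgR; apply: (@commutator_productsM 1 n).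
  exact: commutator_products1.
by apply: IH; exists (fun j => x (widen_ord (leqnSn n) j)), (fun j => y (widen_ord (leqnSn n) j)).
Qed.

End CommutatorProducts.

(* The first half of z lists the left entries of the commutators, the second
   half the right ones. *)
Definition word (H : groupType) n (z : 'I_(n + n) -> H) : H :=
  (\prod_(j < n) [~ z (lshift n j), z (rshift n j)])%g.

Section Extension.
Variables (G A Gt : topologicalGroupType) (i : A -> Gt) (p : Gt -> G).
Hypothesis ext : topological_central_extension i p.

Let i_morph : {morph i : x y / (x * y)%g}. Proof. by case: ext => [[]]. Qed.
Let p_morph : {morph p : x y / (x * y)%g}. Proof. by case: ext => [[]]. Qed.
Let i_inj : injective i. Proof. by case: ext => [[]]. Qed.
Let p_surj z : exists y, p y = z. Proof. by case: ext => [[]]. Qed.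
Let exact_ip y : (exists x, i x = y) <-> p y = 1%g. Proof. by case: ext => [[]]. Qed.
Let i_central x y : (i x * y = y * i x)%g. Proof. by case: ext. Qed.

Lemma p1 : p 1%g = 1%g.
Proof. by apply: (mulgI (p 1%g)); rewrite -p_morph !mulg1. Qed.

Lemma pV x : p (x^-1)%g = (p x)^-1%g.
Proof. by apply: (mulgI (p x)); rewrite -p_morph !mulgV p1. Qed.

Lemma i1 : i 1%g = 1%g.
Proof. by apply: (mulgI (i 1%g)); rewrite -i_morph !mulg1. Qed.

Lemma iV x : i (x^-1)%g = (i x)^-1%g.
Proof. by apply: (mulgI (i x)); rewrite -i_morph !mulgV i1. Qed.

Lemma p_i a : p (i a) = 1%g.
Proof. by apply/exact_ip; exists a. Qed.

Lemma A_abelian (a b : A) : (a * b = b * a)%g.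
Proof. by apply: i_inj; rewrite !i_morph i_central. Qed.

Lemma same_image x y : p x = p y -> exists a, x = (i a * y)%g.
Proof.
move=> e; have [|a ea] := (exact_ip (x * y^-1)%g).2.
  by rewrite p_morph pV e mulgV.
by exists a; rewrite ea mulgVK.
Qed.

Definition lift : G -> Gt := projT1 (choice p_surj).
Lemma liftK g : p (lift g) = g.
Proof. exact: (projT2 (choice p_surj)). Qed.

(* Independent of the choice of lift, since the kernel of p is central. *)
Definition commg_lift (g h : G) : Gt := [~ lift g, lift h]%g.

Lemma commgE (H : groupType) (x y : H) : [~ x, y]%g = ((y * x)^-1 * (x * y))%g.
Proof. by rewrite /commg /conjg invgM !mulgA. Qed.

Lemma commg_central a b (x y : Gt) : [~ i a * x, i b * y]%g = [~ x, y]%g.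
Proof.
rewrite !commgE.
have -> : (i b * y * (i a * x) = i (a * b) * (y * x))%g.
  by rewrite mulgA -(mulgA (i b)) -i_central mulgA -i_morph A_abelian -mulgA.
have -> : (i a * x * (i b * y) = i (a * b) * (x * y))%g.
  by rewrite mulgA -(mulgA (i a)) -i_central mulgA -i_morph -mulgA.
by rewrite invgM -mulgA mulKg.
Qed.

Lemma commg_liftE x y : commg_lift (p x) (p y) = [~ x, y]%g.
Proof.
have [a ea] := same_image (liftK (p x)); have [b eb] := same_image (liftK (p y)).
by rewrite /commg_lift ea eb commg_central.
Qed.

Lemma p_commg_lift g h : p (commg_lift g h) = [~ g, h]%g.
Proof. by rewrite /commg_lift !commgE p_morph pV !p_morph !liftK. Qed.

Definition word_lift n (z : 'I_(n + n) -> G) : Gt :=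
  (\prod_(j < n) commg_lift (z (lshift n j)) (z (rshift n j)))%g.

Lemma p_word_lift n z : p (@word_lift n z) = word z.
Proof.
by rewrite /word_lift /word (big_morph p p_morph p1); apply: eq_bigr => j _; exact: p_commg_lift.
Qed.

Lemma word_lift_commutator n z : commutator_products Gt n (@word_lift n z).
Proof. by exists (fun j => lift (z (lshift n j))), (fun j => lift (z (rshift n j))). Qed.

Lemma word_lift1 n : @word_lift n (fun=> 1%g) = 1%g.
Proof. by apply: big1 => j _; rewrite -p1 commg_liftE commgE mulVg. Qed.

Lemma word_lift_surj n (y : Gt) : commutator_products G n (p y) ->
  exists a z, y = (i a * @word_lift n z)%g.
Proof.
move=> [x [x' e]].
pose z (j : 'I_(n + n)) := match fintype.split j with inl k => x k | inr k => x' k end.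
have [a ->] : exists a, y = (i a * @word_lift n z)%g; last by exists a, z.
apply: same_image; rewrite p_word_lift e /word; apply: eq_bigr => j _; rewrite /z.
by rewrite (unsplitK (inl _)) (unsplitK (inr _)).
Qed.

Lemma cont_in_mulg (S : topologicalType) (H : topologicalGroupType) (W : set S) (f g : S -> H) :
  cont_in W f -> cont_in W g -> cont_in W (fun x => (f x * g x)%g).
Proof.
move=> cf cg; apply: (cont_in_comp (V := setT) (g := fun x : H * H => (x.1 * x.2)%g)) (cont_in_pair cf cg) _ _ => //.
exact: continuous_cont_in (@mulg_continuous H).
Qed.

Lemma cont_in_invg (S : topologicalType) (H : topologicalGroupType) (W : set S) (f : S -> H) :
  cont_in W f -> cont_in W (fun x => (f x)^-1%g).
Proof.
move=> cf; apply: (cont_in_comp (V := setT) (g := fun x : H => x^-1%g)) cf _ _ => //.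
exact: continuous_cont_in (@invg_continuous H).
Qed.

(** [lift] itself need not be continuous. But [p] maps neighbourhoods of lift g and lift h onto
    neighbourhoods of g and h, so nearby points have nearby preimages, from which the commutator may
    equally be computed. *)
Lemma continuous_commg_lift : continuous (fun t : G * G => commg_lift t.1 t.2).
Proof.
move=> [g h] O; change (nbhs (commg_lift g h) O -> nbhs (g, h) (fun t => O (commg_lift t.1 t.2))).
have [_ _ _ _ [_ p_open]] := ext.
have cc : cont_in setT (fun t : Gt * Gt => [~ t.1, t.2]%g).
  have c1 := continuous_cont_in (W := setT) (@continuous_fst Gt Gt).
  have c2 := continuous_cont_in (W := setT) (@continuous_snd Gt Gt).
  rewrite /commg /conjg; apply: cont_in_mulg; first exact: cont_in_invg.
  by apply: cont_in_mulg; [exact: cont_in_invg|exact: cont_in_mulg].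
have pn (x : Gt) N : nbhs x N -> nbhs (p x) (p @` N).
  rewrite nbhsE => -[B [oB Bx] BN].
  have : nbhs (p x) (p @` B) by apply: open_nbhs_nbhs; split; [exact: p_open|exists x].
  by apply: filterS => _ [y By <-]; exists y => //; exact: BN.
move=> hO; have [[/= N1 N2] [/= hN1 hN2] hN] := cc (lift g, lift h) I O hO.
exists (p @` N1, p @` N2); first by split=> /=; [rewrite -[g]liftK|rewrite -[h]liftK]; apply: pn.
move=> [_ _] [/= [x N1x <-] [y N2y <-]]; rewrite commg_liftE.
exact: (hN (x, y)).
Qed.

Lemma continuous_word_lift n : continuous (@word_lift n : {ptws 'I_(n + n) -> G} -> Gt).
Proof.
apply: cont_in_setT; rewrite /word_lift.
have h j : cont_in setT (fun z : {ptws 'I_(n + n) -> G} => commg_lift (z (lshift n j)) (z (rshift n j))).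
  apply: (cont_in_comp (V := setT) (g := fun t : G * G => commg_lift t.1 t.2)
    (f := fun z : {ptws 'I_(n + n) -> G} => (z (lshift n j), z (rshift n j)))) => //.
    by apply: cont_in_pair; exact: continuous_cont_in (@continuous_ptws_app _ _ _).
  exact: continuous_cont_in continuous_commg_lift.
elim: (index_enum _) => [|j l IH].
  by move=> z _ P hP; apply: filterE => z' _; move: hP; rewrite !big_nil => /nbhs_singleton.
move=> z _ P; rewrite big_cons => hP.
have := cont_in_mulg (h j) IH (x := z) I (P := P) hP; apply: filterS => z' + _.
by rewrite big_cons; apply.
Qed.

(** Turns a continuous function with values in a finite set into a locally constant one. *)
Lemma finite_isolated (T : topologicalType) (S : set T) (s : T) : hausdorff_space T ->
  finite_set S -> nbhs s (fun y => S y -> y = s).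
Proof.
move=> hT fS; have cl : closed (S `\` [set s]).
  have /accessible_finite_set_closed h := hausdorff_accessible hT; apply: h.
  by apply: sub_finite_set fS => x [].
have : nbhs s (~` (S `\` [set s])).
  by apply: open_nbhs_nbhs; split; [exact: closed_openC|move=> [_]; apply].
by apply: filterS => y ny Sy; apply: contrapT => ns; apply: ny.
Qed.

Hypothesis E_finite : forall n : nat, finite_set (range i `&` commutator_products Gt n).

Lemma Gt_hausdorff : hausdorff_space Gt. Proof. by case: ext. Qed.

Lemma finite_kernel n : finite_set [set a | commutator_products Gt n (i a)].
Proof.
have := @finite_preimage _ _ (range i `&` commutator_products Gt n) i
  (fun x y _ _ => @i_inj x y) (E_finite n).
by apply: sub_finite_set => a ha; split=> //; exists a.
Qed.

End Extension.

(** * Definability of words in group structures *)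

Lemma coded_self (T : Type) (t0 : T) (N : structure1 T) : coded N T.
Proof.
apply: (@Coded _ _ _ _ (self T)).
- by exists [:: existT _ tt tt] => -[[] []]; left.
- by exists (Fimp (Fbot _ _) (Fbot _ _)), (fun _ _ => t0) => x; split=> // _ [].
- by move=> t; exists (fun _ _ => t).
- exists (@Feq _ _ N (fun s => (unit + unit + nat)%type) tt
    (Tvar _ (inl (inl tt) : (unit + unit + nat)%type))
    (Tvar _ (inl (inr tt) : (unit + unit + nat)%type))), (fun _ _ => t0) => x /=.
  by split=> [[]|].
Defined.

Lemma dmap_mulg_group_structure (H : groupType) :
  dmap (group_structure H) (cT := coded_prod (coded_self 1%g _) (coded_self 1%g _))
    (cT' := coded_self 1%g _) (fun t : H * H => (t.1 * t.2)%g).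
Proof.
exists (@Feq _ _ (group_structure H) (fun s => (unit + unit + unit + nat)%type) tt
    (@Tapp _ _ (group_structure H) _ tt (fun i : 'I_2 => if i == ord0
       then Tvar _ (inl (inl (inl tt)) : (unit + unit + unit + nat)%type)
       else Tvar _ (inl (inl (inr tt)) : (unit + unit + unit + nat)%type)))
    (Tvar _ (inl (inr tt) : (unit + unit + unit + nat)%type))), (fun _ _ => 1%g) => x /=.
by split=> [[]|].
Qed.

Section Inverse.
Variables (S : Type) (U : S -> Type) (N : structure U) (H : groupType) (cH : coded N H).
Hypothesis dmul : dmap N (fun t : H * H => (t.1 * t.2)%g).

Lemma dmap_invg_of_mulg : dmap N (@monoid.inv H).
Proof.
apply: (def_iff (P := fun t : H * H => (t.1 * t.2)%g = 1%g)); last by solve_def.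
by move=> [x y] /=; split=> [e|<-]; [rewrite -[RHS](mulKg x) e mulg1|rewrite mulgV].
Qed.

Lemma dmap_prodg (T : Type) (cT : coded N T) (J : Type) (l : seq J) (f : J -> T -> H) :
  (forall j, dmap N (f j)) -> dmap N (fun x => (\prod_(j <- l) f j x)%g).
Proof.
move=> df; elim: l => [|j l IH].
  by apply: (dmap_iff (f := fun=> 1%g)) => [x|]; [rewrite big_nil|exact: dmap_cst].
apply: (dmap_iff (f := fun x => (f j x * \prod_(j <- l) f j x)%g)) => [x|]; first by rewrite big_cons.
by have := df j => ?; solve_dmap.
Qed.

Lemma dmap_word (n : nat) : dmap N (@word H n).
Proof.
rewrite /word; apply: (@dmap_prodg _ _ _ _ (fun j z => _)) => j; rewrite /commg /conjg.
by have dinv := dmap_invg_of_mulg; solve_dmap.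
Qed.

End Inverse.

(** * Transfer of formulas to the two-sorted structure *)

Section TwoSorted.
Variables (G A : Type) (g0 : G) (a0 : A) (N : structure1 G) (P : structure1 A).
Local Notation TS := (two_sorted N P).

Fixpoint tr_term (V : unit -> Type) (W : sort2 -> Type) (rho : forall s, V s -> W sG)
    s (t : term N V s) : term TS W sG :=
  match t with
  | Tvar s x => Tvar TS (rho s x)
  | Tapp f ts => @Tapp _ _ TS W (inl f) (fun i => tr_term rho (ts i))
  end.

Fixpoint tr_formula (V : unit -> Type) (W : sort2 -> Type) (rho : forall s, V s -> W sG)
    (phi : formula N V) : formula TS W :=
  match phi with
  | Feq s t u => Feq (tr_term rho t) (tr_term rho u)
  | Frel r ts => @Frel _ _ TS W (inl r) (fun i => tr_term rho (ts i))
  | Fbot => Fbot TS W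
  | Fimp a b => Fimp (tr_formula rho a) (tr_formula rho b)
  | Fall s x a => Fall (rho s x) (tr_formula rho a)
  end.

Lemma teval_tr V W rho s (t : term N V s) (w : forall s, W s -> carrier2 G A s) :
  teval w (tr_term rho t) = teval (fun s x => w sG (rho s x)) t.
Proof. by elim: t => //= f ts IH; congr fint; apply: functional_extensionality_dep => i; apply: IH. Qed.

(** Variables are translated without a fresh-name scheme, so injectivity of [rho] is what prevents a
    quantifier from binding a second variable. *)
Lemma sat_tr V W rho (phi : formula N V) (w : forall s, W s -> carrier2 G A s) :
  injective (rho tt) ->
  sat w (tr_formula rho phi) <-> sat (fun s x => w sG (rho s x)) phi.
Proof.
move=> rinj; elim: phi w => [s t u|r ts||a IHa b IHb|s x a IHa] w /=.
- by rewrite !teval_tr.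
- by rewrite (_ : (fun i => teval w _) = fun i => teval (fun s x => w sG (rho s x)) (ts i)) //;
    apply: functional_extensionality_dep => i; rewrite teval_tr.
- by [].
- by rewrite IHa IHb.
case: s x => x; split=> h v hv.
- pose w' s : W s -> carrier2 G A s := match s return W s -> carrier2 G A s with
    | sG => fun z => if pselect (z = rho tt x) then v tt x else w sG z
    | sA => fun z => w sA z end.
  have -> : v = fun s y => w' sG (rho s y).
    apply: functional_extensionality_dep => -[]; apply: functional_extensionality_dep => y.
    rewrite /w'; case: pselect => /= [e|ne]; [by have -> := rinj _ _ e|apply: hv => e].
    by apply: ne; rewrite (existT_inj e).
  apply/IHa; apply: h => -[] y //= ny; case: pselect => // e; case: ny; by rewrite e.
- apply/IHa; apply: h => -[] y ny /=; apply: (hv sG (rho tt y)) => e; apply: ny.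
  by rewrite (rinj _ _ (existT_inj e)).
Qed.

Lemma coded_G : coded TS G.
Proof.
apply: (@Coded _ _ _ _ (self_G G A)).
- by exists [:: existT (fun s => cidx (self_G G A) s) sG tt] => -[[] []]; left.
- by exists (Fimp (Fbot _ _) (Fbot _ _)), (fun s _ => match s return carrier2 G A s with sG => g0 | sA => a0 end) => x; split=> // _ [].
- by move=> t; exists (fun s => match s return cidx (self_G G A) s -> carrier2 G A s with
    sG => fun=> t | sA => fun z => match z with end end).
- exists (@Feq _ _ TS (fun s => (cidx (self_G G A) s + cidx (self_G G A) s + nat)%type) sG
    (Tvar _ (inl (inl tt) : (cidx (self_G G A) sG + cidx (self_G G A) sG + nat)%type))
    (Tvar _ (inl (inr tt) : (cidx (self_G G A) sG + cidx (self_G G A) sG + nat)%type))),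
    (fun s _ => match s return carrier2 G A s with sG => g0 | sA => a0 end) => x /=.
  by split=> [[]|].
Defined.

Lemma coded_A : coded TS A.
Proof.
apply: (@Coded _ _ _ _ (self_A G A)).
- by exists [:: existT (fun s => cidx (self_A G A) s) sA tt] => -[[] []]; left.
- by exists (Fimp (Fbot _ _) (Fbot _ _)), (fun s _ => match s return carrier2 G A s with sG => g0 | sA => a0 end) => x; split=> // _ [].
- by move=> t; exists (fun s => match s return cidx (self_A G A) s -> carrier2 G A s with
    sA => fun=> t | sG => fun z => match z with end end).
- exists (@Feq _ _ TS (fun s => (cidx (self_A G A) s + cidx (self_A G A) s + nat)%type) sA
    (Tvar _ (inl (inl tt) : (cidx (self_A G A) sA + cidx (self_A G A) sA + nat)%type))
    (Tvar _ (inl (inr tt) : (cidx (self_A G A) sA + cidx (self_A G A) sA + nat)%type))),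
    (fun s _ => match s return carrier2 G A s with sG => g0 | sA => a0 end) => x /=.
  by split=> [[]|].
Defined.

Lemma def_transfer (J : finType) (X : set (J -> G)) :
  definable_in N (coding_pow J (self G)) X ->
  def TS (cT := coded_pow J coded_G) X.
Proof.
move=> [phi [b hb]].
pose W s := (J * cidx (self_G G A) s + nat)%type.
pose rho s : (J * unit + nat)%type -> W sG := fun z => z.
exists (@tr_formula _ W (fun s z => z) phi),
  (fun s => match s return nat -> carrier2 G A s with sG => b tt | sA => fun=> a0 end) => x.
rewrite sat_tr //; split.
  move=> [_ Xx]; have /hb : [set x | cdom (coding_pow J (self G)) x /\ X (cval (coding_pow J (self G)) x)] (fun s => x sG) by [].
  by apply: (iffLR (sat_ext _ _)) => -[] [z|k].
move=> h; have : sat (env (fun s => x sG) b) phi.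
  by move: h; apply: (iffLR (sat_ext _ _)) => -[] [z|k].
by move=> /hb [_ Xx].
Qed.

End TwoSorted.

Lemma dmap_mulg_G (G : groupType) (A : Type) (a0 : A) (N1 : structure1 G) (P : structure1 A) :
  let cG := coded_G 1%g a0 (join_structure (group_structure G) N1) P in
  dmap _ (cT := coded_prod cG cG) (cT' := cG) (fun t : G * G => (t.1 * t.2)%g).
Proof.
pose I s := cidx (self_G G A) s; pose V s := (I s + I s + I s + nat)%type.
exists (@Feq _ _ (two_sorted (join_structure (group_structure G) N1) P) V sG
    (@Tapp _ _ (two_sorted (join_structure (group_structure G) N1) P) V (inl (inl tt)) (fun i : 'I_2 => if i == ord0
       then @Tvar _ _ _ V sG (inl (inl (inl tt)))
       else @Tvar _ _ _ V sG (inl (inl (inr tt)))))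
    (@Tvar _ _ _ V sG (inl (inr tt)))), (fun s _ => match s return carrier2 G A s with sG => 1%g | sA => a0 end) => x /=.
by split=> [[]|].
Qed.

Lemma dmap_mulg_A (G : Type) (g0 : G) (A : groupType) (N : structure1 G) :
  let cA := coded_A g0 1%g N (group_structure A) in
  dmap _ (cT := coded_prod cA cA) (cT' := cA) (fun t : A * A => (t.1 * t.2)%g).
Proof.
pose I s := cidx (self_A G A) s; pose V s := (I s + I s + I s + nat)%type.
exists (@Feq _ _ (two_sorted N (group_structure A)) V sA
    (@Tapp _ _ (two_sorted N (group_structure A)) V (inr tt) (fun i : 'I_2 => if i == ord0
       then @Tvar _ _ _ V sA (inl (inl (inl tt)))
       else @Tvar _ _ _ V sA (inl (inl (inr tt)))))
    (@Tvar _ _ _ V sA (inl (inr tt)))), (fun s _ => match s return carrier2 G A s with sG => g0 | sA => 1%g end) => x /=.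
by split=> [[]|].
Qed.

Definition coding_map (S : Type) (U : S -> Type) (H K : Type) (g : H -> K) (c : coding U H) : coding U K :=
  {| cidx := cidx c; cdom := cdom c; cval := fun x => g (cval c x) |}.

(** * The extension as a quotient of G^2n x A *)

Section Relation.
Variables (G A Gt : topologicalGroupType) (i : A -> Gt) (p : Gt -> G).
Hypothesis ext : topological_central_extension i p.
Hypothesis E_finite : forall n : nat, finite_set (range i `&` commutator_products Gt n).
Variable n : nat.
Local Notation m := (n + n)%N.
Local Notation F := (@word_lift _ _ _ _ _ ext n).
Local Notation cp := (commutator_products Gt).

Let i_morph : {morph i : x y / (x * y)%g}. Proof. by case: ext => [[]]. Qed.
Let p_morph : {morph p : x y / (x * y)%g}. Proof. by case: ext => [[]]. Qed.
Let i_central x y : (i x * y = y * i x)%g. Proof. by case: ext. Qed.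
Let exact_ip y : (exists x, i x = y) <-> p y = 1%g. Proof. by case: ext => [[]]. Qed.

Definition proj1of3 (z : 'I_(m + m + m) -> G) : 'I_m -> G := fun j => z (lshift m (lshift m j)).
Definition proj2of3 (z : 'I_(m + m + m) -> G) : 'I_m -> G := fun j => z (lshift m (rshift m j)).
Definition proj3of3 (z : 'I_(m + m + m) -> G) : 'I_m -> G := fun j => z (rshift (m + m) j).

(** Property rho concerns subsets of a power of G, so the three words are packed into one tuple. *)
Definition cat3 (t : ('I_m -> G) * ('I_m -> G) * ('I_m -> G)) (j : 'I_(m + m + m)) : G :=
  match fintype.split j with
  | inl j' => match fintype.split j' with inl k => t.1.1 k | inr k => t.1.2 k end
  | inr k => t.2 k
  end.

Definition F3 (z : 'I_(m + m + m) -> G) : Gt :=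
  (F (proj1of3 z) * F (proj2of3 z) * (F (proj3of3 z))^-1)%g.

Definition word3 (z : 'I_(m + m + m) -> G) : G :=
  (word (proj1of3 z) * word (proj2of3 z) * (word (proj3of3 z))^-1)%g.

Lemma p_F3 z : p (F3 z) = word3 z.
Proof. by rewrite /F3 !p_morph (pV ext) !(p_word_lift ext). Qed.

Lemma F3_cat3 t : F3 (cat3 t) = (F t.1.1 * F t.1.2 * (F t.2)^-1)%g.
Proof.
have e1 : proj1of3 (cat3 t) = t.1.1.
  by apply/funext => j; rewrite /proj1of3 /cat3 (unsplitK (inl _)) (unsplitK (inl _)).
have e2 : proj2of3 (cat3 t) = t.1.2.
  by apply/funext => j; rewrite /proj2of3 /cat3 (unsplitK (inl _)) (unsplitK (inr _)).
have e3 : proj3of3 (cat3 t) = t.2.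
  by apply/funext => j; rewrite /proj3of3 /cat3 (unsplitK (inr _)).
by rewrite /F3 e1 e2 e3.
Qed.

Lemma continuous_F3 : continuous (F3 : {ptws 'I_(m + m + m) -> G} -> Gt).
Proof.
have h (k : 'I_m -> 'I_(m + m + m)) :
    cont_in setT (fun z : {ptws 'I_(m + m + m) -> G} => F (fun j => z (k j))).
  apply: (cont_in_comp (V := setT) (T := {ptws 'I_m -> G}) (g := F)
    (f := fun (z : {ptws 'I_(m + m + m) -> G}) j => z (k j))) => //.
    by apply: cont_in_ptws => j; exact: continuous_cont_in (@continuous_ptws_app _ _ _).
  apply: continuous_cont_in; exact: continuous_word_lift.
apply: cont_in_setT.
exact: (cont_in_mulg (cont_in_mulg (h (fun j => lshift m (lshift m j)))
  (h (fun j => lshift m (rshift m j)))) (cont_in_invg (h (fun j => rshift (m + m) j)))).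
Qed.

(** The inverse of a commutator is a commutator, so the length 3n does not depend on [z] and
    condition (2) bounds the values of [F3] in i(A). *)
Lemma F3_commutator z : cp (n + n + n) (F3 z).
Proof.
rewrite /F3; apply: commutator_productsM; last by apply: commutator_productsV; exact: word_lift_commutator.
by apply: commutator_productsM; exact: word_lift_commutator.
Qed.

Lemma F3_const (z : {ptws 'I_(m + m + m) -> G}) : word3 z = 1%g ->
  nbhs z (fun z' => word3 z' = 1%g -> F3 z' = F3 z).
Proof.
move=> Xz; have hk := continuous_F3 (finite_isolated (F3 z) (Gt_hausdorff ext) (E_finite (n + n + n))).
change (nbhs z (fun z' => (range i `&` cp (n + n + n)) (F3 z') -> F3 z' = F3 z)) in hk.
apply: filterS hk => z' h Xz'; apply: h; split; last exact: F3_commutator.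
by have [|a ea] := (exact_ip (F3 z')).2; [rewrite p_F3|exists a].
Qed.

Definition rel3 v : set (('I_m -> G) * ('I_m -> G) * ('I_m -> G)) :=
  [set t | (F t.1.1 * F t.1.2 = i v * F t.2)%g].

Definition level3 v : set ('I_(m + m + m) -> G) := [set z | word3 z = 1%g /\ F3 z = i v].

Lemma rel3E v t : rel3 v t <-> level3 v (cat3 t).
Proof.
rewrite /rel3 /level3 /= -p_F3 F3_cat3; split=> [->|[_ e]].
  by rewrite mulgK (p_i ext).
by rewrite -e mulgVK.
Qed.

Lemma rel3_commutator v t : rel3 v t -> cp (n + n + n) (i v).
Proof. by move=> /rel3E [_ <-]; exact: F3_commutator. Qed.

Section Definable.
Variables (S : Type) (U : S -> Type) (N : structure U) (coG : coded N G) (coA : coded N A).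
Hypothesis def_level3 : forall v, def N (level3 v).

Lemma def_rel3 v : def N (rel3 v).
Proof.
have dl := def_level3 v.
apply: (def_iff (P := fun t => level3 v (cat3 t))); first by move=> t; rewrite -rel3E.
refine (def_comp (f := cat3) _ dl).
apply: (dmap_fun (f := cat3)) => j; rewrite /cat3.
by case: (fintype.split j) => [j'|k]; [case: (fintype.split j') => k|]; solve_dmap.
Qed.

Definition relA : set (('I_m -> G) * ('I_m -> G) * ('I_m -> G) * A) :=
  [set t | (F t.1.1.1 * F t.1.1.2 = i t.2 * F t.1.2)%g].

(** The last entry is one of the finitely many v for which i(v) is a product of 3n commutators. The
    relation is therefore a finite disjunction in which v is a parameter, although [i] has no
    meaning in [N] yet. *)
Lemma def_relA : def N relA.
Proof.
have /finite_seqP [s hs] := finite_kernel ext E_finite (n + n + n).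
apply: (def_iff (P := fun t => exists k : 'I_(size s), rel3 (nth 1%g s k) t.1 /\ t.2 = nth 1%g s k)).
  move=> [t a]; split=> /= [[k [h ->]] //|h].
  have : [set a | cp (n + n + n) (i a)] a by exact: (@rel3_commutator a t).
  rewrite hs /= -index_mem => ks; exists (Ordinal ks) => /=.
  by rewrite nth_index -?index_mem.
refine (def_exists_fin (P := fun k t => _) _) => k.
by have := def_rel3 (nth 1%g s k) => ?; solve_def.
Qed.

Hypothesis dmulG : dmap N (fun t : G * G => (t.1 * t.2)%g).
Hypothesis dmulA : dmap N (fun t : A * A => (t.1 * t.2)%g).
Hypothesis F_onto : forall y : Gt, exists a z, y = (i a * F z)%g.

Definition cover_map (t : ('I_m -> G) * A) : Gt := (i t.2 * F t.1)%g.

Definition cover_coding : coding U Gt :=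
  coding_map cover_map (@cod _ _ _ _ (coded_prod (coded_pow 'I_m coG) coA)).

(** F takes the value 1 at the constant word 1, so equality is multiplication with a trivial second
    factor. *)
Lemma cover_eq (t u : ('I_m -> G) * A) :
  cover_map t = cover_map u <-> relA (t.1, (fun=> 1%g), u.1, (t.2^-1 * u.2)%g).
Proof.
rewrite /cover_map /relA /= (word_lift1 ext) mulg1 i_morph (iV ext) -mulgA; split=> e.
  by rewrite -e mulKg.
by rewrite e mulVKg.
Qed.

Lemma cover_mul (t u v : ('I_m -> G) * A) :
  (cover_map t * cover_map u)%g = cover_map v <-> relA (t.1, u.1, v.1, ((t.2 * u.2)^-1 * v.2)%g).
Proof.
rewrite /cover_map /relA /= i_morph (iV ext) -[in X in _ <-> X]mulgA.
have -> : (i t.2 * F t.1 * (i u.2 * F u.1) = i (t.2 * u.2) * (F t.1 * F u.1))%g.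
  by rewrite mulgA -(mulgA (i t.2)) -i_central i_morph !mulgA.
by split=> e; [rewrite -e mulKg|rewrite e mulVKg].
Qed.

Lemma interpretable_cover :
  [/\ interpretable_group N cover_coding,
      definable_in N (coding_pair (@cod _ _ _ _ coA) cover_coding) [set t | i t.1 = t.2] &
      definable_in N (coding_pair cover_coding (@cod _ _ _ _ coG)) [set t | p t.1 = t.2]].
Proof.
have dr := def_relA; have dVG := dmap_invg_of_mulg dmulG; have dVA := dmap_invg_of_mulg dmulA.
have dw := dmap_word dmulG n.
split; first split.
- exact: (@cod_dom _ _ _ _ (coded_prod (coded_pow 'I_m coG) coA)).
- move=> y; have [a [z ->]] := F_onto y.
  have [x cx ex] := @cod_surj _ _ _ _ (coded_prod (coded_pow 'I_m coG) coA) (z, a).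
  exists x => //.
  change (cover_map (cval (@cod _ _ _ _ (coded_prod (coded_pow 'I_m coG) coA)) x) = (i a * F z)%g).
  by rewrite ex.
- have h : def N (fun t : (('I_m -> G) * A) * (('I_m -> G) * A) => cover_map t.1 = cover_map t.2).
    apply: (def_iff (P := fun t => relA (t.1.1, (fun=> 1%g), t.2.1, (t.1.2^-1 * t.2.2)%g))).
      by move=> t; rewrite -cover_eq.
    by solve_def.
  exact: h.
- have h : def N (fun t : (('I_m -> G) * A) * (('I_m -> G) * A) * (('I_m -> G) * A) =>
      (cover_map t.1.1 * cover_map t.1.2)%g = cover_map t.2).
    apply: (def_iff (P := fun t => relA (t.1.1.1, t.1.2.1, t.2.1, ((t.1.1.2 * t.1.2.2)^-1 * t.2.2)%g))).
      by move=> t; rewrite -cover_mul.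
    by solve_def.
  exact: h.
- have h : def N (fun t : A * (('I_m -> G) * A) => i t.1 = cover_map t.2).
    apply: (def_iff (P := fun t => relA ((fun=> 1%g), (fun=> 1%g), t.2.1, (t.1^-1 * t.2.2)%g))).
      by move=> t; rewrite -(cover_eq ((fun=> 1%g), t.1)) /cover_map /= (word_lift1 ext) mulg1.
    by solve_def.
  exact: h.
- have h : def N (fun t : (('I_m -> G) * A) * G => p (cover_map t.1) = t.2).
    apply: (def_iff (P := fun t => word t.1.1 = t.2)).
      by move=> t; rewrite /cover_map p_morph (p_i ext) mul1g (p_word_lift ext).
    by solve_def.
  exact: h.
Qed.

End Definable.

(** Applied in [M], where the level sets are analysed, and in the pure group language, as property
    rho demands. *)
Lemma def_word3 (S : Type) (U : S -> Type) (N : structure U) (coG : coded N G) :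
  dmap N (fun t : G * G => (t.1 * t.2)%g) -> def N [set z | word3 z = 1%g].
Proof.
move=> dmul; have dV := dmap_invg_of_mulg dmul; have dw := dmap_word dmul n.
have d1 : dmap N proj1of3 by rewrite /proj1of3; solve_dmap.
have d2 : dmap N proj2of3 by rewrite /proj2of3; solve_dmap.
have d3 : dmap N proj3of3 by rewrite /proj3of3; solve_dmap.
by rewrite /word3; solve_def.
Qed.

End Relation.

(** * A definable section *)

Section Ultrafilter.
Variables (R : realType) (M : structure1 R).
Hypothesis M_order : expansion (order_structure R) M.
Hypothesis M_ominimal : ominimal M.
Local Notation Rn := (Rn R).

(* L X is an ultrafilter of definable subsets of X, obtained uniformly from X
   by iterating the leftmost germ of a nonempty definable subset of the line. *)
Fixpoint leftmost n : set (Rn n) -> set (Rn n) -> Prop :=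
  if n is m.+1 then fun X Y => exists t1 : R, (exists x : Rn m, X (x, t1)) /\
    forall t, (exists x : Rn m, X (x, t)) -> t <= t1 ->
      leftmost (fun x : Rn m => X (x, t)) (fun x => Y (x, t))
  else fun X Y => X tt /\ Y tt.

Lemma def_leftmost n (T : Type) (cT : coded M T) (X Y : T -> Rn n -> Prop) :
  def M (fun t => X t.1 t.2) -> def M (fun t => Y t.1 t.2) ->
  def M (fun t => leftmost (X t) (Y t)).
Proof.
elim: n T cT X Y => [|n IH] T cT X Y dX dY /=; first by solve_def.
pose E : set (T * R) := fun t => exists x : Rn n, X t.1 (x, t.2).
pose L : set (T * R) := fun t => leftmost (fun x : Rn n => X t.1 (x, t.2)) (fun x => Y t.1 (x, t.2)).
have dE : def M E.
  refine (def_ex (P := fun t x => X t.1 (x, t.2)) _).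
  by refine (def_comp2 (P := X) (f := fun t => t.1.1) (g := fun t => (t.2, t.1.2)) dX _ _); solve_dmap.
have dL : def M L.
  apply: (IH _ _ (fun t x => X t.1 (x, t.2)) (fun t x => Y t.1 (x, t.2))).
    by refine (def_comp2 (P := X) (f := fun t => t.1.1) (g := fun t => (t.2, t.1.2)) dX _ _); solve_dmap.
  by refine (def_comp2 (P := Y) (f := fun t => t.1.1) (g := fun t => (t.2, t.1.2)) dY _ _); solve_dmap.
apply: (def_iff (P := fun t => exists t1, E (t, t1) /\ forall u, E (t, u) -> u <= t1 -> L (t, u))) => //.
by clearbody E L; solve_def.
Qed.

Lemma leftmost_total n (X Y : set (Rn n)) : def M X -> def M Y -> X !=set0 ->
  leftmost X Y \/ leftmost X (~` Y).
Proof.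
elim: n X Y => [|n IH] X Y dX dY [x Xx] /=.
  case: x Xx => Xx; have [Ytt|nY] := pselect (Y tt); [by left|by right].
have dX' : def M (X : set (Rn n * R)) by exact: dX.
have dY' : def M (Y : set (Rn n * R)) by exact: dY.
pose E : set R := [set t | exists x : Rn n, X (x, t)].
pose L : set R := [set t | leftmost (fun x : Rn n => X (x, t)) (fun x => Y (x, t))].
have dL : def M L by apply: def_leftmost; solve_def.
have [|t1 Et1 h] := convex_eventually (def_convex M_ominimal dL) (T := E).
  by exists x.2, x.1; case: x Xx.
case: h => h; [by left; exists t1; split=> // t Et tt1; exact: h|right].
exists t1; split=> // t Et tt1.
have d1 : def M (fun x : Rn n => X (x, t)) by solve_def.
have d2 : def M (fun x : Rn n => Y (x, t)) by solve_def.
by case: (IH _ _ d1 d2 Et) => // Lt; case: (h t Et tt1).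
Qed.

Lemma leftmostI n (X Y Y' : set (Rn n)) :
  leftmost X Y -> leftmost X Y' -> leftmost X (Y `&` Y').
Proof.
elim: n X Y Y' => [|n IH] X Y Y' /=; first by move=> [? ?] [].
move=> [t1 [E1 h1]] [t2 [E2 h2]]; exists (Num.min t1 t2); split; first by case: (leP t1 t2).
by move=> t Et; rewrite le_min => /andP[tt1 tt2]; apply: IH; [exact: h1|exact: h2].
Qed.

Lemma leftmost_ex n (X Y : set (Rn n)) : leftmost X Y -> exists x, X x /\ Y x.
Proof.
elim: n X Y => [|n IH] X Y /=; first by exists tt.
by move=> [t1 [E1 h1]]; have [x [Xx Yx]] := IH _ _ (h1 t1 E1 (lexx t1)); exists (x, t1).
Qed.

(** [L X] is required to decide only those [X] that meet [Z], so that a space can be treated piece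
    by piece. The first clause is uniform definability of the ultrafilters in parameters. *)
Definition has_ultrafilters (H : Type) (cH : coded M H) (Z : set H) :=
  def M Z /\ exists L : set H -> set H -> Prop,
  [/\ forall (T : Type) (cT : coded M T) (X Y : T -> H -> Prop),
        def M (fun t => X t.1 t.2) -> def M (fun t => Y t.1 t.2) -> def M (fun t => L (X t) (Y t)),
      forall X Y, def M X -> def M Y -> X `&` Z !=set0 -> L X Y \/ L X (~` Y),
      forall X Y Y', L X Y -> L X Y' -> L X (Y `&` Y') &
      forall X Y, L X Y -> X `&` Y !=set0].

(** The leftmost ultrafilter is pushed forward along each parametrization. On a union the first
    piece is used if [X] meets it, a condition that is itself definable, and the second piece
    otherwise. *)
Lemma parametrized_ultrafilters (H : topologicalType) (cH : coded M H) :
  parametrized H -> has_ultrafilters cH setT.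
Proof.
rewrite /parametrized; elim=> [|_ [m [Y0 [e [dY de ce ->]]]]|P Q _ [dP [L [dL tL iL eL]]] _ [dQ [L' [dL' tL' iL' eL']]]].
- split; first exact: def_cst.
  exists (fun _ _ => False); split=> //; first by move=> *; exact: def_cst.
  by move=> X Y _ _ [x []].
- split; first by rewrite /image; solve_def.
  exists (fun X Y => leftmost [set y | Y0 y /\ X (e y)] [set y | Y (e y)]); split.
  + move=> T cT X Y dX dY'; apply: (def_leftmost (X := fun t y => Y0 y /\ X t (e y)) (Y := fun t y => Y t (e y))).
      by solve_def.
    by refine (def_comp2 (P := Y) (f := fun t => t.1) (g := fun t => e t.2) dY' _ _); solve_dmap.
  + move=> X Y dX dY' [h [Xh [y Y0y eh]]]; rewrite -eh in Xh.
    apply: (leftmost_total (X := [set y | Y0 y /\ X (e y)]) (Y := [set y | Y (e y)])); [by solve_def|by solve_def|].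
    by exists y.
  + by move=> X Y Y'; exact: leftmostI.
  + by move=> X Y /leftmost_ex [y [[_ Xy] Yy]]; exists (e y).
- split; first by solve_def.
  exists (fun X Y => (X `&` P !=set0 /\ L X Y) \/ (~ (X `&` P !=set0) /\ L' X Y)); split.
  + move=> T cT X Y dX dY.
    have d1 : def M (fun t => X t `&` P !=set0).
      by refine (def_ex (P := fun t h => X t h /\ P h) _); solve_def.
    apply: def_or; apply: def_and => //; [exact: dL|exact: def_not|exact: dL'].
  + move=> X Y dX dY [x [Xx PQx]].
    have [h|h] := pselect (X `&` P !=set0).
      by case: (tL X Y dX dY h) => ?; [left|right]; left.
    have ne : X `&` Q !=set0.
      by exists x; split=> //; case: PQx => // Px; case: h; exists x.
    by case: (tL' X Y dX dY ne) => ?; [left|right]; right.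
  + move=> X Y Y' [[h l]|[h l]] [[h' l']|[h' l']] //; [left|right]; split=> //; [exact: iL|exact: iL'].
  + by move=> X Y [[_ /eL]|[_ /eL']].
Qed.

End Ultrafilter.

Lemma definable_group_charts (R : realType) (M : structure1 R) (H : topologicalGroupType)
    (c : coding1 R H) (hc : definable_group M c) : ominimal_topology M c (@open H) ->
  exists k m (D : 'I_m -> set H) (ch : 'I_m -> H -> Rn R k) e,
    (forall h, exists j, D j h) /\ forall j, is_chart (coded_group hc.1) (D j) (ch j) (e j).
Proof.
move=> [_ [k [m [D [phi [cov hD]]]]]].
have /choice [u hu] : forall j, exists u : (H -> Rn R k) * (Rn R k -> H),
    is_chart (coded_group hc.1) (D j) u.1 u.2.
  move=> j; have [oD inj dphi hV] := hD j.
  by have [ch [e [h _]]] := chart_exists (cH := coded_group hc.1) 1%g oD inj dphi hV; exists (ch, e).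
by exists k, m, D, (fun j => (u j).1), (fun j => (u j).2).
Qed.

Section Setting.
Variables (R : realType) (M : structure1 R).
Hypothesis M_order : expansion (order_structure R) M.
Hypothesis M_ominimal : ominimal M.
Variables (G A Gt : topologicalGroupType) (i : A -> Gt) (p : Gt -> G).
Hypothesis ext : topological_central_extension i p.
Hypothesis E_finite : forall n : nat, finite_set (range i `&` commutator_products Gt n).
Variables (coG : coded M G) (coA : coded M A).
Hypothesis dmulG : dmap M (fun t : G * G => (t.1 * t.2)%g).
Hypothesis dmulA : dmap M (fun t : A * A => (t.1 * t.2)%g).
Hypothesis G_parametrized : parametrized G.
Variable n : nat.
Local Notation m := (n + n)%N.
Local Notation F := (@word_lift _ _ _ _ _ ext n).
Hypothesis F_onto : forall y : Gt, exists a z, y = (i a * F z)%g.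
Hypothesis def_level3 : forall v, def M (level3 ext (n := n) v).

Let p_morph : {morph p : x y / (x * y)%g}. Proof. by case: ext => [[]]. Qed.
Let i_inj : injective i. Proof. by case: ext => [[]]. Qed.
Let dVG := dmap_invg_of_mulg dmulG.
Let dVA := dmap_invg_of_mulg dmulA.
Let dw := dmap_word dmulG n.
Let dr := def_relA E_finite coA def_level3.

Lemma word_onto g : exists z : 'I_m -> G, word z = g.
Proof.
have [a [z e]] := F_onto (lift ext g); exists z.
by rewrite -(p_word_lift ext) -(liftK ext g) e p_morph (p_i ext) mul1g.
Qed.

(* M need not have definable choice. The values of F on the words representing g
   are finite in number, so an ultrafilter on these words, definable uniformly
   in g, concentrates on exactly one of them. *)
Lemma definable_section : exists s : G -> Gt, (forall g, exists z, word z = g /\ F z = s g) /\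
  def M (fun t : ('I_m -> G) * G => word t.1 = t.2 /\ F t.1 = s t.2).
Proof.
have [_ [L [dL tL iL eL]]] := parametrized_ultrafilters M_order M_ominimal (parametrized_ptws m 1%g G_parametrized).
pose X (g : G) : set ('I_m -> G) := [set z | word z = g].
pose Y (z : 'I_m -> G) : set ('I_m -> G) := [set z' | F z' = F z].
have YE z z' : Y z z' <-> relA ext (z', (fun=> 1%g), z, 1%g).
  by rewrite /Y /relA /= (word_lift1 ext) mulg1 (i1 ext) mul1g.
have dY : def M (fun t : ('I_m -> G) * ('I_m -> G) => Y t.1 t.2).
  apply: (def_iff (P := fun t => relA ext (t.2, (fun=> 1%g), t.1, 1%g))); last by solve_def.
  by move=> t; rewrite YE.
have dX g : def M (X g) by rewrite /X; solve_def.
have ex g : exists z, X g z /\ L (X g) (Y z).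
  have [z1 Xz1] := word_onto g.
  have /finite_seqP [l hl] := finite_kernel ext E_finite (n + n + n).
  pose Z a : set ('I_m -> G) := [set z | F z = (i a * F z1)%g].
  have dZ a : def M (Z a).
    apply: (def_iff (P := fun z => relA ext (z, (fun=> 1%g), z1, a))); last by solve_def.
    by move=> z; rewrite /Z /relA /= (word_lift1 ext) mulg1.
  have cov z : X g z -> exists2 a, a \in l & Z a z.
    move=> Xz; have [a ea] : exists a, F z = (i a * F z1)%g.
      by apply: (same_image ext); rewrite !(p_word_lift ext) Xz.
    exists a => //; have : [set a | commutator_products Gt (n + n + n) (i a)] a; last by rewrite hl.
    by apply: (@rel3_commutator _ _ _ _ _ ext _ a (z, (fun=> 1%g), z1)); rewrite /rel3 /= (word_lift1 ext) mulg1.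
  have Xne : X g `&` setT !=set0 by exists z1.
  (* The finitely many sets [Z a] cover the words representing g. If all were rejected, the
     intersection of their complements would be accepted, hence would contain such a word. *)
  have [a Za] : exists a, L (X g) (Z a).
    apply: contrapT => nZ.
    have hall (l' : seq A) : L (X g) [set z | forall a, a \in l' -> ~ Z a z].
      elim: l' => [|a l' IH].
        case: (tL (X g) setT (dX g) (def_cst _) Xne) => h.
          by rewrite (_ : [set z | _] = setT) //; apply/seteqP; split.
        by have [z [_ []]] := eL _ _ h.
      have [h|h] := tL (X g) (Z a) (dX g) (dZ a) Xne; first by case: nZ; exists a.
      rewrite (_ : [set z | _] = ~` Z a `&` [set z | forall a, a \in l' -> ~ Z a z]); first exact: iL.
      apply/seteqP; split=> z.
        by move=> hz; split=> [|b bl]; apply: hz; rewrite inE ?eqxx ?bl ?orbT.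
      by move=> [h1 h2] b; rewrite inE => /predU1P[->|/h2].
    have [z [Xz hz]] := eL _ _ (hall l); have [a al Zaz] := cov z Xz.
    exact: hz al Zaz.
  have [z [Xz Zz]] := eL _ _ Za; exists z; split=> //.
  rewrite (_ : Y z = Z a) //; apply/seteqP; split=> z' h; rewrite /Y /Z /=.
    by rewrite (h : F z' = F z) (Zz : F z = _).
  by rewrite (h : F z' = _) (Zz : F z = _).
(* The word [z0 g] is chosen outside [M], but F(z0 g) does not depend on the choice: two accepted
   values share a word, by intersecting their fibres. Thus F z = s g exactly when the ultrafilter
   accepts the fibre of F through z. *)
have [z0 hz0] := choice ex; exists (fun g => F (z0 g)); split.
  by move=> g; exists (z0 g); case: (hz0 g).
have dXX : def M (fun t : (('I_m -> G) * G) * ('I_m -> G) => word t.2 = t.1.2) by solve_def.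
have dYY : def M (fun t : (('I_m -> G) * G) * ('I_m -> G) => Y t.1.1 t.2).
  by refine (def_comp2 (P := Y) (f := fun t => t.1.1) (g := fun t => t.2) dY _ _); solve_dmap.
have dLL := dL _ _ (fun t : ('I_m -> G) * G => X t.2) (fun t => Y t.1) dXX dYY.
have dWW : def M (fun t : ('I_m -> G) * G => word t.1 = t.2) by solve_def.
apply: def_iff (def_and dWW dLL) => -[z g] /=; split=> [[wz Lz]|[wz e]]; split=> //.
  have [_ L0] := hz0 g; have [z' [_ [h1 h2]]] := eL _ _ (iL _ _ _ Lz L0).
  by rewrite -(h1 : F z' = F z) (h2 : F z' = F (z0 g)).
have [_ L0] := hz0 g; rewrite (_ : Y z = Y (z0 g)) //.
by rewrite /Y e.
Qed.

(** * The injective coding of the extension by A x G *)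

Section Coding.
Variable s : G -> Gt.
Hypothesis s_lift : forall g, exists z, word z = g /\ F z = s g.
Hypothesis def_s : def M (fun t : ('I_m -> G) * G => word t.1 = t.2 /\ F t.1 = s t.2).

Lemma p_s g : p (s g) = g.
Proof. by have [z [<- <-]] := s_lift g; rewrite (p_word_lift ext). Qed.

Definition section_map (t : A * G) : Gt := (i t.1 * s t.2)%g.

Lemma section_map_inj : injective section_map.
Proof.
move=> [a g] [b h] e; have eg : g = h.
  have := congr1 p e; rewrite /section_map !p_morph !(p_i ext) !mul1g !p_s; exact.
by move: e; rewrite /section_map eg /= => /mulIg /i_inj ->.
Qed.

Definition section_coding : coding1 R Gt :=
  coding_map section_map (@cod _ _ _ _ (coded_prod coA coG)).

Let relS : set (('I_m -> G) * G) := fun t => word t.1 = t.2 /\ F t.1 = s t.2.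
Let dS : def M relS. Proof. exact: def_s. Qed.

Lemma section_surj y : exists t, section_map t = y.
Proof.
have [a ea] : exists a, y = (i a * s (p y))%g by apply: (same_image ext); rewrite p_s.
by exists (a, p y).
Qed.

Lemma section_interpretable : interpretable_group M section_coding.
Proof.
split.
- exact: (@cod_dom _ _ _ _ (coded_prod coA coG)).
- move=> y; have [t <-] := section_surj y.
  have [x cx ex] := @cod_surj _ _ _ _ (coded_prod coA coG) t.
  exists x => //; change (section_map (cval (@cod _ _ _ _ (coded_prod coA coG)) x) = section_map t).
  by rewrite ex.
- have h : def M (fun t : (A * G) * (A * G) => section_map t.1 = section_map t.2).
    apply: (def_iff (P := fun t => t.1 = t.2)); last by solve_def.
    by move=> t; split=> [->|/section_map_inj].
  exact: h.
- have h : def M (fun t : (A * G) * (A * G) * (A * G) => (section_map t.1.1 * section_map t.1.2)%g = section_map t.2).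
    (* The values of [s] enter through words that represent them, so that the product becomes an
       instance of [relA]. *)
    apply: (def_iff (P := fun t => exists z1 z2 z3, relS (z1, t.1.1.2) /\ relS (z2, t.1.2.2) /\ relS (z3, t.2.2) /\
       relA ext (z1, z2, z3, ((t.1.1.1 * t.1.2.1)^-1 * t.2.1)%g))); last by clear s_lift; clearbody relS; solve_def.
    move=> [[[a g] [b h]] [c' k]] /=.
    have [z1 [w1 e1]] := s_lift g; have [z2 [w2 e2]] := s_lift h; have [z3 [w3 e3]] := s_lift k.
    have key u1 u2 u3 : F u1 = s g -> F u2 = s h -> F u3 = s k ->
        relA ext (u1, u2, u3, ((a * b)^-1 * c')%g) <-> (i a * s g * (i b * s h))%g = (i c' * s k)%g.
      move=> f1 f2 f3; rewrite -(cover_mul ext (u1, a) (u2, b) (u3, c')).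
      by rewrite /cover_map /= f1 f2 f3.
    split=> [[u1 [u2 [u3 [[_ f1] [[_ f2] [[_ f3] r]]]]]]|r]; first exact/(key u1 u2 u3).
    by exists z1, z2, z3; do 3 (split; first by []); apply/key.
  exact: h.
Qed.

Let coGt : coded M Gt := coded_group section_interpretable.

Lemma set_inj_section : set_inj (cdom (@cod _ _ _ _ coA)) (cval (@cod _ _ _ _ coA)) ->
  set_inj (cdom (@cod _ _ _ _ coG)) (cval (@cod _ _ _ _ coG)) ->
  set_inj (cdom section_coding) (cval section_coding).
Proof.
move=> hA hG x y; rewrite !inE => -[xA xG] [yA yG] /section_map_inj [eA eG].
have {}eA : (fun s0 i0 => x s0 (inl i0)) = (fun s0 i0 => y s0 (inl i0)) by apply: hA; rewrite ?inE.
have {}eG : (fun s0 i0 => x s0 (inr i0)) = (fun s0 i0 => y s0 (inr i0)) by apply: hG; rewrite ?inE.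
apply: functional_extensionality_dep => s0; apply/funext => -[j|j].
  exact: (congr1 (fun f => f s0 j) eA).
exact: (congr1 (fun f => f s0 j) eG).
Qed.

Lemma dmap_i : dmap M (cT' := coGt) i.
Proof.
have h : def M (fun t : A * (A * G) => i t.1 = section_map t.2).
  apply: (def_iff (P := fun t => exists z, relS (z, t.2.2) /\ relA ext ((fun=> 1%g), (fun=> 1%g), z, (t.1^-1 * t.2.1)%g))).
    move=> [a [b g]] /=; have [z [w e]] := s_lift g.
    have key u : F u = s g -> relA ext ((fun=> 1%g), (fun=> 1%g), u, (a^-1 * b)%g) <-> i a = section_map (b, g).
      by move=> f; rewrite -(cover_eq ext ((fun=> 1%g), a) (u, b)) /cover_map /section_map /= (word_lift1 ext) mulg1 f.
    by split=> [[u [[_ f] /key]]|r]; [exact|exists z; split=> //; apply/key].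
  by clear coGt s_lift; clearbody relS; solve_def.
exact: h.
Qed.

Lemma dmap_p : dmap M (cT := coGt) p.
Proof.
have h : def M (fun t : (A * G) * G => p (section_map t.1) = t.2).
  apply: (def_iff (P := fun t => t.1.2 = t.2)); last by solve_def.
  by move=> [[a g] h] /=; rewrite /section_map p_morph (p_i ext) mul1g p_s.
exact: h.
Qed.

Lemma dmap_word_lift : dmap M (cT' := coGt) F.
Proof.
have h : def M (fun t : ('I_m -> G) * (A * G) => F t.1 = section_map t.2).
  apply: (def_iff (P := fun t => exists z, relS (z, t.2.2) /\ relA ext (t.1, (fun=> 1%g), z, t.2.1))).
    move=> [z' [b g]] /=; have [z [w e]] := s_lift g.
    have key u : F u = s g -> relA ext (z', (fun=> 1%g), u, b) <-> F z' = section_map (b, g).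
      by move=> f; rewrite /relA /section_map /= (word_lift1 ext) mulg1 f.
    by split=> [[u [[_ f] /key]]|r]; [exact|exists z; split=> //; apply/key].
  by clear coGt s_lift; clearbody relS; solve_def.
exact: h.
Qed.

Lemma dmap_s : dmap M (cT' := coGt) s.
Proof.
have h : def M (fun t : G * (A * G) => s t.1 = section_map t.2).
  apply: (def_iff (P := fun t => t.1 = t.2.2 /\ t.2.1 = 1%g)); last by solve_def.
  move=> [g [a h]] /=; split=> [[-> ->]|]; first by rewrite /section_map (i1 ext) mul1g.
  rewrite -[X in X = _]mul1g -(i1 ext) => /(@section_map_inj (1%g, g) (a, h)) [-> ->]; by [].
exact: h.
Qed.

End Coding.
End Setting.

(** * The topology of the extension *)

Section LocalSections.
Variables (R : realType) (M : structure1 R).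
Hypothesis M_order : expansion (order_structure R) M.
Hypothesis M_ominimal : ominimal M.
Variables (G A Gt : topologicalGroupType) (i : A -> Gt) (p : Gt -> G).
Hypothesis ext : topological_central_extension i p.
Hypothesis E_finite : forall n : nat, finite_set (range i `&` commutator_products Gt n).
Variables (coG : coded M G) (coGt : coded M Gt).
Hypothesis dmulG : dmap M (fun t : G * G => (t.1 * t.2)%g).
Hypothesis dmulGt : dmap M (fun t : Gt * Gt => (t.1 * t.2)%g).
Variable n : nat.
Local Notation m := (n + n)%N.
Local Notation F := (@word_lift _ _ _ _ _ ext n).
Hypothesis dF : dmap M F.
Variables (k l : nat) (D : 'I_l -> set G) (ch : 'I_l -> G -> Rn R k) (e : 'I_l -> Rn R k -> G).
Hypothesis D_cover : forall g, exists j, D j g.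
Hypothesis D_chart : forall j, is_chart coG (D j) (ch j) (e j).
Variable s : G -> Gt.
Hypothesis s_lift : forall g, exists z, word z = g /\ F z = s g.
Hypothesis ds : dmap M s.

Let p_morph : {morph p : x y / (x * y)%g}. Proof. by case: ext => [[]]. Qed.
Let dVG : dmap M (@monoid.inv G) := dmap_invg_of_mulg dmulG.
Let dVGt : dmap M (@monoid.inv Gt) := dmap_invg_of_mulg dmulGt.
Let dw : dmap M (@word G n) := dmap_word dmulG n.

Let ps g : p (s g) = g. Proof. exact: p_s s_lift g. Qed.

Let s_commutator g : commutator_products Gt n (s g).
Proof. by have [z [_ <-]] := s_lift g; exact: word_lift_commutator. Qed.

Definition section_over (N : set G) (tau : G -> Gt) :=
  [/\ open N, def M N, dmap M tau, cont_in N tau & forall x, N x -> p (tau x) = x].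

(** The words representing a point of a chart form a definable family over an open set; a continuous
    selection exists over some open part of it, possibly far from 1. *)
Lemma section_germ : exists B sigma, [/\ section_over B sigma, B 1%g, sigma 1%g = 1%g &
  forall b, commutator_products Gt m (sigma b)].
Proof.
have [j Dj] := D_cover 1%g; have [oD [dD dch de] eK oE [cch ce]] := D_chart j.
have pG := parametrized_charts D_cover D_chart.
have psel := parametrized_selectable M_order M_ominimal (parametrized_ptws m 1%g pG).
have nt : ~ thin [set x | exists z : {ptws 'I_m -> G}, (ch j @` D j) x /\ word z = e j x].
  apply/thinN; exists (ch j 1%g).
  have : nbhs (ch j 1%g) (ch j @` D j) by apply: open_nbhs_nbhs; split=> //; exists 1%g.
  apply: filterS => x [g Dg <-]; have [z [wz _]] := s_lift (e j (ch j g)).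
  by exists z; split=> //; exists g.
have dX : def M (fun t : Rn R k * {ptws 'I_m -> G} => (ch j @` D j) t.1 /\ word t.2 = e j t.1).
  by rewrite /image; solve_def.
have [U [t [[u0 Uu0] oU dU [dt ct] tX]]] := psel _ _ dX nt.
have {tX} [UD wt] : U `<=` ch j @` D j /\ forall x, U x -> word (t x) = e j x.
  by split=> x /tX [].
have [g0 Dg0 eg0] := UD _ Uu0.
pose V : set G := [set g | D j g /\ U (ch j g)].
pose sig0 g : Gt := F (t (ch j g)).
have dV : def M V by rewrite /V; solve_def.
have oV : open V.
  rewrite openE => g [Dg Ug]; have := cch g Dg U (open_nbhs_nbhs (conj oU Ug)).
  have : nbhs g (D j) by exact: open_nbhs_nbhs.
  by apply: filterS2 => g' Dg' /(_ Dg').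
have cs : cont_in V sig0.
  apply: (cont_in_comp (V := setT) (g := F) (f := fun g => t (ch j g) : {ptws 'I_m -> G})) => //.
    apply: (cont_in_comp (V := U) (f := ch j) (g := t)) => //; last by move=> g [].
    by move=> g [Dg _] P /(cch g Dg); apply: filterS => g' h [/h].
  by apply: continuous_cont_in; exact: continuous_word_lift.
have psig g : V g -> p (sig0 g) = g by move=> [Dg Ug]; rewrite /sig0 (p_word_lift ext) wt // eK.
have Vg0 : V g0 by split; rewrite ?eg0.
have dsig : dmap M sig0 by rewrite /sig0; solve_dmap.
(* Translation by [g0] moves the selection to 1 and division by its value there gives the value 1.
   Both factors are values of F, hence the length 2n, valid for every [b] and not only on [B]. *)
exists [set b | V (g0 * b)%g], (fun b => (sig0 g0)^-1 * sig0 (g0 * b))%g; split.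
- have cm : cont_in setT (fun b : G => (g0 * b)%g).
    by apply: cont_in_mulg; [exact: cont_in_cst|exact: cont_in_id].
  have ob : open [set b | V (g0 * b)%g].
    rewrite openE => b Vb; have := cm b I V (open_nbhs_nbhs (conj oV Vb)).
    by apply: filterS => b' /(_ I).
  split=> //.
  + by solve_def.
  + by solve_dmap.
  + apply: cont_in_mulg; first exact: cont_in_cst.
    by apply: (cont_in_comp (V := V) (g := sig0)) => // b _ P /(cm b I); apply: filterS => b' /(_ I).
  + by move=> b Vb; rewrite p_morph (pV ext) !psig // mulKg.
- by rewrite /= mulg1.
- by rewrite mulg1 mulVg.
- by move=> b; apply: commutator_productsM; [apply: commutator_productsV|]; exact: word_lift_commutator.
Qed.

Section Stratum.
Variables (B : set G) (sg : G -> Gt).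
Hypothesis sgB : section_over B sg.
Hypothesis B1 : B 1%g.
Hypothesis sg1 : sg 1%g = 1%g.
Hypothesis sg_commutator : forall b, commutator_products Gt m (sg b).
Variables (d : nat) (E : set G) (Y : set (Rn R d)) (psi : Rn R d -> G) (rho : G -> Rn R d).
Hypothesis oE : open E.
Hypothesis dE : def M E.
Hypothesis dY : def M Y.
Hypothesis dpsi : dmap M psi.
Hypothesis cpsi : cont_in Y psi.
Hypothesis drho : dmap M rho.
Hypothesis crho : cont_in E rho.
Hypothesis psiE : forall y, Y y -> E (psi y).
Hypothesis rho_psi : forall y, Y y -> rho (psi y) = y.

(* Near psi y, the section s follows the translate of the germ sg. *)
Let adapted (y : Rn R d) := nbhs y (fun y' => [/\ Y y', B ((psi y)^-1 * psi y')%g &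
  s (psi y') = s (psi y) * sg ((psi y)^-1 * psi y')]%g).
(** Taking the interior makes [O] open, and along [O] the section [s] is continuous because the germ
    is. *)
Let O : set (Rn R d) := [set y | nbhs y adapted].

Let dB : def M B. Proof. by case: sgB. Qed.
Let dsg : dmap M sg. Proof. by case: sgB. Qed.
Let csg : cont_in B sg. Proof. by case: sgB. Qed.
Let psg b : B b -> p (sg b) = b. Proof. by case: sgB => _ _ _ _; apply. Qed.

Let dadapted : def M adapted.
Proof.
by refine (def_nbhs M_order (P := fun y y' => [/\ _, _ & _]) (f := id) _ _);
  [solve_dmap|apply: (def_iff (P := fun t => Y t.2 /\ B ((psi t.1)^-1 * psi t.2)%g /\
  s (psi t.2) = (s (psi t.1) * sg ((psi t.1)^-1 * psi t.2))%g)); [move=> t; split; [move=> [? []]|case]|solve_def]].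
Qed.

Lemma def_stratum : def M O.
Proof. by apply: (def_nbhs M_order (f := id)); [exact: dmap_id|have := dadapted => ?; solve_def]. Qed.

Let OA y : O y -> adapted y. Proof. exact: nbhs_singleton. Qed.
Let OY : O `<=` Y. Proof. by move=> y /OA /nbhs_singleton []. Qed.
Let open_O : open O. Proof. exact: open_interior. Qed.

Let cont_mulVg (T : topologicalType) (W : set T) (f : T -> G) g : cont_in W f -> cont_in W (fun x => g^-1 * f x)%g.
Proof. by move=> cf; apply: cont_in_mulg => //; exact: cont_in_cst. Qed.

Let cont_s : cont_in O (fun y => s (psi y)).
Proof.
move=> y Oy P hP; have Ay := OA Oy.
have c : cont_in [set y' | Y y' /\ B ((psi y)^-1 * psi y')%g]
    (fun y' => s (psi y) * sg ((psi y)^-1 * psi y'))%g.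
  apply: cont_in_mulg; first exact: cont_in_cst.
  apply: (cont_in_comp (V := B) (g := sg)) => //; last by move=> x [].
  by apply: cont_mulVg => x [Yx _] Q /(cpsi Yx); apply: filterS => x' h [/h].
have := c y; rewrite /= mulVg sg1 mulg1 => /(_ (conj (OY Oy) B1) P hP).
by apply: filterS2 Ay => y' [Yy' By' ->] h _; exact: h.
Qed.

(** To extend [s] from the stratum to an open set, a point x is retracted to psi (rho x), where [s]
    is continuous, and the germ is followed from there to x. *)
Lemma stratum_section : exists N tau, section_over N tau /\ psi @` O `<=` N.
Proof.
have dO := def_stratum.
exists [set x | [/\ E x, O (rho x) & B ((psi (rho x))^-1 * x)%g]],
  (fun x => s (psi (rho x)) * sg ((psi (rho x))^-1 * x))%g.
pose N1 : set G := [set x | E x /\ O (rho x)].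
have cr : cont_in N1 rho by move=> x [Ex _] P /(crho Ex); apply: filterS => x' h [/h].
have cpr : cont_in N1 (fun x => psi (rho x)).
  by apply: (cont_in_comp cr cpsi) => x [_ /OY].
have cb : cont_in N1 (fun x => (psi (rho x))^-1 * x)%g.
  by apply: cont_in_mulg; [exact: cont_in_invg|exact: cont_in_id].
have oN1 x : N1 x -> nbhs x N1.
  move=> [Ex Ox]; have := crho Ex (open_nbhs_nbhs (conj open_O Ox)).
  by have := open_nbhs_nbhs (conj oE Ex); apply: filterS2 => x' Ex' h; split=> //; exact: h.
split; first split.
- rewrite openE => x [Ex Ox Bx]; have [oB _ _ _ _] := sgB.
  have := cb x (conj Ex Ox) _ (open_nbhs_nbhs (conj oB Bx)).
  by have := oN1 x (conj Ex Ox); apply: filterS2 => x' [Ex' Ox'] h; split=> //; exact: h.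
- apply: (def_iff (P := fun x => E x /\ O (rho x) /\ B ((psi (rho x))^-1 * x)%g)); last by solve_def.
  by move=> x; split; [move=> [? []]|case].
- by solve_dmap.
- apply: cont_in_mulg.
    apply: (cont_in_comp (V := O)) cont_s _; last by move=> x [].
    by move=> x [Ex Ox _] P /(cr x (conj Ex Ox)); apply: filterS => x' h [Ex' Ox' _]; exact: h.
  apply: (cont_in_comp (V := B) (g := sg)) => //; last by move=> x [].
  by move=> x [Ex Ox _] P /(cb x (conj Ex Ox)); apply: filterS => x' h [Ex' Ox' _]; exact: h.
- by move=> x [Ex Ox Bx]; rewrite p_morph ps psg // mulVKg.
- move=> _ [y Oy <-]; have Yy := OY Oy; split=> //; first exact: psiE.
    by rewrite rho_psi.
  by rewrite rho_psi // mulVg.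
Qed.

(** Were there an open set of points outside [O], near one of them, [y0], the section [s] would
    differ from the translate of the germ at [y0] by one of finitely many elements of A. On a
    smaller open set [W2] this element is constant, so [s] is continuous along [W2]. Comparing [s]
    with the germ translated to any point of [W2] then gives a continuous difference with finitely
    many values, equal to 1 at that point and hence near it: all of [W2] is adapted. *)
Lemma thin_stratum : thin (Y `\` O).
Proof.
have dO := def_stratum; apply: contrapT => /thinN [y0 hy0].
have [W [oW dW Wy0 WY]] := open_box M_order hy0.
have [oB _ _ _ _] := sgB.
pose W1 : set (Rn R d) := [set y | W y /\ B ((psi y0)^-1 * psi y)%g].
have W1y0 : nbhs y0 W1.
  have Yy0 := (WY _ Wy0).1.
  have B1' : B ((psi y0)^-1 * psi y0)%g by rewrite mulVg.
  have := cont_mulVg (g := psi y0) cpsi Yy0 (open_nbhs_nbhs (conj oB B1')).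
  by have := open_nbhs_nbhs (conj oW Wy0); apply: filterS2 => y Wy h; split=> //; apply: h; exact: (WY _ Wy).1.
pose lft y y' := (s (psi y) * sg ((psi y)^-1 * psi y'))%g.
have plft y y' : B ((psi y)^-1 * psi y')%g -> p (lft y y') = psi y'.
  by move=> By; rewrite /lft p_morph ps psg // mulVKg.
(* The length is n for s (psi y'), 2n for the inverse of the germ and n for the inverse of s (psi
   y). *)
have diff y y' : B ((psi y)^-1 * psi y')%g -> exists2 a, s (psi y') = (i a * lft y y')%g &
    commutator_products Gt (n + (m + n)) (i a).
  move=> By; have [|a ea] := same_image ext (x := s (psi y')) (y := lft y y'); first by rewrite ps plft.
  exists a => //; have -> : i a = (s (psi y') * (lft y y')^-1)%g by rewrite ea mulgK.
  rewrite /lft invgM; apply: commutator_productsM; first exact: s_commutator.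
  by apply: commutator_productsM; apply: commutator_productsV; [exact: sg_commutator|exact: s_commutator].
have /finite_seqP [q hq] := finite_kernel ext E_finite (n + (m + n)).
pose Z a : set (Rn R d) := [set y | W1 y /\ s (psi y) = (i a * lft y0 y)%g].
have W1Z : W1 = [set y | exists2 j, (j < size q)%N & Z (nth 1%g q j) y].
  apply/seteqP; split=> [y [Wy By]|y [j _ []]] //.
  have [a ea ca] := diff _ _ By; have aq : a \in q.
    by have : [set a | commutator_products Gt (n + (m + n)) (i a)] a by []; rewrite hq.
  by exists (index a q); [rewrite index_mem|rewrite nth_index].
have fW1 : finite_union (fun P => exists a, P = Z a) W1.
  by rewrite W1Z; apply: finite_union_lt => j _; apply: finite_union1; exists (nth 1%g q j).
have nW1 : ~ thin W1 by apply/thinN; exists y0.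
have [|_ [a ->] [/thinN [y hy] _]] := finite_union_thin M_order M_ominimal fW1 _ nW1.
  by move=> _ [a ->]; rewrite /Z /W1 /lft; solve_def.
have [W2 [oW2 _ W2y W2Z]] := open_box M_order hy.
have W2Y : W2 `<=` Y by move=> x /W2Z [[/WY []]].
have clft x : W2 x -> cont_in [set x' | Y x' /\ B ((psi x)^-1 * psi x')%g] (lft x).
  move=> W2x; apply: cont_in_mulg; first exact: cont_in_cst.
  apply: (cont_in_comp (V := B) (g := sg)) => //; last by move=> x' [].
  by apply: cont_mulVg => x' [Yx _] Q /(cpsi Yx); apply: filterS => x2 h [/h].
have cs : cont_in W2 (fun x => s (psi x)).
  move=> x W2x P; rewrite (W2Z _ W2x).2 => hP.
  have [[Wx Bx] _] := W2Z _ W2x.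
  have c0 : cont_in W2 (fun x => i a * lft y0 x)%g.
    apply: cont_in_mulg; first exact: cont_in_cst.
    apply: cont_in_mulg; first exact: cont_in_cst.
    apply: (cont_in_comp (V := B) (g := sg)) => //; last by move=> x' /W2Z [[]].
    by apply: cont_mulVg => x' /W2Y Yx Q /(cpsi Yx); apply: filterS => x2 h /W2Y.
  by apply: filterS (c0 x W2x P hP) => x' h W2x'; rewrite (W2Z _ W2x').2; exact: h.
have W2A x : W2 x -> adapted x.
  move=> W2x; have Yx := W2Y _ W2x.
  have Bx : B ((psi x)^-1 * psi x)%g by rewrite mulVg.
  have hB : nbhs x (fun x' => Y x' -> B ((psi x)^-1 * psi x')%g).
    exact: (cont_mulVg (g := psi x) cpsi Yx (open_nbhs_nbhs (conj oB Bx))).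
  have c1 : cont_in [set x' | W2 x' /\ B ((psi x)^-1 * psi x')%g] (fun x' => s (psi x') * (lft x x')^-1)%g.
    apply: cont_in_mulg; first by move=> x' [W2x' _] P /(cs _ W2x'); apply: filterS => x2 h [/h].
    apply: cont_in_invg => x' [W2x' Bx'] P /(clft x W2x x' (conj (W2Y _ W2x') Bx')).
    by apply: filterS => x2 h [/W2Y Yx2 Bx2]; exact: h.
  (* At x' = x the difference is 1, and 1 is isolated in the finite set of its possible values. *)
  have := c1 x (conj W2x Bx); rewrite /= /lft mulVg sg1 mulg1 mulgV.
  move=> /(_ _ (finite_isolated 1%g (Gt_hausdorff ext) (E_finite (n + (m + n))))).
  move=> hI; apply: filterS3 hB (open_nbhs_nbhs (conj oW2 W2x)) hI => x' hB' W2x' h.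
  have Bx' : B ((psi x)^-1 * psi x')%g by apply: hB'; exact: W2Y.
  split; [exact: W2Y|by []|].
  have [a' ea' ca'] := diff _ _ Bx'.
  have : (s (psi x') * (lft x x')^-1)%g = 1%g.
    apply: h => //; split; first by exists a' => //; rewrite ea' mulgK.
    by rewrite ea' mulgK.
  by move=> /(canRL (mulgVK _)); rewrite mul1g.
have [_ nO] := WY _ (W2Z _ W2y).1.1; apply: nO.
have := open_nbhs_nbhs (conj oW2 W2y); rewrite /O /=; exact: filterS.
Qed.

Lemma stratum_exists : exists O' : set (Rn R d), [/\ def M O', O' `<=` Y, thin (Y `\` O') &
  exists N tau, section_over N tau /\ psi @` O' `<=` N].
Proof. by exists O; split; [exact: def_stratum|exact: OY|exact: thin_stratum|exact: stratum_section]. Qed.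

End Stratum.

(** Each stratum loses a thin set, which decomposes into retract images from one dimension lower;
    these are strata again, and in dimension 0 nothing is left over. *)
Lemma finite_section_cover : finite_union (fun P => exists N tau, section_over N tau /\ P `<=` N) [set: G].
Proof.
have [B [sg [sgB B1 sg1 cpsg]]] := section_germ.
set C := (C in finite_union C _).
have step d (E : set G) (Y : set (Rn R d)) (psi : Rn R d -> G) (rho : G -> Rn R d) :
    open E -> def M E -> def M Y -> dmap M psi -> cont_in Y psi -> dmap M rho -> cont_in E rho ->
    (forall y, Y y -> E (psi y) /\ rho (psi y) = y) -> exists O, [/\ def M (Y `\` O), thin (Y `\` O) &
    finite_union C (psi @` (Y `\` O)) -> finite_union C (psi @` Y)].
  move=> oE dE dY dpsi cpsi drho crho hY.
  have [O [dO OY tO sO]] := stratum_exists sgB B1 sg1 cpsg oE dE dY dpsi cpsi drho crho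
    (fun y Yy => (hY y Yy).1) (fun y Yy => (hY y Yy).2).
  exists O; split=> //; first by apply: def_and => //; exact: def_not.
  move=> h; rewrite (_ : psi @` Y = psi @` O `|` psi @` (Y `\` O)).
    by apply: finite_unionU => //; exact: finite_union1.
  by rewrite -image_setU setDE setUIr setUv setIT; congr image; apply/esym/setUidPr.
have main d (j : 'I_l) (Y : set (Rn R d)) (psi : Rn R d -> G) (rho : G -> Rn R d) :
    def M Y -> dmap M psi -> cont_in Y psi -> dmap M rho -> cont_in (D j) rho ->
    (forall y, Y y -> D j (psi y) /\ rho (psi y) = y) ->
    finite_union C (psi @` Y).
  move=> dY dpsi cpsi drho crho hY; have [oD [dD _ _] _ _ _] := D_chart j.
  elim: d Y psi rho dY dpsi cpsi drho crho hY => [|d IH] Y psi rho dY dpsi cpsi drho crho hY.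
    have [O [dYO tO h]] := step _ _ Y psi rho oD dD dY dpsi cpsi drho crho hY; apply: h.
    have /= -> := (conn_thin_decomposition M_order M_ominimal 0).2 _ dYO tO.
    by rewrite image_set0; exact: finite_union0.
  have [O [dYO tO h]] := step _ _ Y psi rho oD dD dY dpsi cpsi drho crho hY; apply: h.
  have /= tYO := (conn_thin_decomposition M_order M_ominimal d.+1).2 _ dYO tO.
  apply: finite_union_image tYO _ => _ [Y' [th [rho' [dY' [dth cth] [drho' crho'] rK ->]]]] YO.
  have thY y : Y' y -> Y (th y) by move=> Yy; apply: (YO (th y) _).1; exists y.
  (* Retractions compose: [rho'] is continuous everywhere, so the composite is still continuous on
     the same open set [D j]. *)
  rewrite image_comp; apply: (IH Y' (psi \o th) (rho' \o rho)) => //.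
  - by rewrite /comp; solve_dmap.
  - exact: (cont_in_comp cth cpsi).
  - by rewrite /comp; solve_dmap.
  - by apply: (cont_in_comp (V := setT) crho) => //; exact: continuous_cont_in.
  - by move=> y Yy; rewrite /= (hY _ (thY _ Yy)).2 rK //; split=> //; exact: (hY _ (thY _ Yy)).1.
rewrite (_ : setT = [set g | exists2 q, (q < l)%N & (if insub q is Some j then D j else set0) g]); last first.
  apply/seteqP; split=> // g _; have [j Dg] := D_cover g.
  by exists (val j); [exact: ltn_ord|rewrite valK].
apply: finite_union_lt => q ql; rewrite insubT; set j := Sub _ _.
have [oD [dD dch de] eK oE [cch ce]] := D_chart j.
rewrite (_ : D j = e j @` (ch j @` D j)); last first.
  apply/seteqP; split=> [g Dg|_ [_ [g Dg <-] <-]]; last by rewrite eK.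
  by exists (ch j g); [exists g|exact: eK].
apply: (main k j _ (e j) (ch j)) => //; first by rewrite /image; solve_def.
by move=> _ [g Dg <-]; rewrite eK.
Qed.

End LocalSections.

Lemma finite_union_family (T : Type) (C : set T -> Prop) (X : set T) : finite_union C X ->
  exists q (P : 'I_q -> set T), (forall j, C (P j)) /\ X = \bigcup_j P j.
Proof.
elim=> [|P CP|P Q _ [q [P' [CP ->]]] _ [r [Q' [CQ ->]]]].
- exists 0%N, (fun=> set0); split; first by case.
  by apply/seteqP; split=> // x [] [].
- by exists 1%N, (fun=> P); split=> //; apply/seteqP; split=> [x Px|x [_ _]] //; exists ord0.
- exists (q + r)%N, (fun j => match fintype.split j with inl j => P' j | inr j => Q' j end); split.
    by move=> j; case: (fintype.split j).
  apply/seteqP; split=> [x [[j _ h]|[j _ h]]|x [j _]].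
  + by exists (lshift r j) => //; rewrite (unsplitK (inl _)).
  + by exists (rshift q j) => //; rewrite (unsplitK (inr _)).
  + by case: (fintype.split j) => j' h; [left|right]; exists j'.
Qed.

Lemma open_chartE (S T : topologicalType) (D : set S) (f : S -> T) (g : T -> S) :
  open D -> open (f @` D) -> cont_in D f -> cont_in (f @` D) g -> (forall x, D x -> g (f x) = x) ->
  forall V, V `<=` D -> (open V <-> open (f @` V)).
Proof.
move=> oD oE cf cg fK V VD; split=> oV.
  rewrite openE => _ [x Vx <-].
  have Ex : (f @` D) (f x) by exists x => //; exact: VD.
  have Vgx : nbhs (g (f x)) V by rewrite fK; [exact: open_nbhs_nbhs|exact: VD].
  have := cg _ Ex _ Vgx; have := open_nbhs_nbhs (conj oE Ex).
  apply: filterS2 => _ [y Dy <-] /(_ (ex_intro2 _ _ y Dy erefl)).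
  by rewrite fK // => Vy; exists y.
rewrite openE => x Vx; have Dx := VD x Vx.
have := cf x Dx _ (open_nbhs_nbhs (conj oV (imageP f Vx))).
have := open_nbhs_nbhs (conj oD Dx); apply: filterS2 => y Dy /(_ Dy) [z Vz e].
by rewrite -(fK y Dy) -e fK //; exact: VD.
Qed.

Lemma group_topology_open (H : topologicalGroupType) : group_topology (@open H).
Proof.
split; first split.
- exact: openT.
- by move=> V W; exact: openI.
- by move=> I F h; apply: bigcup_open => i _; exact: h.
- move=> x y W oW Wxy.
  have := @mulg_continuous H (x, y) W (open_nbhs_nbhs (conj oW Wxy)).
  move=> [[/= P Q] [/= hP hQ] h].
  exists P^°, Q^°; split; [exact: open_interior|exact: open_interior|exact: hP|exact: hQ|].
  by move=> u v /interior_subset Pu /interior_subset Qv; exact: (h (u, v)).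
- move=> W oW; apply: open_comp => // x _; exact: invg_continuous.
Qed.

(** * Charts of the extension *)

Section Atlas.
Variables (R : realType) (M : structure1 R).
Variables (G A Gt : topologicalGroupType) (i : A -> Gt) (p : Gt -> G).
Hypothesis ext : topological_central_extension i p.
Variables (coG : coded M G) (coA : coded M A) (coGt : coded M Gt).
Hypothesis dmulGt : dmap M (fun t : Gt * Gt => (t.1 * t.2)%g).
Hypotheses (di : dmap M i) (dp : dmap M p).

Let p_morph : {morph p : x y / (x * y)%g}. Proof. by case: ext => [[]]. Qed.
Let i_inj : injective i. Proof. by case: ext => [[]]. Qed.

Section Chart.
Variables (k kA : nat) (D : set G) (ch : G -> Rn R k) (e : Rn R k -> G).
Hypothesis D_chart : is_chart coG D ch e.
Variables (DA : set A) (chA : A -> Rn R kA) (eA : Rn R kA -> A).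
Hypothesis DA_chart : is_chart coA DA chA eA.
Variables (N : set G) (tau : G -> Gt).
Hypothesis N_section : section_over p coG coGt N tau.

Let oD : open D. Proof. by case: D_chart. Qed.
Let oN : open N. Proof. by case: N_section. Qed.
Let ctau : cont_in N tau. Proof. by case: N_section. Qed.
Let ptau g : N g -> p (tau g) = g. Proof. by case: N_section => _ _ _ _; apply. Qed.
Let cp W : cont_in W p.
Proof. by apply: continuous_cont_in; case: ext => _ _ _ _ []. Qed.

(** Over [N] the section [tau] trivializes [p]: y corresponds to the pair (al y, p y), and the
    charts of A and G apply to the two entries. *)
Lemma product_chart : exists (W : set Gt) (phi : Gt -> 'I_(kA + k) -> R),
  [/\ open W, set_inj W phi, def M (fun t => W t.1 /\ phi t.1 = t.2),
     forall V, V `<=` W -> (open V <-> open (phi @` V : set {ptws 'I_(kA + k) -> R})) &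
     forall a g, DA a -> D g -> N g -> W (i a * tau g)%g].
Proof.
have [_ [dD dch de] eK oE [cch ce]] := D_chart.
have [oDA [dDA dchA deA] eAK oEA [cchA ceA]] := DA_chart.
have [_ dN dtau _ _] := N_section.
pose Q y a := y = (i a * tau (p y))%g.
have dQ : def M (fun t => Q t.1 t.2) by rewrite /Q; solve_def.
have uQ y a b : Q y a -> Q y b -> a = b.
  by move=> h1 h2; apply: i_inj; apply: (mulIg (tau (p y))); exact: etrans (esym h1) h2.
have [al [dal alE _]] := dmap_choice 1%g dQ uQ.
have p_tau a g : N g -> p (i a * tau g)%g = g.
  by move=> Ng; rewrite p_morph (p_i ext) mul1g ptau.
have al_tau a g : N g -> al (i a * tau g)%g = a.
  by move=> Ng; apply: alE; rewrite /Q p_tau.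
have alK y : N (p y) -> (i (al y) * tau (p y))%g = y.
  move=> Ny; have [|a ea] := same_image ext (x := y) (y := tau (p y)); first by rewrite ptau.
  by rewrite (alE y a ea).
(* The product of y and the inverse of tau (p y) is i (al y) and varies continuously; continuity
   descends to [al] because [i] is an embedding. *)
have cal : cont_in [set y | N (p y)] al.
  move=> y Ny V; rewrite nbhsE => -[V0 [oV0 V0y] V0V].
  have [_ _ _ [_ /(_ V0 oV0) [V1 oV1 V1E]] _] := ext.
  have c : cont_in [set y | N (p y)] (fun y => y * (tau (p y))^-1)%g.
    apply: cont_in_mulg; first exact: cont_in_id.
    by apply: cont_in_invg; apply: (cont_in_comp (V := N)) (@cp _) ctau _.
  have iE x : N (p x) -> (x * (tau (p x))^-1)%g = i (al x) by move=> Nx; rewrite -{1}(alK x Nx) mulgK.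
  have := c y Ny V1; rewrite iE // => /(_ (open_nbhs_nbhs _)) h; apply: filterS (h _) => [x hx Nx|].
    by apply: V0V; rewrite V1E; have := hx Nx; rewrite iE.
  by split=> //; move: V0y; rewrite V1E.
pose W : set Gt := [set y | [/\ N (p y), D (p y) & DA (al y)]].
have WN : W `<=` [set y | N (p y)] by move=> y [].
have oW : open W.
  rewrite openE => y [Ny Dy DAy].
  have h1 := @cp setT y I _ (open_nbhs_nbhs (conj oN Ny)).
  have h2 := @cp setT y I _ (open_nbhs_nbhs (conj oD Dy)).
  have h3 := cal y Ny _ (open_nbhs_nbhs (conj oDA DAy)).
  by apply: filterS3 h1 h2 h3 => x /(_ I) Nx /(_ I) Dx h; split=> //; exact: h.
pose phi (y : Gt) (j : 'I_(kA + k)) : R := match fintype.split j with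
  | inl a => to_fun (chA (al y)) a | inr b => to_fun (ch (p y)) b end.
pose coA_of (f : 'I_(kA + k) -> R) : Rn R kA := of_fun (fun a => f (lshift k a)).
pose co_of (f : 'I_(kA + k) -> R) : Rn R k := of_fun (fun b => f (rshift kA b)).
pose psi (f : 'I_(kA + k) -> R) : Gt := (i (eA (coA_of f)) * tau (e (co_of f)))%g.
have coA_phi y : coA_of (phi y) = chA (al y).
  rewrite -[RHS](@to_funK R); congr of_fun; apply/funext => a.
  by rewrite /phi (unsplitK (inl _)).
have co_phi y : co_of (phi y) = ch (p y).
  rewrite -[RHS](@to_funK R); congr of_fun; apply/funext => a.
  by rewrite /phi (unsplitK (inr _)).
have psiK y : W y -> psi (phi y) = y.
  by move=> [Ny Dy DAy]; rewrite /psi coA_phi co_phi eAK // eK // alK.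
have ccA : continuous (coA_of : {ptws 'I_(kA + k) -> R} -> Rn R kA).
  apply: cont_in_setT; apply: (cont_in_comp (V := setT) (T := {ptws 'I_kA -> R})) (continuous_cont_in (@continuous_of_fun R kA)) _ => //.
  by apply: cont_in_ptws => a; exact: continuous_cont_in (@continuous_ptws_app _ _ _).
have cc : continuous (co_of : {ptws 'I_(kA + k) -> R} -> Rn R k).
  apply: cont_in_setT; apply: (cont_in_comp (V := setT) (T := {ptws 'I_k -> R})) (continuous_cont_in (@continuous_of_fun R k)) _ => //.
  by apply: cont_in_ptws => a; exact: continuous_cont_in (@continuous_ptws_app _ _ _).
pose E : set {ptws 'I_(kA + k) -> R} := [set f | (chA @` DA) (coA_of f) /\ ((ch @` D) (co_of f) /\ N (e (co_of f)))].
have phiW : phi @` W = E.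
  apply/seteqP; split=> [_ [y [Ny Dy DAy] <-]|f [[a DAa ea] [[g Dg eg] Nf]]].
    by rewrite /E /= coA_phi co_phi eK //; split; [exists (al y)|split=> //; exists (p y)].
  have Ng : N g by rewrite -(eK g Dg) eg.
  have eqf : phi (i a * tau g)%g = f.
    apply/funext => j; rewrite /phi; case: splitP => j' ej.
      by rewrite al_tau // ea of_funK; congr f; apply: val_inj.
    by rewrite p_tau // eg of_funK; congr f; apply: val_inj.
  by exists (i a * tau g)%g => //; rewrite /W /= p_tau // al_tau.
have oE' : open E.
  rewrite openE => f [Af [Df Nf]].
  have h1 : nbhs f (fun f' => (chA @` DA) (coA_of f')) by exact: (ccA f _ (open_nbhs_nbhs (conj oEA Af))).
  have h2 : nbhs f (fun f' => (ch @` D) (co_of f')) by exact: (cc f _ (open_nbhs_nbhs (conj oE Df))).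
  have h3 : nbhs f (fun f' => (ch @` D) (co_of f') -> N (e (co_of f'))).
    exact: (cc f _ (ce (co_of f) Df N (open_nbhs_nbhs (conj oN Nf)))).
  by apply: filterS3 h1 h2 h3 => f' A1 A2 A3; do 2 split=> //; exact: A3.
exists W, phi; split=> //.
- by move=> y y'; rewrite !inE => Wy Wy' eq; rewrite -(psiK y Wy) eq psiK.
- have dphi : dmap M phi.
    apply: (dmap_fun (f := phi)) => j; rewrite /phi; case: (fintype.split j) => j'.
      by have dtf := @dmap_to_fun _ M kA; solve_dmap.
    by have dtf := @dmap_to_fun _ M k; solve_dmap.
  apply: (def_iff (P := fun t => (N (p t.1) /\ D (p t.1) /\ DA (al t.1)) /\ phi t.1 = t.2)); last by solve_def.
  by move=> t; rewrite /W /=; split=> [[[? []]]|[[]]].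
- apply: (open_chartE (S := Gt) (T := {ptws 'I_(kA + k) -> R}) oW (g := psi)) => //; first by rewrite phiW.
  + apply: cont_in_ptws => j; rewrite /phi; case: (fintype.split j) => j'.
      apply: (cont_in_comp (V := DA) (f := al) (g := fun a => to_fun (chA a) j')); last by move=> y [].
        by move=> y Wy P /(cal y (WN y Wy)); apply: filterS => y' h /WN.
      apply: (cont_in_comp (V := setT) cchA (g := fun x => to_fun x j')) => //.
      apply: (cont_in_comp (V := setT) (T := {ptws 'I_kA -> R}) (g := fun f => f j') (continuous_cont_in (@continuous_to_fun R kA))) => //.
      exact: continuous_cont_in (@continuous_ptws_app _ _ _).
    apply: (cont_in_comp (V := D) (f := p) (g := fun a => to_fun (ch a) j')) => //; last by move=> y [].
    apply: (cont_in_comp (V := setT) cch (g := fun x => to_fun x j')) => //.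
    apply: (cont_in_comp (V := setT) (T := {ptws 'I_k -> R}) (g := fun f => f j') (continuous_cont_in (@continuous_to_fun R k))) => //.
    exact: continuous_cont_in (@continuous_ptws_app _ _ _).
  + rewrite phiW; apply: cont_in_mulg.
      apply: (cont_in_comp (S := {ptws 'I_(kA + k) -> R}) (V := setT) (f := fun f => eA (coA_of f)) (g := i)) => //.
        apply: (cont_in_comp (V := chA @` DA)) (continuous_cont_in ccA) ceA _; by move=> f [].
      by apply: continuous_cont_in; case: ext => _ _ _ [].
    apply: (cont_in_comp (S := {ptws 'I_(kA + k) -> R}) (V := N) (f := fun f => e (co_of f))) ctau _; last by move=> f [_ []].
    by apply: (cont_in_comp (V := ch @` D)) (continuous_cont_in cc) ce _ => f [_ []].
- by move=> a g DAa Dg Ng; rewrite /W /= p_tau // al_tau.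
Qed.

End Chart.
End Atlas.

Section ProductAtlas.
Variables (R : realType) (M : structure1 R).
Variables (G A Gt : topologicalGroupType) (i : A -> Gt) (p : Gt -> G).
Hypothesis ext : topological_central_extension i p.
Variables (coG : coded M G) (coA : coded M A) (coGt : coded M Gt).
Hypothesis dmulGt : dmap M (fun t : Gt * Gt => (t.1 * t.2)%g).
Hypotheses (di : dmap M i) (dp : dmap M p).
Variables (k l : nat) (D : 'I_l -> set G) (ch : 'I_l -> G -> Rn R k) (e : 'I_l -> Rn R k -> G).
Hypothesis D_cover : forall g, exists j, D j g.
Hypothesis D_chart : forall j, is_chart coG (D j) (ch j) (e j).
Variables (kA lA : nat) (DA : 'I_lA -> set A) (chA : 'I_lA -> A -> Rn R kA) (eA : 'I_lA -> Rn R kA -> A).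
Hypothesis DA_cover : forall a, exists j, DA j a.
Hypothesis DA_chart : forall j, is_chart coA (DA j) (chA j) (eA j).
Hypothesis sections : finite_union
  (fun P => exists N tau, section_over p coG coGt N tau /\ P `<=` N) [set: G].

(** One chart for each triple of a chart of A, a chart of G and a local section, all of the same
    dimension. *)
Lemma product_topology_ominimal : ominimal_topology M (@cod _ _ _ _ coGt) (@open Gt).
Proof.
split; first exact: group_topology_open.
have [q [P [hP covP]]] := finite_union_family sections.
have /choice [N hN] := hP.
have /choice [tau htau] := hN.
pose I : finType := ('I_lA * 'I_l * 'I_q)%type.
have /choice [u hu] : forall x : I, exists u : set Gt * (Gt -> 'I_(kA + k) -> R),
  [/\ open u.1, set_inj u.1 u.2, def M (fun t => u.1 t.1 /\ u.2 t.1 = t.2),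
     forall V, V `<=` u.1 -> (open V <-> open (u.2 @` V : set {ptws 'I_(kA + k) -> R})) &
     forall a g, DA x.1.1 a -> D x.1.2 g -> N x.2 g -> u.1 (i a * tau x.2 g)%g].
  move=> x; have [W [phi h]] := product_chart ext dmulGt di dp (D_chart x.1.2) (DA_chart x.1.1) (htau x.2).1.
  by exists (W, phi).
exists (kA + k)%N, #|I|, (fun j => (u (enum_val j)).1), (fun j => (u (enum_val j)).2); split.
  move=> y; have [jD Dy] := D_cover (p y).
  have [jP _ Py] : (\bigcup_j P j) (p y) by rewrite -covP.
  have [[_ _ _ _ ptau] PN] := htau jP; have Ny := PN _ Py.
  have [a ya] : exists a, y = (i a * tau jP (p y))%g by apply: (same_image ext); rewrite ptau.
  have [jA DAa] := DA_cover a.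
  by exists (enum_rank ((jA, jD, jP) : I)); rewrite enum_rankK ya; have [_ _ _ _] := hu (jA, jD, jP); apply.
by move=> j; have [oW inj dW hV _] := hu (enum_val j); split.
Qed.

End ProductAtlas.

(** Serves the compatibility of the two codings: [q] and [j0] locate the word and the element of A
    among the coordinates of the quotient presentation. *)
Lemma def_cover_map (R : realType) (M : structure1 R) (G A Gt : topologicalGroupType)
    (coG : coded M G) (coA : coded M A) (coGt : coded M Gt) (i : A -> Gt) (n : nat)
    (F : ('I_n -> G) -> Gt) (I J : finType) (q : 'I_n -> I) (j0 : J) :
  dmap M (fun t : Gt * Gt => (t.1 * t.2)%g) -> dmap M i -> dmap M F ->
  def M (fun t : ((I -> G) * (J -> A)) * Gt => (i (t.1.2 j0) * F (fun j => t.1.1 (q j)))%g = t.2).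
Proof.
move=> dmul di dF.
have dz : dmap M (fun t : ((I -> G) * (J -> A)) * Gt => fun j => t.1.1 (q j)) by solve_dmap.
have da : dmap M (fun t : ((I -> G) * (J -> A)) * Gt => t.1.2 j0) by solve_dmap.
by solve_def.
Qed.

Theorem theorem2p8
  (R : realType) (M : structure1 R)
  (M_order : expansion (order_structure R) M)
  (M_ominimal : ominimal M)
  (G : topologicalGroupType) (cG : coding1 R G)
  (G_definable : definable_group M cG)
  (G_topology : ominimal_topology M cG (@open G))
  (A Gt : topologicalGroupType) (i : A -> Gt) (p : Gt -> G)
  (E_extension : topological_central_extension i p)
  (bG : structure1 G)
  (bG_expansion : expansion (group_structure G) bG)
  (bG_rho : property_rho M cG bG)
  (E_finite : forall n : nat,
     finite_set (range i `&` commutator_products Gt n))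
  (G_products : exists r : nat, [set: G] = commutator_products G r) :
  exists (Gt' : groupType) (i' : A -> Gt') (p' : Gt' -> G)
         (c' : coding (carrier2 G A) Gt') (f : Gt -> Gt'),
    [/\ interpretable_extension (two_sorted bG (group_structure A))
          (self_A G A) c' (self_G G A) i' p',
        {morph f : x y / (x * y)%g} /\ bijective f,
        forall x, f (i x) = i' x,
        forall y, p' (f y) = p y &
        forall cA : coding1 R A,
          definable_group M cA -> ominimal_topology M cA (@open A) ->
          exists (c : coding1 R Gt') (op : set_system Gt'),
            [/\ definable_group M c,
                interpretable_extension M cA c cG i' p',
                compatible_coding M cG cA c c',
                ominimal_topology M c op &
                forall W : set Gt, open W <-> op (f @` W)]].
Proof.
case: bG_expansion bG_rho => N1 -> rho {bG}.
have [r hr] := G_products.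
have F_onto y : exists a z, y = (i a * word_lift E_extension (n := r) z)%g by apply: word_lift_surj; rewrite -hr.
pose coG := coded_group G_definable.1.
have [k [l [D [ch [e [D_cover D_chart]]]]]] := definable_group_charts G_definable G_topology.
have pG := parametrized_charts D_cover D_chart.
have dmulG : dmap M (cT := coded_prod coG coG) (cT' := coG) (fun t : G * G => (t.1 * t.2)%g) := dmap_mulg0 G_definable.1.
have dX := def_word3 r dmulG.
have F_const := F3_const E_extension E_finite (n := r).
have gX := def_word3 r (dmap_mulg_group_structure G).
(* The level sets are needed twice: in [M] for the definable section, and in the two-sorted
   structure for the presentation of the extension. *)
have dl v := def_level M_order M_ominimal pG dX F_const (i v).
have gl v := def_transfer 1%g 1%g (group_structure A)
  (definable_in_level M_order M_ominimal pG dX F_const (i v) rho gX).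
have [hc hi hp] := interpretable_cover E_finite gl (dmap_mulg_G 1%g N1 _) (dmap_mulg_A 1%g A _) F_onto.
have exE : exact_sequence i p by have [] := E_extension.
(* The group is kept and only its coding is new, as a quotient of G^2r x A. *)
exists Gt, i, p, (cover_coding E_extension r 
  (coded_G 1%g 1%g (join_structure (group_structure G) N1) (group_structure A))
  (coded_A 1%g 1%g (join_structure (group_structure G) N1) (group_structure A))), id.
split=> //; first by split=> //; exists id.
move=> cA A_definable A_topology.
pose coA := coded_group A_definable.1.
have dmulA := dmap_mulg0 A_definable.1.
have [s [s_lift ds]] := definable_section M_order M_ominimal E_finite coA dmulG pG F_onto dl.
have Gt_int := section_interpretable E_finite dmulA dl s_lift ds.
have dmulGt := dmap_mulg0 Gt_int.
have di := dmap_i E_finite dmulA dl s_lift ds.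
have dp := dmap_p E_finite dmulA dl s_lift ds.
have dF := dmap_word_lift E_finite dmulA dl s_lift ds.
have dS := dmap_s E_finite dmulA dl s_lift ds.
have [kA [lA [DA [chA [eA [DA_cover DA_chart]]]]]] := definable_group_charts A_definable A_topology.
have sec := finite_section_cover M_order M_ominimal E_finite dmulG dmulGt dF D_cover D_chart s_lift dS.
(* A definable group must be coded injectively, which the quotient presentation is not; the coding
   by the section is. The topology is the given one, so what remains is to find an atlas for it. *)
exists (section_coding i coG coA s), (@open Gt); split.
- by split=> //; apply: (set_inj_section s_lift); [exact: A_definable.2|exact: G_definable.2].
- by split.
(* These index types are the coordinates of sort G and of sort A in [cover_coding], with the empty
   summands and factors left by pairing the two one-sorted codings. *)
- have h := def_cover_map (I := ('I_(r + r) * unit + void)%type) (J := ('I_(r + r) * void + unit)%type)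
    (fun j => inl (j, tt)) (inr tt) dmulGt di dF.
  by apply: definable_in_iff h => t; split=> [?|[]].
- exact: (product_topology_ominimal E_extension dmulGt di dp D_cover D_chart DA_cover DA_chart sec).
- by move=> W; rewrite image_id.
Qed.
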